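(* Suppose that $\mathbf v=(v_1,v_2)\in H^1_{loc}(\mathbb R^2)\cap C(\mathbb R^2)$ is a solution of the steady Euler system $$\mathbf v\cdot\nabla\mathbf v+\nabla P=0,\qquad \operatorname{div}\mathbf v=0\qquad\text{in }\mathbb R^2 .$$ Assume there exists a constant $C>0$ such that $$\sup_{|x|\le R}|\mathbf v(x)|\le C\sqrt{\log R}\quad\text{for all } R>100.$$ Then the following statements hold: (i) If there exist $\theta_0\in\mathbb R$ and $\beta\in(0,\pi)$ such that $\Theta(\mathbf v;\mathbb R^2)\subset\mathcal S_{\theta_0,\beta}$, then $\mathbf v$ is a shear flow. (ii) If $\mathbf v\in W^{2,1}_{loc}(\mathbb R^2)$, then either $\mathbf v$ is a shear flow, or $\Theta(\mathbf v;\mathbb R^2)=S^1$.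
   Context: Being a solution means that there is a distribution $P$ (the pressure) on $\mathbb R^2$ such that the equations hold in the sense of distributions. A (parallel) shear flow is a flow whose streamlines are parallel lines, i.e. $\mathbf v(x)=V(x\cdot\mathbf e^\perp)\,\mathbf e$ for some unit vector $\mathbf e=(e_1,e_2)$, $\mathbf e^\perp=(-e_2,e_1)$, and some scalar function $V$ of one variable (the case $\mathbf v\equiv0$ is included). For a vector field $\mathbf u$ on a set $D$, the set of flow angles is $$\Theta(\mathbf u;D)=\left\{\tfrac{\mathbf u(x)}{|\mathbf u(x)|}: x\in D,\ |\mathbf u(x)|>0\right\}\subset S^1 .$$ For $\theta_0\in\mathbb R$ and $\beta\in(0,\pi)$, $$\mathcal S_{\theta_0,\beta}=\{(\cos\theta,\sin\theta)\in S^1: -\pi+\beta+\theta_0\le\theta\le\pi-\beta+\theta_0\}.$$ *)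

(* Defs.v *)
From HB Require Import structures.
From mathcomp Require Import all_boot all_order all_algebra.
From mathcomp Require Import all_classical all_reals all_analysis.

Set Implicit Arguments.
Unset Strict Implicit.
Unset Printing Implicit Defensive.

Import Order.TTheory GRing.Theory Num.Theory.
Import numFieldNormedType.Exports.

Local Open Scope classical_set_scope.
Local Open Scope ring_scope.

(* The plane is the product [R * R].  Its library norm is the max norm, so the
   Euclidean norm is introduced separately. *)
Definition enorm (R : realType) (x : R * R) : R :=
  Num.sqrt (x.1 ^+ 2 + x.2 ^+ 2).

Definition unit_circle (R : realType) : set (R * R) :=
  [set x | enorm x = 1].

Definition lebesgue2 (R : realType) :
    {measure set (measurableTypeR R * measurableTypeR R) -> \bar R} :=
  (@lebesgue_measure R \x @lebesgue_measure R)%E.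

Definition axis1 (R : realType) : R * R := (1, 0).
Definition axis2 (R : realType) : R * R := (0, 1).

Definition pder (R : realType) (e : R * R) (phi : R * R -> R) : R * R -> R :=
  fun x => 'D_e phi x.

Fixpoint Ck (R : realType) (k : nat) (phi : R * R -> R) : Prop :=
  match k with
  | 0 => continuous phi
  | k'.+1 =>
      [/\ continuous phi,
          forall x, derivable phi x (axis1 R) /\ derivable phi x (axis2 R),
          Ck k' (pder (axis1 R) phi) &
          Ck k' (pder (axis2 R) phi)]
  end.

Definition supp (R : realType) (phi : R * R -> R) : set (R * R) :=
  closure [set x | phi x != 0].

Definition test_function (R : realType) (phi : R * R -> R) : Prop :=
  (forall k, Ck k phi) /\ compact (supp phi).

(* Sum over |alpha| <= N of sup |d^alpha phi|; the suprema are finite, hence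
   meaningful for the real-valued [sup], when phi is a test function. *)
Definition test_seminorm (R : realType) (N : nat) (phi : R * R -> R) : R :=
  \sum_(a < N.+1) \sum_(b < N.+1 | (a + b <= N)%N)
    sup (range (fun x : R * R =>
      `|iter a (pder (axis1 R)) (iter b (pder (axis2 R)) phi) x|)).

(* A distribution is represented by a functional on all functions, of which
   only the values on test functions are constrained and used. *)
Definition is_distribution (R : realType) (T : (R * R -> R) -> R) : Prop :=
  (forall (a : R) (phi psi : R * R -> R),
      test_function phi -> test_function psi ->
      T (fun x => a * phi x + psi x) = a * T phi + T psi) /\
  (forall K : set (R * R), compact K ->
      exists (C : R) (N : nat), forall phi : R * R -> R,
        test_function phi -> supp phi `<=` K ->
        `|T phi| <= C * test_seminorm N phi).

Definition distr_of (R : realType) (f : R * R -> R) (phi : R * R -> R) : R :=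
  \int[lebesgue2 R]_x (f x * phi x).

Definition distr_der (R : realType) (e : R * R) (T : (R * R -> R) -> R)
    (phi : R * R -> R) : R :=
  - T (pder e phi).

(* Borel representatives are used: every Lebesgue measurable function agrees
   almost everywhere with a Borel one. *)
Definition Lloc (R : realType) (p : \bar R) (f : R * R -> R) : Prop :=
  measurable_fun [set: R * R] f /\
  forall K : set (R * R), compact K -> finite_norm (lebesgue2 R) p (f \_ K).

Definition weak_der (R : realType) (e : R * R) (f g : R * R -> R) : Prop :=
  [/\ Lloc 1%E f, Lloc 1%E g &
      forall phi, test_function phi ->
        distr_der e (distr_of f) phi = distr_of g phi].

Fixpoint Wloc (R : realType) (k : nat) (p : \bar R) (f : R * R -> R) : Prop :=
  match k with
  | 0 => Lloc p f
  | k'.+1 =>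
      Lloc p f /\
      exists g1 g2 : R * R -> R,
        [/\ weak_der (axis1 R) f g1, weak_der (axis2 R) f g2,
            Wloc k' p g1 & Wloc k' p g2]
  end.

Definition Wloc_field (R : realType) (k : nat) (p : \bar R)
    (v : R * R -> R * R) : Prop :=
  Wloc k p (fun x => (v x).1) /\ Wloc k p (fun x => (v x).2).

Definition H1loc (R : realType) (v : R * R -> R * R) : Prop :=
  Wloc_field 1 2%:E v.

Definition weak_grad (R : realType) (f : R * R -> R) (g : R * R -> R * R) :
    Prop :=
  weak_der (axis1 R) f (fun x => (g x).1) /\
  weak_der (axis2 R) f (fun x => (g x).2).

Definition dot (R : realType) (x y : R * R) : R := x.1 * y.1 + x.2 * y.2.

(* v . grad v is the function built from the weak gradients [g1], [g2] of the
   two components, which are unique up to null sets; it is locally integrable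
   when v is continuous. *)
Definition steady_euler (R : realType) (v : R * R -> R * R) : Prop :=
  exists P : (R * R -> R) -> R, is_distribution P /\
  exists g1 g2 : R * R -> R * R,
    [/\ weak_grad (fun x => (v x).1) g1,
        weak_grad (fun x => (v x).2) g2 &
        forall phi, test_function phi ->
          [/\ distr_of (fun x => dot (v x) (g1 x)) phi
                + distr_der (axis1 R) P phi = 0,
              distr_of (fun x => dot (v x) (g2 x)) phi
                + distr_der (axis2 R) P phi = 0 &
              distr_der (axis1 R) (distr_of (fun x => (v x).1)) phi
                + distr_der (axis2 R) (distr_of (fun x => (v x).2)) phi = 0]].

Definition perp (R : realType) (e : R * R) : R * R := (- e.2, e.1).

Definition shear_flow (R : realType) (v : R * R -> R * R) : Prop :=
  exists2 e : R * R, unit_circle e &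
  exists V : R -> R, forall x,
    v x = (V (dot x (perp e)) * e.1, V (dot x (perp e)) * e.2).

Definition flow_angles (R : realType) (u : R * R -> R * R) (D : set (R * R)) :
    set (R * R) :=
  [set ((u x).1 / enorm (u x), (u x).2 / enorm (u x)) |
     x in [set x | D x /\ 0 < enorm (u x)]].

Definition arc_set (R : realType) (theta0 beta : R) : set (R * R) :=
  [set (cos theta, sin theta) |
     theta in [set theta | - pi + beta + theta0 <= theta <= pi - beta + theta0]].

(* Main.v *)
(** Both statements follow from one fact: if some unit direction is missed by the
    flow angles, then [v] is a shear flow.

    The field [J = v1 grad v2 - v2 grad v1 = |v|^2 grad (angle of v)] is divergence
    free, by incompressibility and the vorticity equation (the curl of the Euler
    system, which eliminates the pressure).  When a direction is missed, the angle is
    a bounded single-valued function wherever [v] does not vanish; testing [div J = 0]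
    against it, truncated near the zeros of [v] and multiplied by a cutoff [h], bounds
    the integral of [|J|^2 / |v|^2] by that of [|v|^2 |grad h|^2].  The growth
    [|v|^2 = O(log R)] allows logarithmic cutoffs for which the latter is arbitrarily
    small, because the harmonic series diverges.  Since [v] is only weakly
    differentiable, this is carried out for mollifications of [v].

    Hence the direction of [v] is locally constant where [v] does not vanish, and by
    incompressibility [v] is constant along the lines carrying that direction, so along
    whole lines by connectedness.  Two such lines carrying different directions would
    meet, so all directions agree. *)

Require Import Defs.
From HB Require Import structures.
From mathcomp Require Import all_boot all_order all_algebra.
From mathcomp Require Import all_classical all_reals all_analysis.
From mathcomp Require Import ring lra measurable_realfun.
Import Order.TTheory GRing.Theory Num.Theory.
Import numFieldNormedType.Exports.
Local Open Scope classical_set_scope.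
Local Open Scope ring_scope.

Set Implicit Arguments.
Unset Strict Implicit.
Unset Printing Implicit Defensive.

(** By incompressibility [J = (v . grad v2, - v . grad v1)], so [div J] is the curl of the
    convection term and [J] itself involves only first weak derivatives of [v]. The obstacle is that
    mollification does not commute with the product defining [J]. Hence two fields occur: the one
    built from the mollified velocity, which is tied to the gradient of the mollified angle, and the
    mollification of [J], which is exactly divergence free. Their difference is controlled by the
    oscillation of [v] at the mollification scale times the [L^2] norm of its gradient. The order of
    choices is forced: the cutoff [h] depends only on the growth bound; then the truncation level
    [E] is taken small on the box carrying [h], using that [s * dchi E s] is bounded and tends to 0
    with [E]; the mollification radius comes last, since its errors carry a factor [1 / E]. To
    extract local constancy, the tangent of the angle with a fixed nonzero velocity replaces the
    angle: it is a rational function of the velocity. *)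

(** * Rectangles, Lebesgue measure and measurability in the plane *)

Definition rect (R : realType) (a b c d : R) : set (R * R) := [set z | a <= z.1 <= b /\ c <= z.2 <= d].

Lemma rectE (R : realType) (a b c d : R) : rect a b c d = `[a, b] `*` `[c, d].
Proof. by apply/seteqP; split => z /=; rewrite /rect/= !in_itv. Qed.

Lemma measurable_rect (R : realType) (a b c d : R) :
  measurable (rect a b c d : set (measurableTypeR R * measurableTypeR R)%type).
Proof. by rewrite rectE; exact: measurableX. Qed.

Lemma lebesgue2_rect (R : realType) (a b c d : R) : a <= b -> c <= d ->
  lebesgue2 R (rect a b c d) = ((b - a) * (d - c))%:E.
Proof.
move=> ab cd; rewrite rectE.
have -> : lebesgue2 R (`[a, b] `*` `[c, d]) = (lebesgue_measure (`[a, b]%classic : set R) * lebesgue_measure (`[c, d]%classic : set R))%E.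
  by rewrite -(@product_measure1E _ _ _ _ R lebesgue_measure lebesgue_measure).
have itv (u w : R) : u <= w -> lebesgue_measure (`[u, w]%classic : set R) = (w - u)%:E.
  rewrite le_eqVlt lebesgue_measure_itv/= lte_fin => /predU1P[->|uw].
    by rewrite ltxx subrr.
  by rewrite uw EFinB.
by rewrite !itv.
Qed.

Lemma compact_rect (R : realType) (a b c d : R) : compact (rect a b c d).
Proof. by rewrite rectE; apply: compact_setX; exact: segment_compact. Qed.

Lemma rect_sub (R : realType) (a b c d a' b' c' d' : R) : a <= a' -> b' <= b -> c <= c' -> d' <= d ->
  rect a' b' c' d' `<=` rect a b c d.
Proof.
move=> aa bb cc dd z [/andP[h1 h2] /andP[h3 h4]]; split; apply/andP; split.
- exact: le_trans aa h1.
- exact: le_trans h2 bb.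
- exact: le_trans cc h3.
- exact: le_trans h4 dd.
Qed.

Lemma lebesgue2_sigma_finite (R : realType) : sigma_finite setT (lebesgue2 R).
Proof.
exists (fun n => rect (- n%:R) n%:R (- n%:R) n%:R).
  apply/seteqP; split => // -[x y] _.
  have h : `|x| + `|y| < (Num.truncn (`|x| + `|y|)).+1%:R by rewrite truncnS_gt.
  exists (Num.truncn (`|x| + `|y|)).+1 => //=.
  have := ler_norm x; have := ler_norm y; have := ler_norm (- x); have := ler_norm (- y).
  rewrite !normrN => *; split => /=; apply/andP; split; lra.
move=> n; split; first exact: measurable_rect.
have n0 : (0 : R) <= n%:R by rewrite ler0n.
by rewrite lebesgue2_rect ?ltry//; lra.
Qed.

(* A copy of [lebesgue2] that carries a sigma-finite measure structure; the two are convertible. *)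
Definition plane (R : realType) : set (measurableTypeR R * measurableTypeR R)%type -> \bar R :=
  lebesgue2 R.
HB.instance Definition _ (R : realType) := isMeasure.Build _ _ _ (@plane R)
  (measure0 (lebesgue2 R)) (measure_ge0 (lebesgue2 R)) (@measure_semi_sigma_additive _ _ _ (lebesgue2 R)).
HB.instance Definition _ (R : realType) := Measure_isSigmaFinite.Build _ _ _ (@plane R)
  (@lebesgue2_sigma_finite R).

(** The measurable structure is the product one, not the one generated by open sets; the two are
    linked by writing an open set as a countable union of open rectangles with rational corners. *)
Lemma open_measurable_plane (R : realType) (U : set (R * R)) : open U ->
  measurable (U : set (measurableTypeR R * measurableTypeR R)%type).
Proof.
move=> oU.
pose r (q : rat * rat * (rat * rat)) : set (R * R) := 
  [set z | ratr q.1.1 < z.1 < ratr q.1.2 /\ ratr q.2.1 < z.2 < ratr q.2.2 ].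
have mr q : measurable (r q : set (measurableTypeR R * measurableTypeR R)%type).
  rewrite [r q](_ : _ = ([set` `]ratr q.1.1, ratr q.1.2[ ] `*` [set` `]ratr q.2.1, ratr q.2.2[ ])); last first.
    by apply/seteqP; split => z /=; rewrite /r/= !in_itv.
  exact: measurableX.
have -> : U = \bigcup_(q in [set q | r q `<=` U]) r q.
  apply/seteqP; split => [z Uz|z [q /= qU rz]]; last exact: qU.
  have /nbhs_ballP[e/= e0 eU] : nbhs z U by exact: open_nbhs_nbhs.
  have H (t : R) : exists p : rat * rat, [/\ ratr p.1 < t < ratr p.2, t - e < ratr p.1 & ratr p.2 < t + e].
    have [p] : exists p, ratr p \in `]t - e, t[ by apply: rat_in_itvoo; lra.
    have [q] : exists p, ratr p \in `]t, t + e[ by apply: rat_in_itvoo; lra.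
    rewrite !in_itv/= => /andP[a b] /andP[c d]; exists (p, q); split => //=.
    by rewrite d a.
  have [p [/andP[p1 p1'] p2 p3]] := H z.1; have [q [/andP[q1 q1'] q2 q3]] := H z.2.
  exists (p, q) => /=; last by rewrite /r/= p1 p1' q1 q1'.
  move=> w [/=/andP[w1 w2] /andP[w3 w4]].
  apply: eU; split => /=; rewrite /ball/= ltr_distl; apply/andP; split; lra.
rewrite bigcup_mkcond; apply: countable_bigcupT_measurable => [|q].
  exact: countableP.
by case: ifP.
Qed.

Lemma continuous_measurable_plane (R : realType) (f : R * R -> R) : continuous f ->
  measurable_fun setT (f : (measurableTypeR R * measurableTypeR R)%type -> R).
Proof.
move=> cf; apply: (measurability _ (measurable_realfun.RGenOpens.measurableE R)).
move=> _ [_ [a [b ->]] <-]; rewrite setTI; apply: open_measurable_plane.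
by apply: open_comp => // + _; exact: cf.
Qed.

(** Continuity is that of [f] on the plane at the points of [D], so within [D] the preimage of an
    open interval may be replaced by its interior, which is open. *)
Lemma continuous_on_measurable_plane (R : realType) (D : set (R * R)) (f : R * R -> R) :
  measurable (D : set (measurableTypeR R * measurableTypeR R)%type) ->
  {in D, continuous f} ->
  measurable_fun D (f : (measurableTypeR R * measurableTypeR R)%type -> R).
Proof.
move=> mD cf; apply: (measurability _ (measurable_realfun.RGenOpens.measurableE R)).
move=> _ [_ [a [b ->]] <-].
rewrite [X in measurable X](_ : _ = D `&` (f @^-1` `]a, b[)^°); last first.
  apply/seteqP; split => z [Dz fz]; split => //.
    by apply: (cf z); [exact/mem_set|apply: open_nbhs_nbhs].
  exact: nbhs_singleton fz.
by apply: measurableI => //; apply: open_measurable_plane; exact: open_interior.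
Qed.

(** * Continuity and derivatives at a point *)

(** Pointwise, because the angle of a vector field is continuous only at the points where the field
    avoids a half-line. *)
Definition cont_at (R : realType) (T : topologicalType) (f : T -> R) (x : T) : Prop :=
  f y @[y --> x] --> f x.

Section cont_at_theory.
Variables (R : realType) (T : topologicalType).
Implicit Types (f g : T -> R) (x : T).

Lemma cont_at_cst (c : R) x : cont_at (fun=> c) x.
Proof. exact: cvg_cst. Qed.

Lemma cont_at_ext f g x : f =1 g -> cont_at f x -> cont_at g x.
Proof. by move=> /funext ->. Qed.

Lemma cont_atD f g x : cont_at f x -> cont_at g x -> cont_at (fun t => f t + g t) x.
Proof. by move=> hf hg; exact: (cvgD hf hg). Qed.

Lemma cont_atN f x : cont_at f x -> cont_at (fun t => - f t) x.
Proof. by move=> hf; exact: (cvgN hf). Qed.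

Lemma cont_atB f g x : cont_at f x -> cont_at g x -> cont_at (fun t => f t - g t) x.
Proof. by move=> hf hg; exact: (cvgB hf hg). Qed.

Lemma cont_atM f g x : cont_at f x -> cont_at g x -> cont_at (fun t => f t * g t) x.
Proof. by move=> hf hg; exact: (cvgM hf hg). Qed.

Lemma cont_atX f n x : cont_at f x -> cont_at (fun t => f t ^+ n) x.
Proof.
move=> hf; elim: n => [|n ih].
  exact: cont_at_cst.
apply: (@cont_at_ext (fun t => f t * f t ^+ n)) => [t|]; first by rewrite exprS.
exact: cont_atM.
Qed.

Lemma cont_atV f x : f x != 0 -> cont_at f x -> cont_at (fun t => (f t)^-1) x.
Proof. by move=> fx0 hf; exact: (cvgV fx0 hf). Qed.

Lemma cont_at_norm f x : cont_at f x -> cont_at (fun t => `|f t|) x.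
Proof. by move=> hf; exact: (cvg_norm hf). Qed.

Lemma cont_at_max f g x : cont_at f x -> cont_at g x -> cont_at (fun t => Num.max (f t) (g t)) x.
Proof.
move=> hf hg.
have e a b : Num.max a b = (a + b + `|a - b|) * 2^-1 :> R.
  by case: (lerP a b) => _; field.
apply: (@cont_at_ext (fun t => (f t + g t + `|f t - g t|) * 2^-1)) => [t|]; first by rewrite -e.
apply: cont_atM; last exact: cont_at_cst.
apply: cont_atD; first exact: cont_atD.
by apply: cont_at_norm; exact: cont_atB.
Qed.

Lemma cont_at_sum (I : Type) (r : seq I) (f : I -> T -> R) x :
  (forall i, cont_at (f i) x) -> cont_at (fun t => \sum_(i <- r) f i t) x.
Proof.
move=> h; elim: r => [|i r ih].
  by apply: (@cont_at_ext (fun=> 0)) => [t|]; [rewrite big_nil|exact: cont_at_cst].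
apply: (@cont_at_ext (fun t => f i t + \sum_(i <- r) f i t)) => [t|]; first by rewrite big_cons.
exact: cont_atD.
Qed.

Lemma cont_at_near f g x : (\near x, f x = g x) -> cont_at f x -> cont_at g x.
Proof.
move=> h hf; rewrite /cont_at -(nbhs_singleton h).
apply: cvg_trans hf; exact: near_eq_cvg.
Qed.

End cont_at_theory.

Lemma cont_at_comp (R : realType) (S T : topologicalType) (f : S -> T) (g : T -> R) (x : S) :
  f y @[y --> x] --> f x -> cont_at g (f x) -> cont_at (fun t => g (f t)) x.
Proof. by move=> hf hg; exact: (cvg_comp _ _ hf hg). Qed.

Lemma cont_at_comp1 (R : realType) (S : topologicalType) (f : S -> R) (g : R -> R) (x : S) :
  cont_at f x -> cont_at g (f x) -> cont_at (fun t => g (f t)) x.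
Proof. exact: cont_at_comp. Qed.

Lemma cont_at_comp2 (R : realType) (S : topologicalType) (p q : S -> R) (G : R * R -> R) (x : S) :
  cont_at p x -> cont_at q x -> cont_at G (p x, q x) -> cont_at (fun t => G (p t, q t)) x.
Proof.
move=> hp hq hG.
have hpq : (fun t => (p t, q t)) y @[y --> x] --> (p x, q x) .
  exact: (cvg_pair hp hq).
exact: (cont_at_comp hpq hG).
Qed.

Lemma cont_at_fst (R : realType) (x : R * R) : cont_at (fun z : R * R => z.1) x.
Proof. exact: cvg_fst. Qed.

Lemma cont_at_snd (R : realType) (x : R * R) : cont_at (fun z : R * R => z.2) x.
Proof. exact: cvg_snd. Qed.

(** The value of the derivative is an argument, so that it can be produced by the rules in one form
    and brought by [ring] or [field] to another through [has_der_eq]. *)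
Definition has_der (R : realType) (f : R -> R) (x l : R) : Prop :=
  is_derive (x : R) (1 : R) f l.

Section has_der_theory.
Variable R : realType.
Implicit Types (f g : R -> R) (x a b : R).

Lemma has_der_eq f x a b : has_der f x a -> a = b -> has_der f x b.
Proof. by move=> h <-. Qed.

Lemma has_der_ext f g x a : f =1 g -> has_der f x a -> has_der g x a.
Proof. by move=> /funext ->. Qed.

Lemma has_der_near f g x a : (\near x, f x = g x) -> has_der f x a -> has_der g x a.
Proof. exact: near_eq_is_derive. Qed.

Lemma has_der_uniq f x a b : has_der f x a -> has_der f x b -> a = b.
Proof. by move=> [_ <-] [_ <-]. Qed.

Lemma has_der_cst (c : R) x : has_der (fun=> c) x 0.
Proof. exact: is_derive_cst. Qed.

Lemma has_der_id x : has_der (fun t => t) x 1.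
Proof. exact: is_derive_id. Qed.

Lemma has_derD f g x a b : has_der f x a -> has_der g x b ->
  has_der (fun t => f t + g t) x (a + b).
Proof. exact: is_deriveD. Qed.

Lemma has_derN f x a : has_der f x a -> has_der (fun t => - f t) x (- a).
Proof. exact: is_deriveN. Qed.

Lemma has_derB f g x a b : has_der f x a -> has_der g x b ->
  has_der (fun t => f t - g t) x (a - b).
Proof. by move=> ha hb; apply: has_derD ha _; exact: has_derN. Qed.

Lemma has_derM f g x a b : has_der f x a -> has_der g x b ->
  has_der (fun t => f t * g t) x (a * g x + f x * b).
Proof.
move=> ha hb; rewrite addrC [a * _]mulrC; exact: (is_deriveM ha hb).
Qed.

Lemma has_derZ (c : R) f x a : has_der f x a -> has_der (fun t => c * f t) x (c * a).
Proof.
by move=> ha; apply: has_der_eq (has_derM (has_der_cst c x) ha) _; rewrite mul0r add0r.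
Qed.

Lemma has_derX f x a n : has_der f x a -> has_der (fun t => f t ^+ n) x (n%:R * f x ^+ n.-1 * a).
Proof.
move=> h; apply: has_der_ext (is_deriveX n h) => t.
by elim: n => // n ih; rewrite !exprS -ih.
Qed.

Lemma has_derV f x a : f x != 0 -> has_der f x a -> has_der (fun t => (f t)^-1) x (- (a / f x ^+ 2)).
Proof.
move=> fx0 h; apply: has_der_eq (is_deriveV fx0 h) _.
by rewrite /GRing.scale/= mulNr mulrC.
Qed.

Lemma has_der_comp f g x a b : has_der f (g x) a -> has_der g x b ->
  has_der (fun t => f (g t)) x (a * b).
Proof. exact: is_derive1_comp. Qed.

Lemma has_der_sum (I : Type) (r : seq I) (f : I -> R -> R) (df : I -> R) x :
  (forall i, has_der (f i) x (df i)) ->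
  has_der (fun t => \sum_(i <- r) f i t) x (\sum_(i <- r) df i).
Proof.
move=> h; elim: r => [|i r ih].
  rewrite big_nil; apply: has_der_ext (has_der_cst 0 x) => t; by rewrite big_nil.
rewrite big_cons; apply: has_der_ext (has_derD (h i) ih) => t; by rewrite big_cons.
Qed.

Lemma has_der_affine (c d x : R) : has_der (fun t => c * t + d) x c.
Proof.
apply: has_der_eq (has_derD (has_derZ c (has_der_id x)) (has_der_cst d x)) _.
by rewrite mulr1 addr0.
Qed.

Lemma has_der_comp_affine f (c d x l : R) : has_der f (c * x + d) l ->
  has_der (fun t => f (c * t + d)) x (c * l).
Proof.
by move=> h; rewrite mulrC; exact: (@has_der_comp f (fun t => c * t + d) x _ _ h (has_der_affine c d x)).
Qed.

Lemma has_der_cont f x a : has_der f x a -> cont_at f x.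
Proof.
by move=> [h _]; apply: differentiable_continuous; apply/derivable1_diffP.
Qed.

Lemma derivable_has_der f x : derivable f x 1 -> has_der f x (derive1 f x).
Proof. by move=> h; apply: DeriveDef => //; rewrite derive1E. Qed.

Lemma derive1_has_der f df : (forall x, has_der f x (df x)) -> derive1 f = df.
Proof. by move=> h; apply/funext => x; rewrite derive1E; have [_ ] := h x. Qed.

End has_der_theory.

(** * Smooth functions of one variable *)

(** The one-variable counterpart of [Ck]: products of smooth functions of one coordinate each then
    give test functions. *)
Fixpoint smooth_upto (R : realType) (k : nat) (p : R -> R) : Prop :=
  if k is k'.+1 then (forall x, derivable p x 1) /\ smooth_upto k' (derive1 p)
  else continuous p.

Definition smooth (R : realType) (p : R -> R) := forall k, smooth_upto k p.

Section smooth_theory.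
Variable R : realType.
Implicit Types p q : R -> R.

Lemma smooth_uptoS k p dp : (forall x : R, has_der p x (dp x)) ->
  smooth_upto k dp -> smooth_upto k.+1 p.
Proof.
move=> h hd; split; first by move=> x; have [] := h x.
by rewrite (derive1_has_der h).
Qed.

Lemma smooth_upto_continuous k p : smooth_upto k p -> continuous p.
Proof.
by case: k => // k [h _] x; exact: (has_der_cont (derivable_has_der (h x))).
Qed.

Lemma smooth_upto_le k p : smooth_upto k.+1 p -> smooth_upto k p.
Proof.
elim: k p => [p h|k ih p [h1 h2]]; first exact: smooth_upto_continuous h.
by split => //; exact: ih.
Qed.

Lemma smooth_upto_has_der k p x : smooth_upto k.+1 p -> has_der p x (derive1 p x).
Proof. by move=> [h _]; exact: derivable_has_der. Qed.

Lemma smooth_uptoD k p q : smooth_upto k p -> smooth_upto k q ->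
  smooth_upto k (fun x => p x + q x).
Proof.
elim: k p q => [p q /= hp hq x|k ih p q hp hq].
  by exact: (cont_atD (hp x) (hq x)).
apply: (@smooth_uptoS _ _ (fun x => derive1 p x + derive1 q x)).
  by move=> x; exact: has_derD (smooth_upto_has_der x hp) (smooth_upto_has_der x hq).
by apply: ih; [exact: hp.2|exact: hq.2].
Qed.

Lemma smooth_uptoM k p q : smooth_upto k p -> smooth_upto k q ->
  smooth_upto k (fun x => p x * q x).
Proof.
elim: k p q => [p q /= hp hq x|k ih p q hp hq].
  by exact: (cont_atM (hp x) (hq x)).
apply: (@smooth_uptoS _ _ (fun x => derive1 p x * q x + p x * derive1 q x)).
  by move=> x; exact: has_derM (smooth_upto_has_der x hp) (smooth_upto_has_der x hq).
by apply: smooth_uptoD; apply: ih;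
  [exact: hp.2|exact: smooth_upto_le|exact: smooth_upto_le|exact: hq.2].
Qed.

Lemma smooth_upto_cst k (c : R) : smooth_upto k (fun _ => c).
Proof.
elim: k c => [c /= x|k ih c]; first exact: cvg_cst.
by apply: (@smooth_uptoS _ _ (fun _ => 0)) => // x; exact: has_der_cst.
Qed.

Lemma smooth_upto_affine k p (c d : R) : smooth_upto k p ->
  smooth_upto k (fun t => p (c * t + d)).
Proof.
elim: k p => [p /= hp x|k ih p hp].
  apply: (@cont_at_comp1 _ _ (fun t : R => c * t + d) p); last exact: hp.
  exact: has_der_cont (has_der_affine c d x).
apply: (@smooth_uptoS _ _ (fun x => c * derive1 p (c * x + d))).
  by move=> x; apply: has_der_comp_affine; exact: smooth_upto_has_der hp.
by apply: smooth_uptoM; [exact: smooth_upto_cst|apply: ih; exact: hp.2].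
Qed.

Lemma smooth_derive1 p : smooth p -> smooth (derive1 p).
Proof. by move=> h k; have [] := h k.+1. Qed.

Lemma smooth_has_der p x : smooth p -> has_der p x (derive1 p x).
Proof. by move=> h; apply: (@smooth_upto_has_der 0); exact: h. Qed.

Lemma smooth_continuous p : smooth p -> continuous p.
Proof. by move=> h; apply: (@smooth_upto_continuous 0); exact: h. Qed.

(* The derivatives of [t |-> exp (- 1 / t)] on [t > 0] are combinations of the functions [expinv n], all of
   which vanish to every order at [0]. *)
Definition expinv n (t : R) : R := if 0 < t then t ^- n * expR (- t^-1) else 0.

(** The exponential of [1 / t] dominates its Taylor term of order [n + 1]. The linear bound is what
    makes the difference quotients at 0 converge. *)
Lemma expinv_le n (t : R) : `|expinv n t| <= n.+1`!%:R * `|t|.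
Proof.
rewrite /expinv; case: ifPn => t0; last by rewrite normr0 mulr_ge0.
rewrite ger0_norm ?gtr0_norm//; last by rewrite mulr_ge0 ?expR_ge0// invr_ge0 exprn_ge0// ltW.
have /(expR_ge1Dxn n) h : 0 <= t^-1 by rewrite invr_ge0 ltW.
have f0 : 0 < n.+1`!%:R :> R by rewrite ltr0n fact_gt0.
rewrite expRN ler_pdivrMr ?expR_gt0//.
have : t^-1 ^+ n.+1 <= n.+1`!%:R * expR t^-1.
  by rewrite -ler_pdivrMl// mulrC; apply: le_trans h; rewrite lerDr.
rewrite exprS exprVn mulrAC => {}h.
by rewrite -ler_pdivrMr// mulrC.
Qed.

Lemma expinv_ge0 n (t : R) : 0 <= expinv n t.
Proof.
rewrite /expinv; case: ifPn => t0 //.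
by rewrite mulr_ge0 ?expR_ge0// invr_ge0 exprn_ge0// ltW.
Qed.

Lemma has_der_expinv n (t : R) :
  has_der (expinv n) t (expinv n.+2 t - n%:R * expinv n.+1 t).
Proof.
have [t0|t0|->] := ltgtP t 0.
- rewrite {2 3}/expinv ltNge (ltW t0)/= mulr0 subr0.
  apply: (@has_der_near _ (cst 0)); last exact: has_der_cst.
  near=> y; rewrite /expinv ifF//; apply/negbTE; rewrite -leNgt ltW//.
  by near: y; exact: lt_nbhsl.
- rewrite {2 3}/expinv t0.
  apply: (@has_der_near _ (fun t => (t ^+ n)^-1 * expR (- t^-1))).
    by near=> y; rewrite /expinv ifT//; near: y; exact: lt_nbhsr.
  have tn0 : t != 0 by rewrite gt_eqF.
  have h1 := @has_derV _ (fun t => t ^+ n) _ _ (expf_neq0 n tn0) (has_derX n (has_der_id t)).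
  have h2 := @has_der_comp _ expR (fun t => - t^-1) _ _ _ (is_derive_expR _)
    (has_derN (@has_derV _ (fun t => t) _ _ tn0 (has_der_id t))).
  apply: has_der_eq (has_derM h1 h2) _.
  case: n h1 => [|n] h1.
    rewrite !expr0 !mul0r !subr0; field.
    done.
  rewrite !exprS/=; field.
  by rewrite expf_neq0.
- rewrite {2 3}/expinv ltxx mulr0 subrr.
  (* At 0 the difference quotient of [expinv n] is [expinv n.+1], which is itself of order [|h|]. *)
  have h : h^-1 *: (expinv n (h + 0) - expinv n 0) @[h --> 0^'] --> (0 : R).
    rewrite {2}/expinv ltxx.
    apply/cvgr0Pnorm_le => e e0.
    have f0 : 0 < n.+2`!%:R :> R by rewrite ltr0n fact_gt0.
    near=> h; rewrite subr0 addr0.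
    have -> : h^-1 *: expinv n h = expinv n.+1 h.
      rewrite /expinv; case: ifPn => h0; last by rewrite scaler0.
      by rewrite /GRing.scale/= mulrA exprS invfM.
    apply: le_trans (expinv_le n.+1 h) _.
    rewrite mulrC -ler_pdivlMr//.
    near: h; apply: dnbhs0_le; exact: divr_gt0.
  apply: DeriveDef; first by apply/cvg_ex; exists 0; under eq_fun do rewrite scaler1.
  by rewrite /derive; under eq_fun do rewrite scaler1; exact: cvg_lim.
Unshelve. all: by end_near. Qed.

Lemma smooth_expinv n : smooth (expinv n).
Proof.
move=> k; elim: k n => [|k ih] n.
  by move=> t; exact: has_der_cont (has_der_expinv n t).
apply: (@smooth_uptoS _ _ (fun t => expinv n.+2 t + - n%:R * expinv n.+1 t)).
  by move=> t; apply: has_der_eq (has_der_expinv n t) _; rewrite mulNr.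
apply: smooth_uptoD; first exact: ih.
by apply: smooth_uptoM; [exact: smooth_upto_cst|exact: ih].
Qed.

(** As [n] grows this tends to the indicator of the open interval between [a] and [b]; for [n = 1]
    and a symmetric interval it is the profile of the mollifier. *)
Definition bump (a b n : R) (t : R) : R := expinv 0 (n * (t - a)) * expinv 0 (n * (b - t)).

Lemma smooth_bump a b n : smooth (bump a b n).
Proof.
move=> k; apply: smooth_uptoM.
  have := @smooth_upto_affine k (expinv 0) n (- (n * a)) (smooth_expinv 0 k).
  by congr (smooth_upto k _); apply/funext => t; congr expinv; ring.
have := @smooth_upto_affine k (expinv 0) (- n) (n * b) (smooth_expinv 0 k).
by congr (smooth_upto k _); apply/funext => t; congr expinv; ring.
Qed.

Lemma bump_ge0 a b n t : 0 <= bump a b n t.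
Proof. by rewrite mulr_ge0// expinv_ge0. Qed.

Lemma bump_eq0 a b n t : 0 < n -> ~~ (a < t < b) -> bump a b n t = 0.
Proof.
have e0 u : u <= 0 -> expinv 0 u = 0 by rewrite /expinv leNgt; case: ifP.
move=> n0; rewrite negb_and -!leNgt => /orP[h|h]; rewrite /bump.
  by rewrite e0 ?mul0r// pmulr_rle0// subr_le0.
by rewrite [X in _ * X]e0 ?mulr0// pmulr_rle0// subr_le0.
Qed.

Lemma expinv_gt0 n u : 0 < u -> 0 < expinv n u.
Proof. by move=> u0; rewrite /expinv u0 mulr_gt0 ?expR_gt0// invr_gt0 exprn_gt0. Qed.

Lemma bump_le1 a b n t : bump a b n t <= 1.
Proof.
have h u : expinv 0 u <= 1.
  rewrite /expinv; case: ifPn => // u0.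
  by rewrite expr0 invr1 mul1r expR_le1 oppr_le0 invr_ge0 ltW.
by rewrite mulr_ile1// expinv_ge0.
Qed.

Lemma bump_cvg a b t : a < t < b -> bump a b n.+1%:R t @[n --> \oo] --> (1 : R).
Proof.
move=> /andP[at_ tb].
have h u : 0 < u -> expinv 0 (n.+1%:R * u) @[n --> \oo] --> (1 : R).
  move=> u0.
  have -> : (fun n => expinv 0 (n.+1%:R * u)) = (fun n => expR (- (harmonic n * u^-1))).
    apply/funext => n; rewrite /expinv pmulr_rgt0// u0 expr0 invr1 mul1r.
    by rewrite invfM.
  have hn : harmonic n * u^-1 @[n --> \oo] --> (0 : R).
    by rewrite -(mul0r u^-1); exact: (cvgM (@cvg_harmonic R) (cvg_cst _)).
  have c : cont_at (fun x : R => expR (- x)) 0.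
    by apply: cont_at_comp1; [exact: opp_continuous|exact: continuous_expR].
  by have := cvg_comp _ _ hn c; rewrite oppr0 expR0; apply.
have ta : 0 < t - a by rewrite subr_gt0.
have bt : 0 < b - t by rewrite subr_gt0.
have h2 : (fun n => expinv 0 (n.+1%:R * (t - a)) * expinv 0 (n.+1%:R * (b - t))) n
    @[n --> \oo] --> (1 * 1 : R) := cvgM (h _ ta) (h _ bt).
rewrite mulr1 in h2; exact: h2.
Qed.

End smooth_theory.

(** * Local integrability on boxes *)

Definition box (R : realType) (M : R) : set (R * R) := rect (- M) M (- M) M.

Section plane_integral.
Variable R : realType.
Local Notation R2 := (measurableTypeR R * measurableTypeR R)%type.
Local Notation mu := (@plane R).
Implicit Types (f g : R * R -> R).

(** Boxes stand for all compact sets, since each compact set lies in one, and they suit iterated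
    integration. *)
Definition locint f : Prop :=
  measurable_fun setT (f : R2 -> R) /\ forall M, mu.-integrable (box M) (EFin \o f).

Lemma measurable_box (M : R) : measurable (box M : set R2).
Proof. exact: measurable_rect. Qed.

Lemma rect_fin (a b c d : R) : (mu (rect a b c d) < +oo)%E.
Proof.
have [ab|ab] := leP a b; last first.
  rewrite (_ : rect a b c d = set0) ?measure0//.
  by apply/seteqP; split => // z [/andP[h1 h2] _] /=; lra.
have [cd|cd] := leP c d; last first.
  rewrite (_ : rect a b c d = set0) ?measure0//.
  by apply/seteqP; split => // z [_ /andP[h1 h2]] /=; lra.
by rewrite /plane lebesgue2_rect// ltry.
Qed.

Lemma compact_cont_bounded (T : topologicalType) (K : set T) (f : T -> R) : compact K ->
  (forall z, K z -> cont_at f z) -> exists2 B : R, 0 < B & forall z, K z -> `|f z| <= B.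
Proof.
move=> cK cf.
have wf : {within K, continuous f}.
  by apply: continuous_in_subspaceT => z /set_mem Kz; exact: cf.
have [M [_ hM]] := compact_bounded (continuous_compact wf cK).
exists (Num.max 1 (M + 1)); first by rewrite lt_max ltr01.
move=> z Kz; apply: hM; last by exists z.
by rewrite lt_max ltrDl ltr01 orbT.
Qed.

Lemma cont_integrable a b c d f : (forall z, rect a b c d z -> cont_at f z) ->
  mu.-integrable (rect a b c d) (EFin \o f).
Proof.
move=> cf; apply: measurable_bounded_integrable.
- exact: measurable_rect.
- exact: rect_fin.
- by apply: continuous_on_measurable_plane; [exact: measurable_rect|move=> z /set_mem; exact: cf].
have [B B0 hB] := compact_cont_bounded (@compact_rect R a b c d) cf.
exists B; split; first exact: num_real.
by move=> x Bx z /hB /le_trans; apply; exact: ltW.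
Qed.

Lemma cont_locint f : continuous f -> locint f.
Proof.
move=> cf; split; first exact: continuous_measurable_plane.
by move=> M; apply: cont_integrable => z _; exact: cf.
Qed.

Lemma bounded_integrableM (A : set R2) f g : measurable A -> measurable_fun A (g : R2 -> R) ->
  (exists B, forall z, A z -> `|g z| <= B) ->
  mu.-integrable A (EFin \o f) -> mu.-integrable A (EFin \o (fun z => f z * g z)).
Proof.
move=> mA mg [B hB] intf.
have -> : EFin \o (fun z => f z * g z) = ((EFin \o f) \* (EFin \o g))%E by apply/funext.
apply: integrableMl => //.
exists B; split; first exact: num_real.
by move=> x Bx z /hB /le_trans; apply; exact: ltW.
Qed.

Lemma locintM_cont f g : locint f -> continuous g -> locint (fun z => f z * g z).
Proof.
move=> [mf intf] cg; split.
  by apply: measurable_funM => //; exact: continuous_measurable_plane.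
move=> M; apply: bounded_integrableM => //; first exact: measurable_box.
  by apply: measurable_funTS; exact: continuous_measurable_plane.
have [B _ hB] := compact_cont_bounded (@compact_rect R (- M) M (- M) M) (fun z _ => cg z).
by exists B.
Qed.

Lemma locintD f g : locint f -> locint g -> locint (fun z => f z + g z).
Proof.
move=> [mf If] [mg Ig]; split; first exact: measurable_funD.
by move=> M; have := integrableD (measurable_box M) (If M) (Ig M).
Qed.

Lemma locintN f : locint f -> locint (fun z => - f z).
Proof.
move=> [mf If]; split; first exact: measurable_funN.
by move=> M; exact: (integrableN (If M)).
Qed.

Lemma locintB f g : locint f -> locint g -> locint (fun z => f z - g z).
Proof. by move=> hf /locintN; exact: locintD. Qed.

Lemma box_sub (M M' : R) : M <= M' -> box M `<=` box M'.
Proof. by move=> MM; apply: rect_sub; rewrite ?lerN2. Qed.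

Lemma box_normP (M : R) (z : R * R) : box M z <-> `|z.1| <= M /\ `|z.2| <= M.
Proof. by rewrite !ler_norml. Qed.

Lemma box_near (M d : R) (x z : R * R) : box M x -> `|x.1 - z.1| <= d -> `|x.2 - z.2| <= d -> box (M + d) z.
Proof.
move=> /box_normP[x1 x2] h1 h2; apply/box_normP; split.
  by rewrite -[z.1](subKr x.1) (le_trans (ler_normB _ _))// lerD.
by rewrite -[z.2](subKr x.2) (le_trans (ler_normB _ _))// lerD.
Qed.

Lemma integral_box_supp f (M : R) : (forall z, ~ box M z -> f z = 0) ->
  \int[mu]_z f z = \int[mu]_(z in box M) f z.
Proof.
move=> h; rewrite [RHS]Rintegral_mkcond; apply: eq_Rintegral => z _.
rewrite patchE; case: ifPn => // /negP; rewrite inE; exact: h.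
Qed.

Lemma integrable_box_supp f (M : R) : (forall z, ~ box M z -> f z = 0) ->
  mu.-integrable (box M) (EFin \o f) -> mu.-integrable setT (EFin \o f).
Proof.
move=> h /(integrable_mkcond _ (measurable_box M)).
apply: eq_integrable => // z _.
rewrite patchE; case: ifPn => // /negP; rewrite inE => /h /= ->//.
Qed.

End plane_integral.

(** * Products of one-variable functions as test functions *)

Definition tensor (R : realType) (p q : R -> R) (z : R * R) : R := p z.1 * q z.2.

Section tensor_test.
Variable R : realType.
Implicit Types (p q : R -> R).

(** A directional derivative is an ordinary derivative along a line, so the one-variable rules apply
    to functions on the plane. *)
Lemma is_derive_dir (f : R * R -> R) (z e : R * R) (l : R) :
  has_der (fun t => f (z.1 + t * e.1, z.2 + t * e.2)) 0 l -> is_derive z e f l.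
Proof.
move=> [h <-].
have E : (fun t : R => f (z.1 + t * e.1, z.2 + t * e.2)) = (fun t => f (t *: e + z)).
  by apply/funext => t; congr f; rewrite [RHS]surjective_pairing /=; congr pair; rewrite addrC.
rewrite E in h *.
split; first by apply/(derivable1P f z e).
rewrite /derive; apply: (congr1 (fun F : R -> R => lim (F @ 0^'))).
by apply/funext => t /=; rewrite addr0 scale0r add0r /GRing.scale/= mulr1.
Qed.

Lemma tensor_dir p q dp dq (z e : R * R) : has_der p z.1 dp -> has_der q z.2 dq ->
  is_derive z e (tensor p q) (e.1 * (dp * q z.2) + e.2 * (p z.1 * dq)).
Proof.
move=> hp hq; apply: is_derive_dir; rewrite /tensor/=.
have h1 : has_der (fun t => p (z.1 + t * e.1)) 0 (e.1 * dp).
  have := @has_der_comp_affine _ p e.1 z.1 0 dp; rewrite mulr0 add0r => /(_ hp).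
  by apply: has_der_ext => t; rewrite addrC mulrC.
have h2 : has_der (fun t => q (z.2 + t * e.2)) 0 (e.2 * dq).
  have := @has_der_comp_affine _ q e.2 z.2 0 dq; rewrite mulr0 add0r => /(_ hq).
  by apply: has_der_ext => t; rewrite addrC mulrC.
apply: has_der_eq (has_derM h1 h2) _.
by rewrite !mul0r !addr0; ring.
Qed.

Lemma pder_tensor1 p q : smooth p -> smooth q ->
  pder (axis1 R) (tensor p q) = tensor (derive1 p) q.
Proof.
move=> sp sq; apply/funext => z; rewrite /pder.
have [_ ->] := tensor_dir (axis1 R) (smooth_has_der z.1 sp) (smooth_has_der z.2 sq).
by rewrite mul1r mul0r addr0.
Qed.

Lemma pder_tensor2 p q : smooth p -> smooth q ->
  pder (axis2 R) (tensor p q) = tensor p (derive1 q).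
Proof.
move=> sp sq; apply/funext => z; rewrite /pder.
have [_ ->] := tensor_dir (axis2 R) (smooth_has_der z.1 sp) (smooth_has_der z.2 sq).
by rewrite mul1r mul0r add0r.
Qed.

Lemma continuous_tensor p q : continuous p -> continuous q -> continuous (tensor p q).
Proof.
move=> cp cq z; apply: cont_atM.
  by apply: (@cont_at_comp1 _ _ (fun z : R * R => z.1) p); [exact: cont_at_fst|exact: cp].
by apply: (@cont_at_comp1 _ _ (fun z : R * R => z.2) q); [exact: cont_at_snd|exact: cq].
Qed.

(** The induction on the order closes because both partial derivatives of a product of this shape
    have the same shape again. *)
Lemma test_tensor p q (M : R) : smooth p -> smooth q ->
  (forall t, M < `|t| -> p t = 0) -> (forall t, M < `|t| -> q t = 0) ->
  test_function (tensor p q).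
Proof.
move=> sp sq p0 q0; split.
  move=> k; elim: k p q sp sq {p0 q0} => [|k ih] p q sp sq.
    by apply: continuous_tensor; exact: smooth_continuous.
  split.
  - by apply: continuous_tensor; exact: smooth_continuous.
  - by move=> z; split; [have [] := tensor_dir (axis1 R) (smooth_has_der z.1 sp) (smooth_has_der z.2 sq)
      |have [] := tensor_dir (axis2 R) (smooth_has_der z.1 sp) (smooth_has_der z.2 sq)].
  - by rewrite pder_tensor1//; apply: ih => //; exact: smooth_derive1.
  - by rewrite pder_tensor2//; apply: ih => //; exact: smooth_derive1.
have cb : compact (box M) by exact: compact_rect.
apply: subclosed_compact cb _; first exact: closed_closure.
have clb : closed (box M).
  rewrite [box M](_ : _ = (fst @^-1` `[- M, M]) `&` (snd @^-1` `[- M, M])); last first.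
    by apply/seteqP; split => x /=; rewrite /box /rect/= !in_itv.
  apply: closedI; apply: closed_comp => [x _|]; [exact: cvg_fst|exact: interval_closed|
    exact: cvg_snd|exact: interval_closed].
rewrite [X in _ `<=` X](closure_id _).1//.
apply: closure_subset => z /=; apply: contra_neqP => nbz.
have [h1|h1] := leP `|z.1| M; last by rewrite /tensor p0// mul0r.
have [h2|h2] := leP `|z.2| M; last by rewrite /tensor q0// mulr0.
by exfalso; apply: nbz; split; rewrite -ler_norml.
Qed.

(** The strict inequality makes the region where [p] is known to vanish open, so the derivative
    vanishes there too. *)
Lemma smooth_derive1_supp p (M : R) : smooth p -> (forall t, M < `|t| -> p t = 0) ->
  forall t, M < `|t| -> derive1 p t = 0.
Proof.
move=> sp p0 t Mt; apply: has_der_uniq (smooth_has_der t sp) _.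
apply: (@has_der_near _ (fun=> 0)); last exact: has_der_cst.
have : cont_at (fun t : R => `|t|) t by exact: norm_continuous.
move/cvgr_gt => /(_ _ Mt); by apply: filterS => s /p0.
Qed.

Lemma bump_supp (a b : R) n M t : 0 < n -> `|a| <= M -> `|b| <= M -> M < `|t| -> bump a b n t = 0.
Proof.
move=> n0 aM bM Mt; apply: bump_eq0 => //; apply/negP => /andP[h1 h2].
move: aM bM Mt; rewrite !ler_norml lter_normr => /andP[? ?] /andP[? ?] /orP[?|?]; lra.
Qed.

End tensor_test.

(** * Functions annihilated by all test functions *)

Section uniqueness.
Variable R : realType.
Local Notation R2 := (measurableTypeR R * measurableTypeR R)%type.
Local Notation mu := (@plane R).
Implicit Types (f g : R * R -> R).

(** Open, because the bumps converge to the indicator of the open interval. *)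
Definition orect (a b c d : R) : set (R * R) := [set z | a < z.1 < b /\ c < z.2 < d].

Lemma measurable_orect (a b c d : R) : measurable (orect a b c d : set R2).
Proof.
rewrite (_ : orect a b c d = `]a, b[ `*` `]c, d[); first exact: measurableX.
by apply/seteqP; split => z /=; rewrite /orect/= !in_itv.
Qed.

Lemma orect_sub a b c d M : `|a| <= M -> `|b| <= M -> `|c| <= M -> `|d| <= M ->
  orect a b c d `<=` box M.
Proof.
rewrite !ler_norml => /andP[? ?] /andP[? ?] /andP[? ?] /andP[? ?] z [/andP[? ?] /andP[? ?]].
by split; apply/andP; split; lra.
Qed.

(** Products of bumps are test functions bounded by 1 that converge to the indicator of the open
    rectangle; dominated convergence passes to the limit. *)
Lemma integral_orect0 f (a b c d : R) : locint f ->
  (forall phi, test_function phi -> \int[mu]_z (f z * phi z) = 0) ->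
  (\int[mu]_(z in orect a b c d) (f z)%:E = 0)%E.
Proof.
move=> [mf intf] h.
pose M := `|a| + `|b| + `|c| + `|d|.
have [Ma Mb Mc Md] : [/\ `|a| <= M, `|b| <= M, `|c| <= M & `|d| <= M].
  by rewrite /M; have := normr_ge0 a; have := normr_ge0 b; have := normr_ge0 c;
    have := normr_ge0 d; split; lra.
pose phi n := tensor (bump a b n.+1%:R) (bump c d n.+1%:R).
have n0 (n : nat) : 0 < n.+1%:R :> R by [].
have tphi n : test_function (phi n).
  apply: (@test_tensor _ _ _ M); try exact: smooth_bump.
  - by move=> t; exact: bump_supp.
  - by move=> t; exact: bump_supp.
have phi0 n z : ~ orect a b c d z -> phi n z = 0.
  move=> nz; rewrite /phi /tensor; have [h1|h1] := boolP (a < z.1 < b); last by rewrite bump_eq0// mul0r.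
  have [h2|h2] := boolP (c < z.2 < d); last by rewrite mulrC bump_eq0// mul0r.
  by exfalso; apply: nz.
have phi_le1 n z : `|phi n z| <= 1.
  rewrite /phi /tensor normrM !ger0_norm ?bump_ge0//.
  by rewrite mulr_ile1 ?bump_ge0 ?bump_le1.
have fo : mu.-integrable (orect a b c d) (EFin \o f).
  by apply: integrableS (intf M); [exact: measurable_box|exact: measurable_orect|exact: orect_sub].
have cphi n : continuous (phi n) by exact: ((tphi n).1 0).
have : (\int[mu]_(z in orect a b c d) (f z * phi n z)%:E)%E @[n --> \oo] -->
       (\int[mu]_(z in orect a b c d) (f z)%:E)%E.
  apply: (@dominated_cvg _ _ _ mu _ _ _ _ (fun z => `|f z|%:E)).
  - exact: measurable_orect.
  - move=> n; apply/measurable_EFinP/measurable_funTS; apply: measurable_funM => //.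
    exact: continuous_measurable_plane.
  - move=> z [z1 z2]; apply/cvg_EFin; first exact: nearW.
    have : (fun n => f z * (bump a b n.+1%:R z.1 * bump c d n.+1%:R z.2)) n @[n --> \oo] -->
        f z * (1 * 1) := cvgM (cvg_cst _) (cvgM (bump_cvg z1) (bump_cvg z2)).
    by rewrite mulr1 mulr1 => hc; exact: hc.
  - by [].
  - exact: integrable_norm.
  - by move=> n z _; rewrite lee_fin normrM ler_piMr.
have -> : (fun n => (\int[mu]_(z in orect a b c d) (f z * phi n z)%:E)%E) = (fun=> 0%E).
  apply/funext => n.
  have int1 : mu.-integrable setT (EFin \o (fun z => f z * phi n z)).
    apply: (@integrable_box_supp _ _ M).
      by move=> z nz; rewrite phi0 ?mulr0// => /(orect_sub Ma Mb Mc Md).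
    by apply: (locintM_cont _ (cphi n)).2.
  have <- : (\int[mu]_z (f z * phi n z)%:E)%E = 0%E.
    rewrite -[LHS]fineK; last exact: integrable_fin_num.
    by congr EFin; exact: h.
  rewrite [LHS]integral_mkcond; apply: eq_integral => z _.
  rewrite patchE; case: ifPn => // /negP; rewrite inE => /phi0 ->.
  by rewrite mulr0.
by move=> hc; have := cvg_unique _ hc (cvg_cst _) => /(_ _); apply; exact: ereal_hausdorff.
Qed.

Let itvs : set (set R) := [set A | A = setT \/ exists a b, A = `]a, b[%classic].
Let rects : set (set R2) := [set A `*` B | A in itvs & B in itvs].

Let measurable_rects : @measurable _ R2 = <<s rects >>.
Proof.
apply/seteqP; split; last first.
  apply: smallest_sub; first exact: sigma_algebra_measurable.
  move=> _ [A hA [B hB <-]]; apply: measurableX.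
    by case: hA => [->|[a [b ->]]].
  by case: hB => [->|[a [b ->]]].
rewrite measurable_prod_measurableType; apply: smallest_sub; first exact: smallest_sigma_algebra.
move=> _ [A mA [B mB <-]].
have -> : A `*` B = (fst @^-1` A) `&` (snd @^-1` B) by apply/seteqP; split => z.
apply: (@measurableI _ (g_sigma_algebraType rects)).
  have : measurable_fun setT (fst : g_sigma_algebraType rects -> R).
    apply: (measurability _ (RGenOpens.measurableE R)) => _ [_ [a [b ->]] <-].
    apply: sub_sigma_algebra; exists `]a, b[%classic; first by right; exists a, b.
    by exists setT; [left|apply/seteqP; split => z //= []].
  by move=> /(_ measurableT _ mA); rewrite setTI.
have : measurable_fun setT (snd : g_sigma_algebraType rects -> R).
  apply: (measurability _ (RGenOpens.measurableE R)) => _ [_ [a [b ->]] <-].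
  apply: sub_sigma_algebra; exists setT; first by left.
  by exists `]a, b[%classic; [right; exists a, b|apply/seteqP; split => z //= []].
by move=> /(_ measurableT _ mB); rewrite setTI.
Qed.

(** A pi-lambda argument: rectangles form a pi-system on which the integral vanishes, and vanishing
    passes to complements and disjoint unions. Cutting with a fixed bounded square keeps [f]
    integrable throughout. *)
Lemma integral_box_setI0 f M (E : set R2) : locint f ->
  (forall phi, test_function phi -> \int[mu]_z (f z * phi z) = 0) ->
  measurable E -> (\int[mu]_(z in E `&` orect (- M) M (- M) M) (f z)%:E = 0)%E.
Proof.
move=> lf h; rewrite [X in X -> _](_ : _ = <<s rects >> E); last by rewrite -measurable_rects.
have mO : measurable (orect (- M) M (- M) M : set R2) by exact: measurable_orect.
have int_sub A : measurable A -> mu.-integrable (A `&` orect (- M) M (- M) M) (EFin \o f).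
  move=> mA; apply: integrableS (lf.2 `|M|).
  - exact: measurable_box.
  - exact: measurableI.
  - by apply: subset_trans (@subIsetr _ _ _) _; apply: orect_sub; rewrite ?normrN.
pose P (A : set R2) := (\int[mu]_(z in A `&` orect (- M) M (- M) M) (f z)%:E = 0)%E.
apply: (@dynkin_induction _ R2 rects P) => //.
- move=> _ _ [A hA [B hB <-]] [A' hA' [B' hB' <-]].
  have hI C C' : itvs C -> itvs C' -> itvs (C `&` C').
    move=> [->|[a [b ->]]]; first by rewrite setTI.
    move=> [->|[c [d ->]]]; first by rewrite setIT; right; exists a, b.
    right; exists (Num.max a c), (Num.min b d).
    by apply/seteqP; split => x /=; rewrite !in_itv/= gt_max lt_min; lra.
  by exists (A `&` A'); [exact: hI|exists (B `&` B'); [exact: hI|rewrite setXI]].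
- by rewrite /P setTI; exact: integral_orect0.
- move=> _ [A hA [B hB <-]]; rewrite /P.
  have hI C : itvs C -> exists a b, C `&` `]- M, M[%classic = `]a, b[%classic.
    move=> [->|[a [b ->]]]; first by exists (- M), M; rewrite setTI.
    exists (Num.max a (- M)), (Num.min b M).
    by apply/seteqP; split => x /=; rewrite !in_itv/= gt_max lt_min; lra.
  have [a [b ab]] := hI _ hA; have [c [d cd]] := hI _ hB.
  rewrite (_ : _ `&` _ = orect a b c d); first exact: integral_orect0.
  have -> : orect (- M) M (- M) M = `]- M, M[ `*` `]- M, M[.
    by apply/seteqP; split => z /=; rewrite /orect/= !in_itv.
  rewrite -setXI ab cd.
  by apply/seteqP; split => z /=; rewrite /orect/= !in_itv.
- move=> A mA hA; rewrite /P.
  have : (\int[mu]_(z in (A `|` ~` A) `&` orect (- M) M (- M) M) (f z)%:E = 0)%E.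
    by rewrite setUv setTI; exact: integral_orect0.
  rewrite setIUl integral_setU_EFin.
  + by move=> e; move: hA; rewrite /P => hA; rewrite hA add0e in e.
  + by apply: measurableI mO.
  + by apply: measurableI mO; exact: measurableC.
  + by apply: measurable_funTS; exact: lf.1.
  + by apply/disj_setPS => z [[? _] []].
- move=> F mF tF hF; rewrite /P setI_bigcupl integral_bigcup.
  + by apply: eseries0 => n _ _; exact: hF.
  + by apply: trivIset_setIr.
  + by move=> k; exact: measurableI.
  + by rewrite -setI_bigcupl; apply: int_sub; exact: bigcupT_measurable.
Qed.

Lemma test_ae_eq0 f M : locint f ->
  (forall phi, test_function phi -> \int[mu]_z (f z * phi z) = 0) ->
  ae_eq mu (box M) (EFin \o f) (cst 0%E).
Proof.
move=> lf h.
(* Vanishing is known inside open squares, so the closed box is put into a slightly larger open one;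
   the absolute value covers negative [M]. *)
have sub : (box M : set R2) `<=` orect (- (`|M| + 1)) (`|M| + 1) (- (`|M| + 1)) (`|M| + 1).
  by move=> z [/andP[? ?] /andP[? ?]]; have := ler_norm M; split; apply/andP; split; lra.
apply: (ae_eq_subset sub).
apply: integral_ae_eq.
- exact: measurable_orect.
- apply: integrableS (lf.2 (`|M| + 1)).
  + exact: measurable_box.
  + exact: measurable_orect.
  + by apply: orect_sub; rewrite ?normrN ger0_norm// addr_ge0.
- exact: measurable_cst.
- move=> E Esub mE; rewrite integral0.
  rewrite -(setIidl Esub); exact: integral_box_setI0.
Qed.

End uniqueness.

(** * Mollification *)

Section kernel.
Variable R : realType.
Local Notation leb := (@lebesgue_measure R).

Lemma ge0_integral_shift (g : R -> R) (c : R) : continuous g -> (forall x, 0 <= g x) ->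
  (\int[leb]_x (g (x - c))%:E = \int[leb]_x (g x)%:E)%E.
Proof.
move=> cg g0.
have dF x : has_der (fun t : R => t - c) x 1.
  by apply: has_der_eq (has_derB (has_der_id x) (has_der_cst c x)) _; rewrite subr0.
have F' : derive1 (fun t : R => t - c) = cst 1 by exact: derive1_has_der.
rewrite [RHS](@increasing_ge0_integration_by_substitutionT _ (fun t => t - c) g) => //.
- by apply: eq_integral => x _; rewrite F' /= mulr1.
- by move=> x y xy; rewrite ltrD2r.
- by rewrite F'; exact: cst_continuous.
- by rewrite F'; exact: is_cvg_cst.
- by rewrite F'; exact: is_cvg_cst.
- by apply/cvgrNyPle => A; apply: (filterS _ (nbhs_ninfty_le (num_real (A + c)))) => x /=; rewrite lerBlDr.
- by apply/cvgryPge => A; apply: (filterS _ (nbhs_pinfty_ge (num_real (A + c)))) => x /=; rewrite lerBrDr.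
Qed.

Variable d : R.
Hypothesis d0 : 0 < d.

Definition bump_mass : R := fine (\int[leb]_x (bump (- d) d 1 x)%:E)%E.

Let measurable_bump : measurable_fun setT (fun x : R => (bump (- d) d 1 x)%:E).
Proof.
have c : continuous (bump (- d) d 1 : R -> R) by apply: smooth_continuous; exact: smooth_bump.
by apply/measurable_EFinP; exact: continuous_measurable_fun.
Qed.

Let bumpE : (\int[leb]_x (bump (- d) d 1 x)%:E = bump_mass%:E)%E.
Proof.
rewrite /bump_mass fineK// ge0_fin_numE; last by apply: integral_ge0 => x _; rewrite lee_fin bump_ge0.
apply: (@le_lt_trans _ _ (\int[leb]_x (\1_(`[- d, d]%classic : set R) x)%:E)%E).
  apply: ge0_le_integral => //.
  - by move=> x _; rewrite lee_fin bump_ge0.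
    by apply/measurable_EFinP; exact: measurable_indic.
  - move=> x _; rewrite lee_fin indicE; case: (boolP (x \in _)) => xd /=; first exact: bump_le1.
    rewrite bump_eq0//; apply: contra xd => /andP[h1 h2].
    by rewrite inE/= in_itv/= !ltW.
by rewrite integral_indic// setIT /= lebesgue_measure_itv; case: ifP => _; rewrite ltry.
Qed.

(** On the middle half of the interval both exponential factors are at least [expinv 0 (d / 2)], by
    monotonicity. *)
Lemma bump_mass_gt0 : 0 < bump_mass.
Proof.
pose m := expinv 0 (d / 2) ^+ 2.
have m0 : 0 < m by rewrite exprn_gt0// expinv_gt0// divr_gt0.
have mono (u w : R) : 0 < u -> u <= w -> expinv 0 u <= expinv 0 w.
  move=> u0 uw; have w0 := lt_le_trans u0 uw.
  by rewrite /expinv u0 w0 !expr0 invr1 !mul1r ler_expR lerN2 lef_pV2.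
rewrite -lte_fin -bumpE.
apply: (@lt_le_trans _ _ (\int[leb]_x (m * \1_(`[- (d / 2), d / 2]%classic : set R) x)%:E)%E).
  under eq_integral do rewrite EFinM.
  rewrite ge0_integralZl_EFin ?(ltW m0)//; last first.
    by apply/measurable_EFinP; exact: measurable_indic.
  have dd : - (d / 2) < d / 2 by rewrite gtrN ?divr_gt0.
  rewrite integral_indic// setIT /= lebesgue_measure_itv/= lte_fin dd.
  by rewrite -EFinB -EFinM lte_fin mulr_gt0 // opprK addr_gt0 // divr_gt0.
apply: ge0_le_integral => //.
- by move=> x _; rewrite lee_fin mulr_ge0// ltW.
- by apply/measurable_EFinP; apply: measurable_funM => //; exact: measurable_indic.
- move=> x _; rewrite lee_fin indicE; case: (boolP (x \in _)) => xd /=; last by rewrite mulr0 bump_ge0.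
  move: xd; rewrite inE/= in_itv/= mulr1 => /andP[h1 h2].
  rewrite /m /bump expr2 !mul1r; apply: ler_pM; rewrite ?expinv_ge0//; apply: mono; rewrite ?divr_gt0//; (try by lra); move: h1 h2 d0; clear; lra.
Qed.

Definition moll (t : R) : R := bump_mass^-1 * bump (- d) d 1 t.

Lemma smooth_moll : smooth moll.
Proof. by move=> k; apply: smooth_uptoM; [exact: smooth_upto_cst|exact: smooth_bump]. Qed.

Lemma moll_ge0 t : 0 <= moll t.
Proof. by rewrite mulr_ge0 ?bump_ge0// invr_ge0 ltW// bump_mass_gt0. Qed.

Lemma moll_supp t : d <= `|t| -> moll t = 0.
Proof.
move=> dt; rewrite /moll bump_eq0 ?mulr0//; apply: contraL dt => /andP[h1 h2].
by rewrite -ltNge ltr_norml h1 h2.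
Qed.

Lemma moll_even t : moll (- t) = moll t.
Proof.
rewrite /moll /bump; have -> : 1 * (- t - - d) = 1 * (d - t) by ring.
have -> : 1 * (d - - t) = 1 * (t - - d) by ring.
by congr (_ * _); rewrite mulrC.
Qed.

Lemma integral_moll c : (\int[leb]_t (moll (c - t))%:E = 1)%E.
Proof.
have cm : continuous moll by apply: smooth_continuous; exact: smooth_moll.
under eq_integral do rewrite -moll_even opprB.
rewrite (ge0_integral_shift _ cm moll_ge0) /moll.
under eq_integral do rewrite EFinM.
rewrite ge0_integralZl_EFin//.
- by rewrite bumpE -EFinM mulVf// gt_eqF// bump_mass_gt0.
- by move=> x _; rewrite lee_fin bump_ge0.
- by rewrite invr_ge0 ltW// bump_mass_gt0.
Qed.

End kernel.

Definition csmooth (R : realType) (D : R) (p : R -> R) : Prop :=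
  smooth p /\ forall t, D < `|t| -> p t = 0.

(** As a function of [z] this is a test function, and the mollifier and all its partial derivatives
    are of this form; every weak equation is tested against such kernels. *)
Definition kern (R : realType) (p q : R -> R) (x z : R * R) : R := p (x.1 - z.1) * q (x.2 - z.2).

Definition conv (R : realType) (f : R * R -> R) (p q : R -> R) (x : R * R) : R :=
  \int[@plane R]_z (f z * kern p q x z).

Section convolution.
Variable R : realType.
Local Notation R2 := (measurableTypeR R * measurableTypeR R)%type.
Local Notation mu := (@plane R).
Implicit Types (f g : R * R -> R) (p q : R -> R) (x z : R * R) (D M : R).

Lemma csmooth_derive1 D p : csmooth D p -> csmooth D (derive1 p).
Proof. by move=> [sp p0]; split; [exact: smooth_derive1|exact: smooth_derive1_supp]. Qed.

Lemma csmooth_moll (d : R) : 0 < d -> csmooth d (moll d).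
Proof.
move=> d0; split; first exact: smooth_moll.
by move=> t /ltW; exact: moll_supp.
Qed.

Lemma csmooth_bounded D p : csmooth D p -> exists2 B : R, 0 < B & forall t, `|p t| <= B.
Proof.
move=> [sp p0].
have [|B B0 hB] := @compact_cont_bounded _ _ `[- D, D]%classic p (@segment_compact R (- D) D).
  by move=> t _; exact: smooth_continuous.
exists B => // t; have [h|h] := leP `|t| D; last by rewrite p0// normr0 ltW.
by apply: hB; rewrite /= in_itv/= -ler_norml.
Qed.

Lemma kern_continuous p q x : continuous p -> continuous q -> continuous (kern p q x).
Proof.
move=> cp cq z; apply: cont_atM.
  apply: (@cont_at_comp1 _ _ (fun z : R * R => x.1 - z.1) p); last exact: cp.
  by apply: cont_atB; [exact: cont_at_cst|exact: cont_at_fst].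
apply: (@cont_at_comp1 _ _ (fun z : R * R => x.2 - z.2) q); last exact: cq.
by apply: cont_atB; [exact: cont_at_cst|exact: cont_at_snd].
Qed.

Lemma kern0 D M p q x z : csmooth D p -> csmooth D q -> box M x -> ~ box (M + D) z ->
  kern p q x z = 0.
Proof.
move=> [_ p0] [_ q0] bx nz; rewrite /kern.
have [h1|h1] := leP `|x.1 - z.1| D; last by rewrite p0// mul0r.
have [h2|h2] := leP `|x.2 - z.2| D; last by rewrite q0// mulr0.
by exfalso; apply: nz; exact: box_near bx h1 h2.
Qed.

Lemma in_box x : box (`|x.1| + `|x.2|) x.
Proof. by apply/box_normP; rewrite lerDl lerDr. Qed.

Section one_kernel.
Variables (D : R) (p q : R -> R).
Hypotheses (hp : csmooth D p) (hq : csmooth D q).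

Let ck x : continuous (kern p q x).
Proof. by apply: kern_continuous; apply: smooth_continuous; [exact: hp.1|exact: hq.1]. Qed.

Lemma conv_integrable_box f M x : locint f -> mu.-integrable (box M) (EFin \o (fun z => f z * kern p q x z)).
Proof. by move=> lf; exact: (locintM_cont lf (@ck x)).2 M. Qed.

Lemma conv_integrable f x : locint f -> mu.-integrable setT (EFin \o (fun z => f z * kern p q x z)).
Proof.
move=> lf; apply: (@integrable_box_supp _ _ (`|x.1| + `|x.2| + D)).
  by move=> z /(kern0 hp hq (in_box x)) ->; rewrite mulr0.
exact: conv_integrable_box.
Qed.

Lemma conv_boxE f M x : box M x -> conv f p q x = \int[mu]_(z in box (M + D)) (f z * kern p q x z).
Proof.
move=> bx; apply: integral_box_supp => z /(kern0 hp hq bx) ->; by rewrite mulr0.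
Qed.

Lemma convD f g x : locint f -> locint g ->
  conv (fun z => f z + g z) p q x = conv f p q x + conv g p q x.
Proof.
move=> lf lg; rewrite /conv -RintegralD//; [|exact: conv_integrable..].
by apply: eq_Rintegral => z _; rewrite mulrDl.
Qed.

Lemma convZ (a : R) f x : locint f -> conv (fun z => a * f z) p q x = a * conv f p q x.
Proof.
move=> lf; rewrite /conv -RintegralZl//; [|exact: conv_integrable].
by apply: eq_Rintegral => z _; rewrite mulrA.
Qed.

Lemma conv_bounded f M : locint f -> exists2 C, 0 < C & forall x, box M x -> `|conv f p q x| <= C.
Proof.
move=> lf; have [B1 B10 hB1] := csmooth_bounded hp; have [B2 B20 hB2] := csmooth_bounded hq.
have In := integrable_norm (lf.2 (M + D)).
exists (B1 * B2 * \int[mu]_(z in box (M + D)) `|f z| + 1).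
  rewrite ltr_pwDr// mulr_ge0//; first by rewrite mulr_ge0// ltW.
  by apply: Rintegral_ge0 => z _.
move=> x bx; rewrite (conv_boxE f bx).
apply: le_trans (_ : B1 * B2 * \int[mu]_(z in box (M + D)) `|f z| <= _); last by rewrite lerDl.
have mb : measurable (box (M + D) : set R2) by exact: measurable_box.
apply: le_trans (le_normr_Rintegral mb (conv_integrable_box _ _ lf)) _.
rewrite -RintegralZl//; apply: le_Rintegral => //.
- exact: (integrable_norm (conv_integrable_box _ _ lf)).
- exact: (integrableZl mb (B1 * B2) In).
- move=> z _; rewrite normrM mulrC ler_wpM2r// normrM.
  by apply: ler_pM.
Qed.

End one_kernel.

Lemma kern_dir D p q x z (e : R * R) (t : R) : csmooth D p -> csmooth D q ->
  has_der (fun t => kern p q (x.1 + t * e.1, x.2 + t * e.2) z) t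
   (e.1 * kern (derive1 p) q (x.1 + t * e.1, x.2 + t * e.2) z +
    e.2 * kern p (derive1 q) (x.1 + t * e.1, x.2 + t * e.2) z).
Proof.
move=> [sp _] [sq _]; rewrite /kern/=.
have h1 : has_der (fun t => p (x.1 + t * e.1 - z.1)) t (e.1 * derive1 p (x.1 + t * e.1 - z.1)).
  have := @has_der_comp_affine _ p e.1 (x.1 - z.1) t _ (smooth_has_der _ sp).
  rewrite (_ : e.1 * t + _ = x.1 + t * e.1 - z.1); last by ring.
  by apply: has_der_ext => s; congr p; ring.
have h2 : has_der (fun t => q (x.2 + t * e.2 - z.2)) t (e.2 * derive1 q (x.2 + t * e.2 - z.2)).
  have := @has_der_comp_affine _ q e.2 (x.2 - z.2) t _ (smooth_has_der _ sq).
  rewrite (_ : e.2 * t + _ = x.2 + t * e.2 - z.2); last by ring.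
  by apply: has_der_ext => s; congr q; ring.
by apply: has_der_eq (has_derM h1 h2) _; ring.
Qed.

(** Differentiation under the integral sign along the line through [x] with direction [e]; the
    derivative falls on the kernel, so [f] need only be locally integrable. *)
Lemma conv_dir D f p q x (e : R * R) (t : R) : locint f -> csmooth D p -> csmooth D q ->
  has_der (fun t => conv f p q (x.1 + t * e.1, x.2 + t * e.2)) t
   (e.1 * conv f (derive1 p) q (x.1 + t * e.1, x.2 + t * e.2) +
    e.2 * conv f p (derive1 q) (x.1 + t * e.1, x.2 + t * e.2)).
Proof.
move=> lf hp hq.
have hp' := csmooth_derive1 hp; have hq' := csmooth_derive1 hq.
(* [M] bounds the points of the line with parameter within 1 of [t], so that one fixed box [M + D]
   carries all the kernels and [G] dominates there. *)
pose M := `|x.1| + `|x.2| + (`|t| + 1) * (`|e.1| + `|e.2|).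
have bM s : s \in `]t - 1, t + 1[ -> box M (x.1 + s * e.1, x.2 + s * e.2).
  rewrite in_itv/= => /andP[s1 s2].
  have sb : `|s| <= `|t| + 1.
    by rewrite ler_norml; have := ler_norm t; have := ler_norm (- t); rewrite normrN => *; apply/andP; split; lra.
  have b1 : `|s * e.1| <= (`|t| + 1) * `|e.1| by rewrite normrM ler_wpM2r.
  have b2 : `|s * e.2| <= (`|t| + 1) * `|e.2| by rewrite normrM ler_wpM2r.
  have n1 := normr_ge0 x.1; have n2 := normr_ge0 x.2.
  have n3 := normr_ge0 (s * e.1); have n4 := normr_ge0 (s * e.2).
  have a1 := ler_normD x.1 (s * e.1); have a2 := ler_normD x.2 (s * e.2).
  split; rewrite -ler_norml /M /= mulrDr; lra.
have [B1 B10 hB1] := csmooth_bounded hp; have [B2 B20 hB2] := csmooth_bounded hq.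
have [B3 B30 hB3] := csmooth_bounded hp'; have [B4 B40 hB4] := csmooth_bounded hq'.
pose F s z := f z * kern p q (x.1 + s * e.1, x.2 + s * e.2) z.
pose G z := `|f z| * (`|e.1| * (B3 * B2) + `|e.2| * (B1 * B4)).
have dF s z : has_der (F ^~ z) s (f z * (e.1 * kern (derive1 p) q (x.1 + s * e.1, x.2 + s * e.2) z +
    e.2 * kern p (derive1 q) (x.1 + s * e.1, x.2 + s * e.2) z)).
  by apply: has_derZ; exact: (kern_dir x z e s hp hq).
have mb : measurable (box (M + D) : set R2) by exact: measurable_box.
have It : (`]t - 1, t + 1[%classic : set R) t by rewrite /= in_itv/=; apply/andP; split; lra.
have intF s : (`]t - 1, t + 1[%classic : set R) s -> mu.-integrable (box (M + D)) (EFin \o F s).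
  by move=> _; exact: (conv_integrable_box hp hq _ _ lf).
have derF s z : (`]t - 1, t + 1[%classic : set R) s -> box (M + D) z -> derivable (F ^~ z) s 1.
  by move=> _ _; have [] := dF s z.
have dFE s z : partial1of2 F s z = f z * (e.1 * kern (derive1 p) q (x.1 + s * e.1, x.2 + s * e.2) z +
    e.2 * kern p (derive1 q) (x.1 + s * e.1, x.2 + s * e.2) z).
  by rewrite /partial1of2 derive1E; have [_ ->] := dF s z.
have G0 z : 0 <= G z by rewrite mulr_ge0// addr_ge0// mulr_ge0// mulr_ge0// ltW.
have intG : mu.-integrable (box (M + D)) (EFin \o G).
  have In := integrable_norm (lf.2 (M + D)).
  exact: (integrableZr mb _ In).
have Gub s z : (`]t - 1, t + 1[%classic : set R) s -> box (M + D) z -> `|partial1of2 F s z| <= G z.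
  move=> _ _; rewrite dFE normrM ler_wpM2l//.
  apply: le_trans (ler_normD _ _) _; rewrite /kern !normrM.
  by apply: lerD; rewrite ler_wpM2l//; apply: ler_pM.
have hd := @derivable_under_integral R _ R2 mu F _ mb t _ _ It intF derF G G0 intG Gub.
have he := @differentiation_under_integral R _ R2 mu F _ mb t _ _ It intF derF G G0 intG Gub.
have nearE : \near t, \int[mu]_(y in box (M + D)) F t y = conv f p q (x.1 + t * e.1, x.2 + t * e.2).
  have : t \in `]t - 1, t + 1[ by exact: It.
  move=> /near_in_itvoo; apply: filterS => s /bM bs.
  by rewrite (conv_boxE hp hq f bs).
apply: has_der_near nearE _.
split => //; rewrite -derive1E he.
under eq_Rintegral do rewrite dFE mulrDr mulrCA [X in _ + X]mulrCA.
rewrite RintegralD//; last 2 first.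
- by have := integrableZl mb e.1 (conv_integrable_box hp' hq (M + D) (x.1 + t * e.1, x.2 + t * e.2) lf).
- by have := integrableZl mb e.2 (conv_integrable_box hp hq' (M + D) (x.1 + t * e.1, x.2 + t * e.2) lf).
rewrite RintegralZl//; last exact: (conv_integrable_box hp' hq _ _ lf).
rewrite RintegralZl//; last exact: (conv_integrable_box hp hq' _ _ lf).
by rewrite -(conv_boxE hp' hq f (bM t It)) -(conv_boxE hp hq' f (bM t It)).
Qed.

End convolution.

Section mollification.
Variable R : realType.
Local Notation R2 := (measurableTypeR R * measurableTypeR R)%type.
Local Notation mu := (@plane R).
Local Notation leb := (@lebesgue_measure R).
Implicit Types (f g h : R * R -> R) (p q : R -> R) (x z : R * R) (D M d : R).

Lemma cont_at2P f x : cont_at f x <-> (forall e, 0 < e -> exists2 d, 0 < d &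
  forall y, `|y.1 - x.1| < d -> `|y.2 - x.2| < d -> `|f y - f x| < e).
Proof.
split=> [/cvgrPdist_lt h e e0|h].
  have /nbhs_ballP[d /= d0 hd] := h e e0.
  by exists d => // y y1 y2; rewrite distrC; apply: hd; split => /=; rewrite /ball/= distrC.
apply/cvgrPdist_lt => e e0; have [d d0 hd] := h e e0.
have : nbhs x [set y | `|f x - f y| < e].
  apply/nbhs_ballP; exists d => //= y [/= y1 y2].
  by rewrite distrC; apply: hd; rewrite distrC.
by [].
Qed.

(** Local Lipschitz bound: the mean value theorem on the segment from [x] to [y], the derivative
    being a combination of convolutions with differentiated kernels, which are bounded on boxes. *)
Lemma conv_continuous D f p q : locint f -> csmooth D p -> csmooth D q -> continuous (conv f p q).
Proof.
move=> lf hp hq x; apply/cont_at2P => e e0.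
pose M := `|x.1| + `|x.2| + 1.
have [C1 C10 hC1] := conv_bounded (csmooth_derive1 hp) hq M lf.
have [C2 C20 hC2] := conv_bounded hp (csmooth_derive1 hq) M lf.
exists (Num.min 1 (e / (C1 + C2))); first by rewrite lt_min ltr01 divr_gt0// addr_gt0.
move=> y; rewrite !lt_min !ltr_pdivlMr ?addr_gt0// => /andP[a1 b1] /andP[a2 b2].
pose u := (y.1 - x.1, y.2 - x.2).
have [| |t t01] := @MVT_segment R (fun t => conv f p q (x.1 + t * u.1, x.2 + t * u.2))
  (fun t => u.1 * conv f (derive1 p) q (x.1 + t * u.1, x.2 + t * u.2) +
    u.2 * conv f p (derive1 q) (x.1 + t * u.1, x.2 + t * u.2)) 0 1 ler01.
- by move=> t _; exact: (conv_dir x u t lf hp hq).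
- apply: derivable_within_continuous => t _.
  by have [] := conv_dir x u t lf hp hq.
rewrite !mul0r !mul1r !addr0 subr0 mulr1 /u /= !subrKC => E.
have -> : conv f p q y - conv f p q x = conv f p q (y.1, y.2) - conv f p q (x.1, x.2).
  by case: (y); case: (x).
rewrite E.
move: t01; rewrite in_itv/= => /andP[t0 t1].
have bt : box M (x.1 + t * (y.1 - x.1), x.2 + t * (y.2 - x.2)).
  have n1 : `|t * (y.1 - x.1)| <= 1 by rewrite normrM ger0_norm// mulr_ile1// ltW.
  have n2 : `|t * (y.2 - x.2)| <= 1 by rewrite normrM ger0_norm// mulr_ile1// ltW.
  have n3 := normr_ge0 x.1; have n4 := normr_ge0 x.2.
  have m1 := ler_normD x.1 (t * (y.1 - x.1)); have m2 := ler_normD x.2 (t * (y.2 - x.2)).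
  by split; rewrite -ler_norml /M /=; lra.
have l1 := hC1 _ bt; have l2 := hC2 _ bt.
apply: le_lt_trans (ler_normD _ _) _; rewrite !normrM.
set A := `|y.1 - x.1| in a1 b1 *; set B := `|y.2 - x.2| in a2 b2 *.
have A0 : 0 <= A by exact: normr_ge0.
have B0 : 0 <= B by exact: normr_ge0.
apply: (@le_lt_trans _ _ (A * C1 + B * C2)).
  by apply: lerD; apply: ler_wpM2l.
move: b1 b2; rewrite !mulrDr => b1 b2.
have [AB|/ltW AB] := leP A B.
  by have := ler_wpM2r (ltW C10) AB; lra.
by have := ler_wpM2r (ltW C20) AB; lra.
Qed.

Definition mollify d f : R * R -> R := conv f (moll d) (moll d).

Lemma kern_moll_ge0 d x z : 0 < d -> 0 <= kern (moll d) (moll d) x z.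
Proof. by move=> d0; rewrite mulr_ge0// moll_ge0. Qed.

Lemma kern_moll_sym d x z : kern (moll d) (moll d) x z = kern (moll d) (moll d) z x.
Proof. by rewrite /kern -[moll d (x.1 - z.1)]moll_even -[moll d (x.2 - z.2)]moll_even !opprB. Qed.

Lemma integral_kern_moll d x : 0 < d -> (\int[mu]_z (kern (moll d) (moll d) x z)%:E = 1)%E.
Proof.
move=> d0.
have ck : continuous (kern (moll d) (moll d) x).
  by apply: kern_continuous; apply: smooth_continuous; exact: smooth_moll.
have mk : measurable_fun setT (fun z : R2 => (kern (moll d) (moll d) x z)%:E).
  by apply/measurable_EFinP; exact: continuous_measurable_plane.
have cm (c : R) : measurable_fun setT (fun t : R => (moll d (c - t))%:E).
  have cc : continuous (fun t : R => moll d (c - t)).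
    move=> t; apply: (@cont_at_comp1 _ _ (fun t : R => c - t) (moll d)).
      by apply: cont_atB; [exact: cont_at_cst|exact: cvg_id].
    exact: (smooth_continuous (smooth_moll d)).
  by apply/measurable_EFinP; exact: continuous_measurable_fun.
rewrite (@fubini_tonelli1 _ _ _ _ R leb leb) => //; last first.
  by move=> z; rewrite lee_fin kern_moll_ge0.
rewrite /fubini_F /kern /=.
under eq_integral => t _.
  under eq_integral do rewrite EFinM.
  have m0 (s : R) : (0 <= (moll d s)%:E)%E by rewrite lee_fin moll_ge0.
  rewrite ge0_integralZl_EFin ?moll_ge0//; last exact: cm.
  rewrite integral_moll// mule1.
  over.
exact: (integral_moll d0 x.1).
Qed.

Section fixed_radius.
Variable d : R.
Hypothesis d0 : 0 < d.
Let hm := csmooth_moll d0.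

Lemma mollify_continuous f : locint f -> continuous (mollify d f).
Proof. by move=> lf; exact: (conv_continuous lf hm hm). Qed.

Lemma mollify_cst (c : R) x : mollify d (fun=> c) x = c.
Proof.
rewrite /mollify /conv.
have ik : mu.-integrable setT (EFin \o (kern (moll d) (moll d) x)).
  have := conv_integrable hm hm x (cont_locint (@cst_continuous _ _ (1 : R))).
  by apply: eq_integrable => // z _ /=; rewrite mul1r.
rewrite RintegralZl// /Rintegral integral_kern_moll//= mulr1//.
Qed.

Lemma le_mollify f g x : locint f -> locint g ->
  (forall z, `|x.1 - z.1| <= d -> `|x.2 - z.2| <= d -> f z <= g z) ->
  mollify d f x <= mollify d g x.
Proof.
move=> lf lg h; apply: le_Rintegral => //; [exact: (conv_integrable hm hm)..|].
move=> z _; have [h1|h1] := leP `|x.1 - z.1| d; last first.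
  by rewrite /kern (hm.2 _ h1) mul0r !mulr0.
have [h2|h2] := leP `|x.2 - z.2| d; last first.
  by rewrite /kern (hm.2 _ h2) !mulr0.
by rewrite ler_wpM2r ?kern_moll_ge0//; exact: h.
Qed.

Lemma mollify_cont_dist f x (c e : R) : continuous f ->
  (forall z, `|x.1 - z.1| <= d -> `|x.2 - z.2| <= d -> `|f z - c| <= e) ->
  `|mollify d f x - c| <= e.
Proof.
move=> cf h; have lf := cont_locint cf.
have lc (a : R) : locint (fun=> a) by apply: cont_locint; exact: cst_continuous.
rewrite ler_distl -{1}(mollify_cst (c - e) x) -(mollify_cst (c + e) x).
by apply/andP; split; apply: le_mollify => // z z1 z2; have := h z z1 z2;
  rewrite ler_distl => /andP[].
Qed.

Lemma mollifyD f g x : locint f -> locint g ->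
  mollify d (fun z => f z + g z) x = mollify d f x + mollify d g x.
Proof. exact: (convD hm hm). Qed.

Lemma mollifyZ (a : R) f x : locint f -> mollify d (fun z => a * f z) x = a * mollify d f x.
Proof. exact: (convZ hm hm). Qed.

(** The variance is nonnegative: average [(f - c)^2], where [c] is the average of [f]. *)
Lemma mollify_jensen f x : locint f -> locint (fun z => f z ^+ 2) ->
  mollify d f x ^+ 2 <= mollify d (fun z => f z ^+ 2) x.
Proof.
move=> lf lf2; set c := mollify d f x.
have lc (a : R) : locint (fun=> a) by apply: cont_locint; exact: cst_continuous.
have lfc : locint (fun z => (- (2 * c)) * f z).
  have := locintM_cont lf (@cst_continuous _ _ (- (2 * c) : R)).
  by congr locint; apply/funext => z; rewrite mulrC.
have e : mollify d (fun z => f z ^+ 2 + (- (2 * c) * f z + c ^+ 2)) x =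
    mollify d (fun z => f z ^+ 2) x - c ^+ 2.
  rewrite mollifyD//; last exact: locintD.
  by rewrite mollifyD// mollifyZ// mollify_cst -/c; ring.
rewrite -subr_ge0 -e -(mollify_cst 0 x); apply: le_mollify => //.
  by apply: locintD => //; exact: locintD.
move=> z _ _; have -> : f z ^+ 2 + (- (2 * c) * f z + c ^+ 2) = (f z - c) ^+ 2 by ring.
exact: sqr_ge0.
Qed.

(** Tonelli: for fixed [z] the kernel has total mass 1 in [x], and for [x] in [box M] it vanishes
    unless [z] lies in the box enlarged by [d]. *)
Lemma integral_mollify_le h M : locint h -> (forall z, 0 <= h z) ->
  \int[mu]_(x in box M) mollify d h x <= \int[mu]_(z in box (M + d)) h z.
Proof.
move=> lh h0.
pose k x z := kern (moll d) (moll d) x z.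
have k0 x z : 0 <= k x z by exact: kern_moll_ge0.
have mm : measurable_fun setT (moll d : R -> R).
  by apply: continuous_measurable_fun; apply: smooth_continuous; exact: smooth_moll.
pose F (w : R2 * R2) : \bar R := (\1_(box M : set R2) w.1 * (h w.2 * k w.1 w.2))%:E.
have mF : measurable_fun setT F.
  apply/measurable_EFinP; apply: measurable_funM.
    by apply: measurableT_comp; [exact: measurable_indic (measurable_box M)|exact: measurable_fst].
  apply: measurable_funM.
    by apply: measurableT_comp; [exact: lh.1|exact: measurable_snd].
  apply: measurable_funM.
    apply: (measurableT_comp mm); apply: measurable_funB.
      by apply: (measurableT_comp measurable_fst); exact: measurable_fst.
    by apply: (measurableT_comp measurable_fst); exact: measurable_snd.
  apply: (measurableT_comp mm); apply: measurable_funB.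
    by apply: (measurableT_comp measurable_snd); exact: measurable_fst.
  by apply: (measurableT_comp measurable_snd); exact: measurable_snd.
have F0 w : (0 <= F w)%E by rewrite lee_fin mulr_ge0// mulr_ge0.
have fub := @fubini_tonelli _ _ _ _ R (@plane R) (@plane R) F mF F0.
have cmh : continuous (mollify d h) by exact: mollify_continuous.
rewrite -lee_fin.
have -> : (\int[mu]_(x in box M) mollify d h x)%:E = (\int[mu]_x \int[mu]_z F (x, z))%E.
  rewrite /Rintegral fineK; last first.
    by apply: integrable_fin_num; [exact: measurable_box|apply: (cont_locint cmh).2].
  rewrite integral_mkcond; apply: eq_integral => x _.
  rewrite patchE /F /=; case: ifPn => xM.
    have ik : (\int[mu]_z (h z * k x z)%:E)%E \is a fin_num.
      exact: (integrable_fin_num measurableT (conv_integrable hm hm x lh)).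
    transitivity (\int[mu]_z (h z * k x z)%:E)%E; first exact: (fineK ik).
    by apply: eq_integral => z _; rewrite indicE xM mul1r.
  rewrite indicE (negbTE xM)/=; under [RHS]eq_integral do rewrite mul0r.
  by rewrite integral0.
rewrite fub.
have -> : (\int[mu]_(z in box (M + d)) h z)%:E = (\int[mu]_z (\1_(box (M + d) : set R2) z * h z)%:E)%E.
  rewrite /Rintegral fineK; last first.
    by apply: integrable_fin_num; [exact: measurable_box|apply: lh.2].
  rewrite integral_mkcond; apply: eq_integral => z _.
  by rewrite patchE indicE; case: ifPn => _; rewrite ?mul1r ?mul0r.
apply: ge0_le_integral; first exact: measurableT.
- by move=> z _; apply: integral_ge0.
- exact: (@measurable_fun_fubini_tonelli_G _ _ _ _ R (@plane R) F mF F0).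
- apply/measurable_EFinP; apply: measurable_funM; last exact: lh.1.
  exact: measurable_indic (measurable_box _).
move=> z _; rewrite /fubini_G indicE; case: (boolP (z \in _)) => zM; last first.
  have Fz x : F (x, z) = 0%E.
    rewrite /F/= indicE; case: (boolP (x \in _)) => xM; last by rewrite mul0r.
    have bx : box M x := set_mem xM.
    have nz : ~ box (M + d) z by move=> bz; move/negP: zM; apply; exact: mem_set.
    have kz : k x z = 0 := kern0 hm hm bx nz.
    by rewrite kz !mulr0.
  rewrite mul0r.
  by have -> : (fun x => F (x, z)) = (fun=> 0%E) by [apply/funext|]; rewrite integral0.
rewrite mul1r.
have mk : measurable_fun setT (fun x : R2 => (k x z)%:E).
  apply/measurable_EFinP; rewrite (_ : k ^~ z = k z); last by apply/funext => x; exact: kern_moll_sym.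
  have ck : continuous (k z).
    by apply: kern_continuous; apply: smooth_continuous; exact: smooth_moll.
  exact: continuous_measurable_plane ck.
have one : (\int[mu]_x (k x z)%:E)%E = 1%E.
  rewrite -(integral_kern_moll z d0); apply: eq_integral => x _.
  by congr EFin; exact: kern_moll_sym.
apply: (@le_trans _ _ (\int[mu]_x ((h z)%:E * (k x z)%:E))%E).
  apply: ge0_le_integral; first exact: measurableT.
  - by move=> x _; exact: F0.
  - exact: (measurableT_comp mF (measurable_pair2 z)).
  - exact: (measurable_funeM (h z)%:E mk).
  - move=> x _; rewrite -EFinM lee_fin /= indicE; case: (x \in _).
      by rewrite mul1r.
    by rewrite mul0r; apply: mulr_ge0; [exact: h0|exact: k0].
rewrite ge0_integralZl_EFin; [|exact: measurableT|by move=> x _; rewrite lee_fin; exact: k0|exact: mk|exact: h0].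
rewrite one mule1; exact: lexx.
Qed.

End fixed_radius.
End mollification.

(** * Uniform approximation and integration by parts on boxes *)

Section box_calculus.
Variable R : realType.
Local Notation R2 := (measurableTypeR R * measurableTypeR R)%type.
Local Notation mu := (@plane R).
Local Notation leb := (@lebesgue_measure R).
Implicit Types (f g h Phi : R * R -> R) (x z : R * R) (M d e : R).

(** Only [x] is confined to the compact box; [y] may leave it, which is needed because mollification
    looks beyond the box. *)
Lemma unif_cont_box f M e : continuous f -> 0 < e -> exists2 d, 0 < d &
  forall x y : R * R, box M x -> `|y.1 - x.1| <= d -> `|y.2 - x.2| <= d -> `|f y - f x| < e.
Proof.
move=> cf e0.
pose P d x := forall y, `|y.1 - x.1| <= d -> `|y.2 - x.2| <= d -> `|f y - f x| < e.
have cb : near_covering (box M) by apply/compact_near_coveringP; exact: compact_rect.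
have : \forall d \near (0 : R)^'+, box M `<=` P d.
  apply: cb => x _.
  have [d d0 hd] := (cont_at2P f x).1 (cf x) (e / 2) (divr_gt0 e0 (ltr0Sn _ 1)).
  exists (ball x (d / 2), [set s | s < d / 2]).
    split; first by apply: nbhsx_ballx; rewrite divr_gt0.
    by apply: nbhs_right_lt; rewrite divr_gt0.
  move=> [x' s] [/= [b1 b2] sd] y y1 y2.
  rewrite /ball/= distrC in b1; rewrite /ball/= distrC in b2.
  have h1 : `|f x' - f x| < e / 2 by apply: hd; lra.
  have h2 : `|f y - f x| < e / 2.
    apply: hd.
      by have := ler_distD x'.1 y.1 x.1; lra.
    by have := ler_distD x'.2 y.2 x.2; lra.
  have := ler_distD (f x) (f y) (f x'); rewrite [`|f x - f x'|]distrC; lra.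
move=> h; have [d [/= d0 hd]] : exists d, 0 < d /\ box M `<=` P d.
  near (0 : R)^'+ => d; exists d; split; first by near: d; exact: nbhs_right_gt.
  by near: d.
by exists d => // x y bx; exact: hd.
Unshelve. all: by end_near. Qed.

(** The value at [x] of a function of the mollified pair is compared with the unmollified one at
    every nearby [z], not only at [z = x]: this form can be inserted under the integral defining a
    mollification. *)
Lemma mollify_unif (u w Psi : R * R -> R) M e : continuous u -> continuous w -> continuous Psi ->
  0 < e -> exists2 d0, 0 < d0 & forall d x z, 0 < d -> d <= d0 -> box M x ->
    `|x.1 - z.1| <= d -> `|x.2 - z.2| <= d ->
    `|Psi (mollify d u x, mollify d w x) - Psi (u z, w z)| < e.
Proof.
move=> cu cw cP e0.
have cau z : cont_at u z by exact: cu.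
have caw z : cont_at w z by exact: cw.
have [B1 B10 hB1] := compact_cont_bounded (@compact_rect R (- (M + 1)) (M + 1) (- (M + 1)) (M + 1)) (fun z _ => cau z).
have [B2 B20 hB2] := compact_cont_bounded (@compact_rect R (- (M + 1)) (M + 1) (- (M + 1)) (M + 1)) (fun z _ => caw z).
have [s s0 hs] := unif_cont_box (B1 + B2) cP e0.
have s20 : 0 < s / 2 by rewrite divr_gt0.
have [d1 d10 h1] := unif_cont_box M cu s20.
have [d2 d20 h2] := unif_cont_box M cw s20.
exists (Num.min 1 (Num.min d1 d2)); first by rewrite !lt_min ltr01 d10.
move=> d x z d0; rewrite !le_min => /andP[dd /andP[dd1 dd2]] bx xz1 xz2.
have bz : box (M + 1) z.
  by apply: (box_near bx); [exact: le_trans xz1 dd|exact: le_trans xz2 dd].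
have hu : `|mollify d u x - u x| <= s / 2.
  apply: mollify_cont_dist => // y y1 y2; apply: ltW; apply: h1 => //; rewrite distrC.
    exact: le_trans y1 dd1.
  exact: le_trans y2 dd1.
have hw : `|mollify d w x - w x| <= s / 2.
  apply: mollify_cont_dist => // y y1 y2; apply: ltW; apply: h2 => //; rewrite distrC.
    exact: le_trans y1 dd2.
  exact: le_trans y2 dd2.
have hu' : `|u z - u x| < s / 2.
  by apply: h1 => //; rewrite distrC; [exact: le_trans xz1 dd1|exact: le_trans xz2 dd1].
have hw' : `|w z - w x| < s / 2.
  by apply: h2 => //; rewrite distrC; [exact: le_trans xz1 dd2|exact: le_trans xz2 dd2].
apply: hs => /=.
- apply/box_normP; split.
    by rewrite (le_trans (hB1 _ bz))// lerDl ltW.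
  by rewrite (le_trans (hB2 _ bz))// lerDr ltW.
- by rewrite (le_trans (ler_distD (u x) _ _))// [leRHS]splitr lerD// distrC ltW.
- by rewrite (le_trans (ler_distD (w x) _ _))// [leRHS]splitr lerD// distrC ltW.
Qed.

Lemma itv_ftc (F dF : R -> R) (a b : R) : a < b ->
  (forall t, a <= t <= b -> cont_at dF t) -> (forall t, a <= t <= b -> has_der F t (dF t)) ->
  (\int[leb]_(t in `[a, b]) (dF t)%:E = (F b - F a)%:E)%E.
Proof.
move=> ab cdF hF.
rewrite (continuous_FTC2 ab (F := F)) ?EFinB//.
- by apply: continuous_in_subspaceT => t; rewrite inE/= in_itv/=; exact: cdF.
- have aa : a <= a <= b by rewrite lexx ltW.
  have bb : a <= b <= b by rewrite lexx ltW.
  split.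
  + move=> t; rewrite in_itv/= => /andP[/ltW h1 /ltW h2]; have tt : a <= t <= b by rewrite h1.
    by have [] := hF t tt.
  + by apply: cvg_at_right_filter; exact: has_der_cont (hF a aa).
  + by apply: cvg_at_left_filter; exact: has_der_cont (hF b bb).
- move=> t; rewrite in_itv/= => /andP[/ltW h1 /ltW h2].
  have tt : a <= t <= b by rewrite h1.
  by rewrite derive1E; have [_ ->] := hF t tt.
Qed.

Lemma rect_ftc1 Phi f (a b c d : R) : a < b ->
  (forall z, rect a b c d z -> cont_at f z) ->
  (forall z, rect a b c d z -> has_der (fun t => Phi (t, z.2)) z.1 (f z)) ->
  \int[mu]_(z in rect a b c d) f z = \int[leb]_(y in `[c, d]) (Phi (b, y) - Phi (a, y)).
Proof.
move=> ab cf hf; congr fine.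
have intf : mu.-integrable (rect a b c d) (EFin \o f) by exact: cont_integrable.
rewrite integral_mkcond -(@integral21_prod_meas1 _ _ _ _ R leb leb) ; last first.
  by apply/(integrable_mkcond _ (@measurable_rect R a b c d)).
rewrite [RHS]integral_mkcond; apply: eq_integral => y _.
rewrite patchE; case: ifPn => yc; last first.
  rewrite -[RHS](@integral0 _ _ _ leb setT); apply: eq_integral => x _.
  rewrite patchE ifF//; apply: contraNF yc; rewrite !inE => -[_ /= h].
  by rewrite /= in_itv/= h.
move: yc; rewrite inE/= in_itv/= => yc.
rewrite -(itv_ftc (F := fun t => Phi (t, y)) (dF := fun t => f (t, y)) ab).
- rewrite [RHS]integral_mkcond; apply: eq_integral => x _.
  rewrite !patchE; case: ifPn => hx.
    by rewrite ifT//; move: hx; rewrite !inE => -[/= h _]; rewrite in_itv.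
  rewrite ifF//; apply: contraNF hx; rewrite !inE /= in_itv/= => h.
  by split => //=.
- move=> t tab; apply: (@cont_at_comp2 _ _ (fun t => t) (fun=> y) f).
  + exact: cvg_id.
  + exact: cont_at_cst.
  + by apply: cf; split.
- by move=> t tab; apply: (hf (t, y)); split.
Qed.

Lemma rect_ftc2 Phi f (a b c d : R) : c < d ->
  (forall z, rect a b c d z -> cont_at f z) ->
  (forall z, rect a b c d z -> has_der (fun t => Phi (z.1, t)) z.2 (f z)) ->
  \int[mu]_(z in rect a b c d) f z = \int[leb]_(x in `[a, b]) (Phi (x, d) - Phi (x, c)).
Proof.
move=> cd cf hf; congr fine.
have intf : mu.-integrable (rect a b c d) (EFin \o f) by exact: cont_integrable.
rewrite integral_mkcond -(@integral12_prod_meas1 _ _ _ _ R leb leb) ; last first.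
  by apply/(integrable_mkcond _ (@measurable_rect R a b c d)).
rewrite [RHS]integral_mkcond; apply: eq_integral => x _.
rewrite patchE; case: ifPn => xc; last first.
  rewrite -[RHS](@integral0 _ _ _ leb setT); apply: eq_integral => y _.
  rewrite patchE ifF//; apply: contraNF xc; rewrite !inE => -[/= h _].
  by rewrite /= in_itv/= h.
move: xc; rewrite inE/= in_itv/= => xc.
rewrite -(itv_ftc (F := fun t => Phi (x, t)) (dF := fun t => f (x, t)) cd).
- rewrite [RHS]integral_mkcond; apply: eq_integral => y _.
  rewrite !patchE; case: ifPn => hy.
    by rewrite ifT//; move: hy; rewrite !inE => -[_ /= h]; rewrite in_itv.
  rewrite ifF//; apply: contraNF hy; rewrite !inE /= in_itv/= => h.
  by split => //=.
- move=> t tab; apply: (@cont_at_comp2 _ _ (fun=> x) (fun t => t) f).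
  + exact: cont_at_cst.
  + exact: cvg_id.
  + by apply: cf; split.
- by move=> t tab; apply: (hf (x, t)); split.
Qed.

(** The divergence theorem for the field [(Phi1, Phi2)] on a square, with components vanishing on
    the sides where they would contribute a flux. *)
Lemma rect_ibp (Phi1 Phi2 f1 f2 : R * R -> R) M : 0 < M ->
  (forall z, box M z -> cont_at f1 z) -> (forall z, box M z -> cont_at f2 z) ->
  (forall z, box M z -> has_der (fun t => Phi1 (t, z.2)) z.1 (f1 z)) ->
  (forall z, box M z -> has_der (fun t => Phi2 (z.1, t)) z.2 (f2 z)) ->
  (forall s, Phi1 (M, s) = 0) -> (forall s, Phi1 (- M, s) = 0) ->
  (forall s, Phi2 (s, M) = 0) -> (forall s, Phi2 (s, - M) = 0) ->
  \int[mu]_(z in box M) (f1 z + f2 z) = 0.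
Proof.
move=> M0 c1 c2 h1 h2 z1 z2 z3 z4.
rewrite RintegralD; [|exact: measurable_box|exact: cont_integrable|exact: cont_integrable].
have MM : - M < M by rewrite gtrN.
rewrite (rect_ftc1 MM c1 h1) (rect_ftc2 MM c2 h2).
under eq_Rintegral do rewrite z1 z2 subrr.
under [X in _ + X]eq_Rintegral do rewrite z3 z4 subrr.
by rewrite !Rintegral_cst// !mul0r addr0.
Qed.

End box_calculus.

(** * The truncated angle *)

Section angle.
Variable R : realType.
Implicit Types (p q s t : R).

Definition pospart t : R := Num.max 0 t.

Lemma pospart_ge0 t : 0 <= pospart t.
Proof. by rewrite /pospart le_max lexx. Qed.

Lemma pospart_cont (T : topologicalType) (f : T -> R) x : cont_at f x -> cont_at (fun y => pospart (f y)) x.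
Proof. by move=> hf; apply: cont_at_max => //; exact: cont_at_cst. Qed.

Lemma has_der_pospart2 t : has_der (fun t => pospart t ^+ 2) t (2 * pospart t).
Proof.
have [t0|t0|->] := ltgtP t 0.
- rewrite {2}/pospart max_l ?(ltW t0)// mulr0.
  apply: (@has_der_near _ (fun=> 0)); last exact: has_der_cst.
  near=> u; rewrite /pospart max_l ?expr0n//.
  by apply: ltW; near: u; exact: lt_nbhsl.
- rewrite {2}/pospart max_r ?(ltW t0)//.
  apply: (@has_der_near _ (fun u => u ^+ 2)).
    near=> u; rewrite /pospart max_r//.
    by apply: ltW; near: u; exact: lt_nbhsr.
  by apply: has_der_eq (has_derX 2 (has_der_id t)) _; rewrite mulr1 expr1.
- rewrite {2}/pospart maxxx mulr0.
  have h : h^-1 *: (pospart (h + 0) ^+ 2 - pospart 0 ^+ 2) @[h --> 0^'] --> (0 : R).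
    apply/cvgr0Pnorm_le => e e0.
    near=> h; rewrite {2}/pospart maxxx expr0n subr0 addr0.
    have h0 : h != 0 by near: h; exact: nbhs_dnbhs_neq.
    rewrite normrZ normfV normrX ler_pdivrMl ?normr_gt0// expr2.
    have hh : `|pospart h| <= `|h|.
      by rewrite ger0_norm ?pospart_ge0// /pospart ge_max normr_ge0 ler_norm.
    apply: (@le_trans _ _ (`|h| * `|h|)); first by apply: ler_pM.
    rewrite ler_wpM2l//.
    by near: h; apply: dnbhs0_le.
  split; first by apply/cvg_ex; exists 0; under eq_fun do rewrite scaler1.
  by rewrite /derive; under eq_fun do rewrite scaler1; exact: cvg_lim.
Unshelve. all: by end_near. Qed.

(* A [C^1] truncation with values in [0, 1] that vanishes for [s <= E], tends to [1] as [E] tends to [0],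
   and for which [s * dchi E s] is bounded uniformly in [E]. *)
Definition chi (E s : R) : R := pospart (s - E) ^+ 2 / (E ^+ 2 + pospart (s - E) ^+ 2).
Definition dchi (E s : R) : R := 2 * pospart (s - E) * E ^+ 2 / (E ^+ 2 + pospart (s - E) ^+ 2) ^+ 2.

Section chi_theory.
Variable E : R.
Hypothesis E0 : 0 < E.
Let den_gt0 s : 0 < E ^+ 2 + pospart (s - E) ^+ 2.
Proof. by rewrite ltr_pwDl// ?exprn_gt0// sqr_ge0. Qed.

Lemma has_der_chi s : has_der (chi E) s (dchi E s).
Proof.
have h : has_der (fun s => pospart (s - E) ^+ 2) s (2 * pospart (s - E)).
  have := @has_der_comp _ (fun t => pospart t ^+ 2) (fun s => s - E) s _ _
    (has_der_pospart2 _) (has_derB (has_der_id s) (has_der_cst E s)).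
  by rewrite subr0 mulr1.
have d0 : E ^+ 2 + pospart (s - E) ^+ 2 != 0 by rewrite gt_eqF.
have hd := has_derD (has_der_cst (E ^+ 2) s) h.
have H := has_derM h (@has_derV _ (fun s => E ^+ 2 + pospart (s - E) ^+ 2) _ _ d0 hd).
suff e : dchi E s = 2 * pospart (s - E) * (E ^+ 2 + pospart (s - E) ^+ 2)^-1 +
    pospart (s - E) ^+ 2 * - ((0 + 2 * pospart (s - E)) / (E ^+ 2 + pospart (s - E) ^+ 2) ^+ 2).
  by rewrite e.
by rewrite /dchi; field.
Qed.

Lemma chi_eq0 s : s <= E -> chi E s = 0.
Proof. by move=> sE; rewrite /chi /pospart max_l ?subr_le0// expr0n mul0r. Qed.

Lemma dchi_eq0 s : s <= E -> dchi E s = 0.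
Proof. by move=> sE; rewrite /dchi /pospart max_l ?subr_le0// mulr0 !mul0r. Qed.

Lemma chi_ge0 s : 0 <= chi E s.
Proof. by rewrite divr_ge0 ?sqr_ge0// ltW. Qed.

Lemma chi_le1 s : chi E s <= 1.
Proof. by rewrite ler_pdivrMr// mul1r lerDr sqr_ge0. Qed.

Lemma chi_half s : 2 * E <= s -> 2^-1 <= chi E s.
Proof.
move=> h; rewrite ler_pdivlMr// /pospart max_r; last by move: h E0; lra.
rewrite mulrDr -lerBrDr.
have : E ^+ 2 <= (s - E) ^+ 2 by rewrite ler_sqr ?nnegrE; move: h E0; lra.
lra.
Qed.

Lemma dchi_ge0 s : 0 <= dchi E s.
Proof. by rewrite /dchi divr_ge0 ?sqr_ge0// mulr_ge0 ?sqr_ge0// mulr_ge0// pospart_ge0. Qed.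

(** With [u = s - E > 0] this reduces to [2 u E + 2 u^2 <= 3 (E^2 + u^2)]. The product
    [s * dchi E s] is the weight of the gradient energy in the error caused by truncating the
    angle. *)
Lemma sdchi_le s : s * dchi E s <= 3 * E ^+ 2 / (E ^+ 2 + pospart (s - E) ^+ 2).
Proof.
have [sE|Es] := leP s E; first by rewrite dchi_eq0// mulr0 mulr_ge0 ?invr_ge0 ?(ltW (den_gt0 s))// mulr_ge0// sqr_ge0.
have := den_gt0 s; rewrite /dchi /pospart max_r ?subr_ge0; last exact: ltW.
set u := s - E; set d := E ^+ 2 + u ^+ 2 => d0.
have -> : s * (2 * u * E ^+ 2 / d ^+ 2) = s * (2 * u * E ^+ 2) / d / d.
  by field; rewrite gt_eqF.
rewrite ler_pM2r ?invr_gt0// ler_pdivrMr//.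
have -> : s = E + u by rewrite addrC subrK.
have u0 : 0 < u by rewrite subr_gt0.
have -> : (E + u) * (2 * u * E ^+ 2) = E ^+ 2 * (2 * u * E + 2 * u ^+ 2) by ring.
have -> : 3 * E ^+ 2 * d = E ^+ 2 * (3 * d) by ring.
rewrite ler_wpM2l ?sqr_ge0// /d.
have := sqr_ge0 (u - E); rewrite sqrrB; have := sqr_ge0 E; have : 0 <= E * u by rewrite mulr_ge0 ?ltW.
rewrite !expr2; lra.
Qed.

Lemma sdchi_le3 s : s * dchi E s <= 3.
Proof.
apply: le_trans (sdchi_le s) _; rewrite ler_pdivrMr// ler_wpM2l// lerDl sqr_ge0//.
Qed.

Lemma sdchi_ge0 s : 0 <= s -> 0 <= s * dchi E s.
Proof. by move=> s0; rewrite mulr_ge0// dchi_ge0. Qed.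

Lemma cont_at_chi s : cont_at (chi E) s.
Proof. exact: has_der_cont (has_der_chi s). Qed.

Lemma cont_at_dchi s : cont_at (dchi E) s.
Proof.
have hp : cont_at (fun s => pospart (s - E)) s.
  by apply: pospart_cont; apply: cont_atB; [exact: cvg_id|exact: cont_at_cst].
apply: cont_atM.
  by apply: cont_atM; [apply: cont_atM => //; exact: cont_at_cst|exact: cont_at_cst].
apply: cont_atV; first by rewrite expf_neq0// gt_eqF.
apply: cont_atX; apply: cont_atD; first exact: cont_at_cst.
exact: cont_atX.
Qed.

End chi_theory.

(* The angle from [(e1, e2)] to [(p, q)], by the half-angle formula: it takes values in [-pi, pi] and is
   smooth away from the half-line opposite to [(e1, e2)]. *)
Definition ang (e1 e2 p q : R) : R :=
  2 * atan ((q * e1 - p * e2) / (Num.sqrt (p ^+ 2 + q ^+ 2) + (p * e1 + q * e2))).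

Lemma ang_le e1 e2 p q : `|ang e1 e2 p q| <= pi.
Proof.
rewrite /ang normrM ger0_norm// mulrC -ler_pdivlMr// ler_norml.
by apply/andP; split; apply: ltW; [exact: atan_gtNpi2|exact: atan_ltpi2].
Qed.

(** The derivative of the argument does not depend on the reference direction, which only decides
    where the branch is cut. The last hypothesis says that the point is off the cut. *)
Lemma has_der_ang e1 e2 (p q : R -> R) (t dp dq : R) : e1 ^+ 2 + e2 ^+ 2 = 1 ->
  has_der p t dp -> has_der q t dq -> 0 < p t ^+ 2 + q t ^+ 2 ->
  0 < Num.sqrt (p t ^+ 2 + q t ^+ 2) + (p t * e1 + q t * e2) ->
  has_der (fun t => ang e1 e2 (p t) (q t)) t ((p t * dq - q t * dp) / (p t ^+ 2 + q t ^+ 2)).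
Proof.
move=> he hp hq s0 ra0.
set P := p t; set Q := q t.
pose s t := p t ^+ 2 + q t ^+ 2.
have hs : has_der s t (2 * P * dp + 2 * Q * dq).
  by apply: has_der_eq (has_derD (has_derX 2 hp) (has_derX 2 hq)) _; rewrite !expr1.
set r := Num.sqrt (P ^+ 2 + Q ^+ 2) in ra0 *.
have r0 : 0 < r by rewrite sqrtr_gt0.
have r2 : r ^+ 2 = P ^+ 2 + Q ^+ 2 by rewrite sqr_sqrtr// ltW.
have hr : has_der (fun t => Num.sqrt (s t)) t ((P * dp + Q * dq) / r).
  apply: (@has_der_eq _ (fun t => Num.sqrt (s t)) _ _ _
    (@has_der_comp _ Num.sqrt s t _ _ (is_derive1_sqrt s0) hs)).
  rewrite -/P -/Q -/r; field; exact: lt0r_neq0.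
have ha := has_derD (has_derM hp (has_der_cst e1 t)) (has_derM hq (has_der_cst e2 t)).
have hb := has_derB (has_derM hq (has_der_cst e1 t)) (has_derM hp (has_der_cst e2 t)).
have hden := has_derD hr ha.
have ra : r + (P * e1 + Q * e2) != 0 by exact: lt0r_neq0.
have hT := has_derM hb (@has_derV _ (fun t => Num.sqrt (s t) + (p t * e1 + q t * e2)) t _ ra hden).
have hA := @has_der_comp _ (@atan R) _ t _ _ (is_derive1_atan _) hT.
apply: (@has_der_eq _ (fun t => ang e1 e2 (p t) (q t)) _ _ _ (has_derZ 2 hA)).
rewrite /s -/P -/Q -/r !mulr0 !addr0.
(* Coordinates of the vector in the orthonormal frame given by [(e1, e2)] and its rotation; the
   half-angle tangent is [b / (r + a)]. *)
set a := P * e1 + Q * e2 in ra *; set b := Q * e1 - P * e2.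
have r2ab : r ^+ 2 = a ^+ 2 + b ^+ 2.
  rewrite r2 /a /b; have -> : P ^+ 2 + Q ^+ 2 = (P ^+ 2 + Q ^+ 2) * (e1 ^+ 2 + e2 ^+ 2) by rewrite he mulr1.
  by ring.
(* The identity [1 + tan^2 = 1 / cos^2] at the half angle. *)
have den : 1 + (b / (r + a)) ^+ 2 = 2 * r / (r + a).
  have -> : 1 + (b / (r + a)) ^+ 2 = (r ^+ 2 + 2 * r * a + (a ^+ 2 + b ^+ 2)) / (r + a) ^+ 2 by field.
  by rewrite -r2ab; field.
rewrite den -r2.
have -> : P * dq - Q * dp = a * (dq * e1 - dp * e2) - b * (dp * e1 + dq * e2).
  rewrite /a /b; have -> : P * dq - Q * dp = (P * dq - Q * dp) * (e1 ^+ 2 + e2 ^+ 2) by rewrite he mulr1.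
  by ring.
have PQ : P * dp + Q * dq = a * (dp * e1 + dq * e2) + b * (dq * e1 - dp * e2).
  rewrite /a /b; have -> : P * dp + Q * dq = (P * dp + Q * dq) * (e1 ^+ 2 + e2 ^+ 2) by rewrite he mulr1.
  by ring.
rewrite PQ; set da := dp * e1 + dq * e2; set db := dq * e1 - dp * e2.
have rn0 : r != 0 by exact: lt0r_neq0.
have b2 : b ^+ 2 = r ^+ 2 - a ^+ 2 by rewrite r2ab; ring.
transitivity ((db * (r + a) * r - b * (a * da + b * db) - b * r * da) / (r ^+ 2 * (r + a))).
  by field; rewrite rn0 ra.
have -> : db * (r + a) * r - b * (a * da + b * db) - b * r * da =
   db * (r + a) * r - b * a * da - b ^+ 2 * db - b * r * da by ring.
rewrite b2; by field; rewrite rn0 ra.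
Qed.

End angle.

Section angle_cutoff.
Variables (R : realType) (E e1 e2 : R).
Hypotheses (E0 : 0 < E) (he : e1 ^+ 2 + e2 ^+ 2 = 1).
Local Notation sq p q := (p ^+ 2 + q ^+ 2).

(** Required only from level [E] on, since the truncation kills the angle below it: near zeros of
    [v] its mollification may well cross the slit. *)
Definition off_slit (p q : R) : Prop := E <= sq p q -> 0 < Num.sqrt (sq p q) + (p * e1 + q * e2).

Definition cang (p q : R) : R := chi E (sq p q) * ang e1 e2 p q.

Definition dcang (p q dp dq : R) : R :=
  dchi E (sq p q) * (2 * (p * dp + q * dq)) * ang e1 e2 p q +
  chi E (sq p q) * ((p * dq - q * dp) / sq p q).

Let cont_sq (T : topologicalType) (p q : T -> R) x : cont_at p x -> cont_at q x ->
  cont_at (fun y => sq (p y) (q y)) x.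
Proof. by move=> cp cq; apply: cont_atD; exact: cont_atX. Qed.

Let cont_ang (T : topologicalType) (p q : T -> R) x : cont_at p x -> cont_at q x ->
  0 < Num.sqrt (sq (p x) (q x)) + (p x * e1 + q x * e2) ->
  cont_at (fun y => ang e1 e2 (p y) (q y)) x.
Proof.
move=> cp cq ra; apply: cont_atM; first exact: cont_at_cst.
apply: (@cont_at_comp1 _ _ (fun y => (q y * e1 - p y * e2) / (Num.sqrt (sq (p y) (q y)) + (p y * e1 + q y * e2))) (@atan R)); last exact: continuous_atan.
have lin (u : T -> R) (c : R) : cont_at u x -> cont_at (fun y => u y * c) x.
  by move=> cu; apply: cont_atM => //; exact: cont_at_cst.
apply: cont_atM; first by apply: cont_atB; exact: lin.
apply: cont_atV; first exact: lt0r_neq0.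
apply: cont_atD; last by apply: cont_atD; exact: lin.
apply: (@cont_at_comp1 _ _ (fun y => sq (p y) (q y)) Num.sqrt); first exact: cont_sq.
exact: sqrt_continuous.
Qed.

Let small_near (T : topologicalType) (p q : T -> R) x : cont_at p x -> cont_at q x ->
  sq (p x) (q x) < E -> \near x, sq (p x) (q x) <= E.
Proof.
move=> cp cq sE; have /cvgr_lt := cont_sq cp cq => /(_ _ sE).
by apply: filterS => y /ltW.
Qed.

Lemma cont_at_cang (T : topologicalType) (p q : T -> R) x : cont_at p x -> cont_at q x ->
  off_slit (p x) (q x) -> cont_at (fun y => cang (p y) (q y)) x.
Proof.
move=> cp cq os; have [Es|sE] := leP E (sq (p x) (q x)).
  apply: cont_atM; last by apply: cont_ang => //; exact: os.
  by apply: (@cont_at_comp1 _ _ (fun y => sq (p y) (q y)) (chi E)); [exact: cont_sq|exact: cont_at_chi].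
apply: (@cont_at_near _ _ (fun=> 0)); last exact: cont_at_cst.
by apply: filterS (small_near cp cq sE) => y h; rewrite /cang chi_eq0// mul0r.
Qed.

Lemma cont_at_dcang (T : topologicalType) (p q dp dq : T -> R) x : cont_at p x -> cont_at q x ->
  cont_at dp x -> cont_at dq x ->
  off_slit (p x) (q x) -> cont_at (fun y => dcang (p y) (q y) (dp y) (dq y)) x.
Proof.
move=> cp cq cdp cdq os; have [Es|sE] := leP E (sq (p x) (q x)).
  have s0 : 0 < sq (p x) (q x) by exact: lt_le_trans Es.
  apply: cont_atD.
    apply: cont_atM; last by apply: cont_ang => //; exact: os.
    apply: cont_atM.
      by apply: (@cont_at_comp1 _ _ (fun y => sq (p y) (q y)) (dchi E)); [exact: cont_sq|exact: cont_at_dchi].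
    by apply: cont_atM; [exact: cont_at_cst|apply: cont_atD; exact: cont_atM].
  apply: cont_atM.
    by apply: (@cont_at_comp1 _ _ (fun y => sq (p y) (q y)) (chi E)); [exact: cont_sq|exact: cont_at_chi].
  apply: cont_atM; first by apply: cont_atB; exact: cont_atM.
  by apply: cont_atV; [exact: lt0r_neq0|exact: cont_sq].
apply: (@cont_at_near _ _ (fun=> 0)); last exact: cont_at_cst.
by apply: filterS (small_near cp cq sE) => y h; rewrite /dcang chi_eq0// dchi_eq0// !mul0r addr0.
Qed.

Lemma has_der_cang (p q : R -> R) (t dp dq : R) : has_der p t dp -> has_der q t dq ->
  off_slit (p t) (q t) -> has_der (fun t => cang (p t) (q t)) t (dcang (p t) (q t) dp dq).
Proof.
move=> hp hq os; have [Es|sE] := leP E (sq (p t) (q t)).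
  have s0 : 0 < sq (p t) (q t) by exact: lt_le_trans Es.
  have hs : has_der (fun t => sq (p t) (q t)) t (2 * (p t * dp + q t * dq)).
    apply: (@has_der_eq _ (fun t => sq (p t) (q t)) _ _ _ (has_derD (has_derX 2 hp) (has_derX 2 hq))).
    by rewrite !expr1; ring.
  have hc := @has_der_comp _ (chi E) (fun t => sq (p t) (q t)) t _ _ (has_der_chi E0 _) hs.
  exact: (has_derM hc (has_der_ang he hp hq s0 (os Es))).
rewrite /dcang chi_eq0 ?(ltW sE)// dchi_eq0 ?(ltW sE)// !mul0r addr0.
apply: (@has_der_near _ (fun=> 0)); last exact: has_der_cst.
have := small_near (has_der_cont hp) (has_der_cont hq) sE.
by apply: filterS => y h; rewrite /cang chi_eq0// mul0r.
Qed.

Lemma cang_le p q : `|cang p q| <= pi.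
Proof.
rewrite normrM ger0_norm ?chi_ge0//.
apply: (@le_trans _ _ (1 * `|ang e1 e2 p q|)); first by rewrite ler_wpM2r// chi_le1.
by rewrite mul1r ang_le.
Qed.

Let young (a b w : R) : 0 < w -> a * b <= a ^+ 2 / (2 * w) + w / 2 * b ^+ 2.
Proof.
move=> w0; have w1 : w != 0 by exact: lt0r_neq0.
have -> : a ^+ 2 / (2 * w) + w / 2 * b ^+ 2 = (a - w * b) ^+ 2 / (2 * w) + a * b by field.
by rewrite lerDr divr_ge0 ?sqr_ge0// mulr_ge0// ltW.
Qed.

(** The radial part [S] and angular part [J] of the velocity satisfy [S^2 + J^2 = s * D]. The
    constant collects [2 * 4 * 9 * pi^2] from the radial term, as [s * dchi E s <= 3], and 2 from
    the angular one. The factor [1 / E] is harmless because the bound is used with a weight chosen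
    after [E]. *)
Lemma dcang_sq_le p q dp dq : dcang p q dp dq ^+ 2 <= (72 * pi ^+ 2 + 2) / E * (dp ^+ 2 + dq ^+ 2).
Proof.
rewrite /dcang; set s := sq p q; set th := ang e1 e2 p q.
have [sE|Es] := leP s E.
  rewrite chi_eq0// dchi_eq0// !mul0r addr0 expr0n/=.
  by rewrite mulr_ge0// ?addr_ge0 ?sqr_ge0// divr_ge0 ?(ltW E0)// addr_ge0// mulr_ge0// sqr_ge0.
have s0 : 0 < s by exact: lt_trans Es.
have s1 : s != 0 by exact: lt0r_neq0.
set c := chi E s; set c' := dchi E s; set S := p * dp + q * dq; set J := p * dq - q * dp.
set D := dp ^+ 2 + dq ^+ 2.
have SJ : S ^+ 2 + J ^+ 2 = s * D by rewrite /S /J /s /D; ring.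
have D0 : 0 <= D by rewrite addr_ge0 ?sqr_ge0.
have th2 : th ^+ 2 <= pi ^+ 2.
  have := ang_le e1 e2 p q; rewrite -/th => h.
  by rewrite -[th ^+ 2]ger0_norm ?sqr_ge0// normrX ler_sqr ?nnegrE ?pi_ge0.
have W2 : (s * c') ^+ 2 <= 9.
  have := sdchi_le3 E0 s; have := sdchi_ge0 E (ltW s0); rewrite -/c' => w0 w3.
  have -> : (9 : R) = 3 ^+ 2 by rewrite expr2; ring.
  by rewrite ler_sqr ?nnegrE.
have c1 : c ^+ 2 <= 1 by rewrite expr_le1 ?chi_ge0 ?chi_le1.
have iE : s^-1 <= E^-1 by rewrite lef_pV2 ?posrE// ltW.
have A : (c' * (2 * S) * th) ^+ 2 <= 36 * pi ^+ 2 / E * D.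
  have -> : (c' * (2 * S) * th) ^+ 2 = 4 * ((s * c') ^+ 2 * th ^+ 2) * (S ^+ 2 / s) * s^-1 by field.
  have h1 : S ^+ 2 / s <= D by rewrite ler_pdivrMr// mulrC -SJ lerDl sqr_ge0.
  have h2 : (s * c') ^+ 2 * th ^+ 2 <= 9 * pi ^+ 2 by apply: ler_pM; rewrite ?sqr_ge0.
  have -> : 36 * pi ^+ 2 / E * D = 4 * (9 * pi ^+ 2) * D * E^-1 by ring.
  apply: ler_pM => //.
  - by rewrite mulr_ge0 ?divr_ge0 ?sqr_ge0 ?(ltW s0)// mulr_ge0// mulr_ge0// sqr_ge0.
  - by rewrite invr_ge0 ltW.
  apply: ler_pM => //.
  - by rewrite mulr_ge0// mulr_ge0// sqr_ge0.
  - by rewrite divr_ge0 ?sqr_ge0// ltW.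
  by rewrite ler_wpM2l.
have B : (c * (J / s)) ^+ 2 <= E^-1 * D.
  have -> : (c * (J / s)) ^+ 2 = c ^+ 2 * (J ^+ 2 / s) * s^-1 by field.
  have h1 : J ^+ 2 / s <= D by rewrite ler_pdivrMr// mulrC -SJ lerDr sqr_ge0.
  rewrite [E^-1 * D]mulrC -[D]mul1r; apply: ler_pM => //.
  - by rewrite mulr_ge0 ?sqr_ge0// divr_ge0 ?sqr_ge0// ltW.
  - by rewrite invr_ge0 ltW.
  by apply: ler_pM; rewrite ?sqr_ge0// divr_ge0 ?sqr_ge0// ltW.
set a := c' * (2 * S) * th in A *; set b := c * (J / s) in B *.
have -> : (72 * pi ^+ 2 + 2) / E * D = 2 * (36 * pi ^+ 2 / E * D) + 2 * (E^-1 * D) by ring.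
have := sqr_ge0 (a - b); rewrite sqrrB sqrrD; lra.
Qed.

(* The main term of [J = p grad q - q grad p] against the gradient of [cang p q * h^2] is [chi |J|^2 h^2 / s];
   the terms carrying [dchi] and the gradient of [h] are absorbed by Cauchy-Schwarz. *)
Lemma energy_pointwise1 (p q p1 p2 q1 q2 h h1 h2 : R) : off_slit p q ->
  let s := sq p q in let J1 := p * q1 - q * p1 in let J2 := p * q2 - q * p2 in
  let f := cang p q in
  2^-1 * (chi E s * (J1 ^+ 2 + J2 ^+ 2) / s * h ^+ 2) <=
    J1 * (dcang p q p1 q1 * h ^+ 2 + 2 * f * h * h1) +
    J2 * (dcang p q p2 q2 * h ^+ 2 + 2 * f * h * h2) +
    pi * (s * dchi E s) * (p1 ^+ 2 + p2 ^+ 2 + q1 ^+ 2 + q2 ^+ 2) * h ^+ 2 +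
    2 * pi ^+ 2 * s * (h1 ^+ 2 + h2 ^+ 2).
Proof.
move=> os; cbv zeta; rewrite /dcang /cang.
set s := sq p q; set J1 := p * q1 - q * p1; set J2 := p * q2 - q * p2.
set th := ang e1 e2 p q; set c := chi E s; set c' := dchi E s.
set S1 := p * p1 + q * q1; set S2 := p * p2 + q * q2.
have s0 : 0 <= s by rewrite addr_ge0 ?sqr_ge0.
have c0 : 0 <= c by exact: chi_ge0.
have c1 : c <= 1 by exact: chi_le1.
have W0 : 0 <= s * c' by exact: sdchi_ge0.
have c'0 : 0 <= c' by exact: dchi_ge0.
have th1 : `|th| <= pi by exact: ang_le.
have th2 : th ^+ 2 <= pi ^+ 2.
  by rewrite -[th ^+ 2]ger0_norm ?sqr_ge0// normrX ler_sqr ?nnegrE ?pi_ge0.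
set k1 := J1 / s; set k2 := J2 / s.
(* At [s = 0] the quotient [k1] has its default value 0, and the identity survives because [chi]
   vanishes there. *)
have Jk1 : c * J1 = c * (s * k1).
  have [s00|s00] := eqVneq s 0; last by rewrite /k1; field.
  by rewrite /c chi_eq0 ?mul0r// s00 ltW.
have Jk2 : c * J2 = c * (s * k2).
  have [s00|s00] := eqVneq s 0; last by rewrite /k2; field.
  by rewrite /c chi_eq0 ?mul0r// s00 ltW.
(* Twice the product of the angular and radial parts is at most the sum of their squares, which is
   [s * d]; this is where the weight [s * dchi E s] appears. *)
have cross (J S d : R) : J ^+ 2 + S ^+ 2 = s * d -> - (pi * (s * c') * d) <= J * (c' * (2 * S) * th).
  move=> JS; have h3 : `|J * (c' * (2 * S) * th)| <= pi * (s * c') * d.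
    have -> : J * (c' * (2 * S) * th) = (c' * th) * (2 * (J * S)) by ring.
    have -> : pi * (s * c') * d = (c' * pi) * (J ^+ 2 + S ^+ 2) by rewrite JS; ring.
    rewrite normrM; apply: ler_pM => //.
      by rewrite normrM ger0_norm// ler_wpM2l.
    rewrite ler_norml; apply/andP; split.
      by have := sqr_ge0 (J + S); rewrite sqrrD; lra.
    by have := sqr_ge0 (J - S); rewrite sqrrB; lra.
  by move: h3; rewrite ler_norml => /andP[].
have X1 := cross J1 S1 (p1 ^+ 2 + q1 ^+ 2).
have X2 := cross J2 S2 (p2 ^+ 2 + q2 ^+ 2).
have {}X1 : - (pi * (s * c') * (p1 ^+ 2 + q1 ^+ 2)) <= J1 * (c' * (2 * S1) * th).
  by apply: X1; rewrite /J1 /S1 /s; ring.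
have {}X2 : - (pi * (s * c') * (p2 ^+ 2 + q2 ^+ 2)) <= J2 * (c' * (2 * S2) * th).
  by apply: X2; rewrite /J2 /S2 /s; ring.
have hh : 0 <= h ^+ 2 by exact: sqr_ge0.
have {}X1 := ler_wpM2r hh X1; have {}X2 := ler_wpM2r hh X2.
have Y (k g : R) : - (c * s * (h ^+ 2 * k ^+ 2) / 2 + 2 * pi ^+ 2 * s * g ^+ 2) <=
    c * s * (2 * k * th * h * g).
  have y1 : - (h ^+ 2 * k ^+ 2 / 2 + 2 * th ^+ 2 * g ^+ 2) <= 2 * k * th * h * g.
    have : 0 <= (h * k + 2 * th * g) ^+ 2 by exact: sqr_ge0.
    rewrite (_ : (h * k + 2 * th * g) ^+ 2 = 2 * (h ^+ 2 * k ^+ 2 / 2 + 2 * th ^+ 2 * g ^+ 2 + 2 * k * th * h * g)); last by field.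
    by lra.
  have {}y1 := ler_wpM2l (mulr_ge0 c0 s0) y1.
  apply: le_trans y1.
  have : c * s * (2 * th ^+ 2 * g ^+ 2) <= 2 * pi ^+ 2 * s * g ^+ 2.
    have -> : c * s * (2 * th ^+ 2 * g ^+ 2) = (c * th ^+ 2) * (2 * s * g ^+ 2) by ring.
    have -> : 2 * pi ^+ 2 * s * g ^+ 2 = (1 * pi ^+ 2) * (2 * s * g ^+ 2) by ring.
    apply: ler_wpM2r; first by rewrite mulr_ge0 ?sqr_ge0// mulr_ge0.
    by apply: ler_pM => //; exact: sqr_ge0.
  lra.
have Y1 := Y k1 h1; have Y2 := Y k2 h2.
have -> : 2^-1 * (c * (J1 ^+ 2 + J2 ^+ 2) / s * h ^+ 2) =
   2^-1 * (c * s * (h ^+ 2 * k1 ^+ 2)) + 2^-1 * (c * s * (h ^+ 2 * k2 ^+ 2)).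
  have -> : c * (J1 ^+ 2 + J2 ^+ 2) / s * h ^+ 2 = (c * J1) * (J1 / s) * h ^+ 2 + (c * J2) * (J2 / s) * h ^+ 2 by ring.
  by rewrite Jk1 Jk2 -/k1 -/k2; ring.
have -> : J1 * ((c' * (2 * S1) * th + c * (J1 / s)) * h ^+ 2 + 2 * (c * th) * h * h1) =
  J1 * (c' * (2 * S1) * th) * h ^+ 2 + (c * J1) * (J1 / s * h ^+ 2) + (c * J1) * (2 * th * h * h1) by ring.
have -> : J2 * ((c' * (2 * S2) * th + c * (J2 / s)) * h ^+ 2 + 2 * (c * th) * h * h2) =
  J2 * (c' * (2 * S2) * th) * h ^+ 2 + (c * J2) * (J2 / s * h ^+ 2) + (c * J2) * (2 * th * h * h2) by ring.
rewrite Jk1 Jk2 -/k1 -/k2.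
have Z1 : c * (s * k1) * (2 * th * h * h1) = c * s * (2 * k1 * th * h * h1) by ring.
have Z2 : c * (s * k2) * (2 * th * h * h2) = c * s * (2 * k2 * th * h * h2) by ring.
rewrite Z1 Z2.
have -> : c * (s * k1) * (k1 * h ^+ 2) = c * s * (h ^+ 2 * k1 ^+ 2) by ring.
have -> : c * (s * k2) * (k2 * h ^+ 2) = c * s * (h ^+ 2 * k2 ^+ 2) by ring.
have -> : pi * (s * c') * (p1 ^+ 2 + p2 ^+ 2 + q1 ^+ 2 + q2 ^+ 2) * h ^+ 2 =
  pi * (s * c') * (p1 ^+ 2 + q1 ^+ 2) * h ^+ 2 + pi * (s * c') * (p2 ^+ 2 + q2 ^+ 2) * h ^+ 2 by ring.
have -> : 2 * pi ^+ 2 * s * (h1 ^+ 2 + h2 ^+ 2) = 2 * pi ^+ 2 * s * h1 ^+ 2 + 2 * pi ^+ 2 * s * h2 ^+ 2 by ring.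
rewrite !mulNr in X1 X2.
lra.
Qed.

(** Replaces the field [J] of the mollified velocity by a nearby field [K], intended to be the
    divergence-free mollification. The difference is paired with the test gradient by Young's
    inequality with weight [w], and the hypothesis bounding it has the form supplied by
    [commutator_le]. *)
Lemma energy_pointwise (p q p1 p2 q1 q2 h h1 h2 K1 K2 w L : R) : off_slit p q ->
  0 < w -> `|h| <= 1 -> p1 ^+ 2 + p2 ^+ 2 + q1 ^+ 2 + q2 ^+ 2 <= L ->
  let s := sq p q in let J1 := p * q1 - q * p1 in let J2 := p * q2 - q * p2 in
  let f := cang p q in
  (J1 - K1) ^+ 2 + (J2 - K2) ^+ 2 <= 2 * w ^+ 2 * L ->
  2^-1 * (chi E s * (J1 ^+ 2 + J2 ^+ 2) / s * h ^+ 2) <=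
    K1 * (dcang p q p1 q1 * h ^+ 2 + 2 * f * h * h1) +
    K2 * (dcang p q p2 q2 * h ^+ 2 + 2 * f * h * h2) +
    w * (1 + (72 * pi ^+ 2 + 2) / E) * L + 4 * pi ^+ 2 * w * (h1 ^+ 2 + h2 ^+ 2) +
    pi * (s * dchi E s) * L + 2 * pi ^+ 2 * s * (h1 ^+ 2 + h2 ^+ 2).
Proof.
move=> os w0 hle DL; cbv zeta.
have := energy_pointwise1 p1 p2 q1 q2 h h1 h2 os; cbv zeta.
set s := sq p q; set J1 := p * q1 - q * p1; set J2 := p * q2 - q * p2; set f := cang p q.
set D := p1 ^+ 2 + p2 ^+ 2 + q1 ^+ 2 + q2 ^+ 2.
set F1 := dcang p q p1 q1 * h ^+ 2 + 2 * f * h * h1.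
set F2 := dcang p q p2 q2 * h ^+ 2 + 2 * f * h * h2.
move=> base JK.
have h2le : h ^+ 2 <= 1.
  by rewrite -[h ^+ 2]ger0_norm ?sqr_ge0// normrX expr_le1.
have W0 : 0 <= pi * (s * dchi E s).
  by rewrite mulr_ge0 ?pi_ge0// sdchi_ge0// addr_ge0 ?sqr_ge0.
have D0 : 0 <= D by rewrite /D !addr_ge0 ?sqr_ge0.
have a1 : pi * (s * dchi E s) * D * h ^+ 2 <= pi * (s * dchi E s) * L.
  rewrite -mulrA; apply: ler_wpM2l => //; apply: le_trans DL.
  by rewrite ler_piMr.
set CE := (72 * pi ^+ 2 + 2) / E.
have Fsq (dp dq g : R) : (dcang p q dp dq * h ^+ 2 + 2 * f * h * g) ^+ 2 <=
    2 * (CE * (dp ^+ 2 + dq ^+ 2)) + 8 * pi ^+ 2 * g ^+ 2.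
  have b1 := dcang_sq_le p q dp dq; rewrite -/CE in b1.
  set x := dcang p q dp dq in b1 *.
  have b2 : (x * h ^+ 2) ^+ 2 <= x ^+ 2.
    rewrite exprMn ler_piMr ?sqr_ge0// expr_le1 ?sqr_ge0//.
  have b3 : (f * h) ^+ 2 <= pi ^+ 2.
    rewrite -[(f * h) ^+ 2]ger0_norm ?sqr_ge0// normrX ler_sqr ?nnegrE ?pi_ge0//.
    rewrite normrM; apply: (@le_trans _ _ (pi * 1)); last by rewrite mulr1.
    by apply: ler_pM => //; exact: cang_le.
  have b4 : (f * h) ^+ 2 * g ^+ 2 <= pi ^+ 2 * g ^+ 2 by rewrite ler_wpM2r ?sqr_ge0.
  have -> : x * h ^+ 2 + 2 * f * h * g = x * h ^+ 2 + 2 * ((f * h) * g) by ring.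
  have := sqr_ge0 (x * h ^+ 2 - 2 * ((f * h) * g)); rewrite sqrrB sqrrD.
  have -> : (2 * (f * h * g)) ^+ 2 = 4 * ((f * h) ^+ 2 * g ^+ 2) by ring.
  lra.
have Y1 := young (J1 - K1) F1 w0; have Y2 := young (J2 - K2) F2 w0.
have JKw : (J1 - K1) ^+ 2 / (2 * w) + (J2 - K2) ^+ 2 / (2 * w) <= w * L.
  rewrite -mulrDl ler_pdivrMr ?mulr_gt0//; apply: le_trans JK _.
  by have -> : w * L * (2 * w) = 2 * w ^+ 2 * L by ring.
have CE0 : 0 <= CE by rewrite divr_ge0 ?(ltW E0)// addr_ge0// mulr_ge0// sqr_ge0.
have FF : F1 ^+ 2 + F2 ^+ 2 <= 2 * (CE * L) + 8 * pi ^+ 2 * (h1 ^+ 2 + h2 ^+ 2).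
  have f1 := Fsq p1 q1 h1; have f2 := Fsq p2 q2 h2; rewrite -/F1 in f1; rewrite -/F2 in f2.
  have := ler_wpM2l CE0 DL; rewrite /D; lra.
have w20 : 0 <= w / 2 by rewrite divr_ge0// ltW.
have FFw := ler_wpM2l w20 FF.
have e1' : w / 2 * (F1 ^+ 2 + F2 ^+ 2) = w / 2 * F1 ^+ 2 + w / 2 * F2 ^+ 2 by ring.
have e2' : w / 2 * (2 * (CE * L) + 8 * pi ^+ 2 * (h1 ^+ 2 + h2 ^+ 2)) =
  w * CE * L + 4 * pi ^+ 2 * w * (h1 ^+ 2 + h2 ^+ 2) by field.
have e3' : w * (1 + CE) * L = w * L + w * CE * L by ring.
have e4' : J1 * F1 = K1 * F1 + (J1 - K1) * F1 by ring.
have e5' : J2 * F2 = K2 * F2 + (J2 - K2) * F2 by ring.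
rewrite e3'; rewrite e4' e5' in base; rewrite e1' e2' in FFw.
apply: le_trans base _; lra.
Qed.

End angle_cutoff.

(** * Logarithmic cutoffs *)

Section cutoff.
Variable R : realType.
Local Notation R2 := (measurableTypeR R * measurableTypeR R)%type.
Local Notation mu := (@plane R).
Implicit Types (t : R) (x z : R * R).

Let upper t : R := pospart (4 - t ^+ 2) ^+ 2.
Let lower t : R := pospart (t ^+ 2 - 1) ^+ 2.
Let dupper t : R := 2 * pospart (4 - t ^+ 2) * (- (2 * t)).
Let dlower t : R := 2 * pospart (t ^+ 2 - 1) * (2 * t).

(** A step that is 1 for [|t| <= 1] and 0 for [|t| >= 2]. [upper] is positive for [|t| < 2] and
    [lower] for [|t| > 1], so the denominator never vanishes; squares of positive parts make it of
    class [C^1], as a single integration by parts requires. *)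
Definition cut t : R := upper t / (upper t + lower t).
Definition dcut t : R := (dupper t * lower t - upper t * dlower t) / (upper t + lower t) ^+ 2.

Let den_gt0 t : 0 < upper t + lower t.
Proof.
have u0 : 0 <= upper t by exact: sqr_ge0.
have l0 : 0 <= lower t by exact: sqr_ge0.
have [h|h] := ltP (t ^+ 2) 4.
  by rewrite ltr_pwDl// exprn_gt0// /pospart lt_max subr_gt0 h orbT.
by rewrite ltr_wpDl// exprn_gt0// /pospart lt_max; apply/orP; right; lra.
Qed.

Let has_der_sq t : has_der (fun t : R => t ^+ 2) t (2 * t).
Proof. by apply: has_der_eq (has_derX 2 (has_der_id t)) _; rewrite mulr1 expr1. Qed.

Lemma has_der_cut t : has_der cut t (dcut t).
Proof.
have hu : has_der upper t (dupper t).
  have h := has_derB (has_der_cst 4 t) (has_der_sq t).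
  apply: (@has_der_eq _ upper _ _ _ (@has_der_comp _ (fun t => pospart t ^+ 2) _ t _ _ (has_der_pospart2 _) h)).
  by rewrite sub0r.
have hl : has_der lower t (dlower t).
  have h := has_derB (has_der_sq t) (has_der_cst 1 t).
  apply: (@has_der_eq _ lower _ _ _ (@has_der_comp _ (fun t => pospart t ^+ 2) _ t _ _ (has_der_pospart2 _) h)).
  by rewrite subr0.
have d0 : upper t + lower t != 0 by exact: lt0r_neq0.
apply: (@has_der_eq _ cut _ _ _ (has_derM hu (@has_derV _ (fun t => upper t + lower t) _ _ d0 (has_derD hu hl)))).
by rewrite /dcut; field.
Qed.

Let cont_sq t : cont_at (fun t : R => t ^+ 2) t.
Proof. exact: has_der_cont (has_der_sq t). Qed.

Lemma cont_at_dcut t : cont_at dcut t.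
Proof.
have c1 : cont_at (fun t => pospart (4 - t ^+ 2)) t.
  by apply: pospart_cont; apply: cont_atB; [exact: cont_at_cst|exact: cont_sq].
have c2 : cont_at (fun t => pospart (t ^+ 2 - 1)) t.
  by apply: pospart_cont; apply: cont_atB; [exact: cont_sq|exact: cont_at_cst].
have cu : cont_at upper t by exact: cont_atX.
have cl : cont_at lower t by exact: cont_atX.
have c2t : cont_at (fun t : R => 2 * t) t by apply: cont_atM; [exact: cont_at_cst|exact: cvg_id].
apply: cont_atM.
  apply: cont_atB; apply: cont_atM => //.
    apply: cont_atM; last exact: cont_atN.
    by apply: cont_atM => //; exact: cont_at_cst.
  by apply: cont_atM => //; apply: cont_atM => //; exact: cont_at_cst.
apply: cont_atV; first by rewrite expf_neq0//; exact: lt0r_neq0.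
by apply: cont_atX; exact: cont_atD.
Qed.

Lemma cut_ge0 t : 0 <= cut t.
Proof. by rewrite divr_ge0 ?sqr_ge0// ltW. Qed.

Lemma cut_le1 t : cut t <= 1.
Proof. by rewrite ler_pdivrMr// mul1r lerDl sqr_ge0. Qed.

Let lower0 t : `|t| <= 1 -> pospart (t ^+ 2 - 1) = 0.
Proof.
move=> t1; rewrite /pospart max_l// subr_le0 -[t ^+ 2]ger0_norm ?sqr_ge0// normrX.
by rewrite expr_le1.
Qed.

Let upper0 t : 2 <= `|t| -> pospart (4 - t ^+ 2) = 0.
Proof.
move=> t2; rewrite /pospart max_l// subr_le0 -[t ^+ 2]ger0_norm ?sqr_ge0// normrX.
have -> : (4 : R) = 2 ^+ 2 by rewrite expr2; ring.
by rewrite ler_sqr ?nnegrE.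
Qed.

Lemma cut_eq1 t : `|t| <= 1 -> cut t = 1.
Proof.
move=> t1; have := den_gt0 t; rewrite /cut /lower lower0// expr0n addr0 => h.
by rewrite divff// lt0r_neq0.
Qed.

Lemma cut_eq0 t : 2 <= `|t| -> cut t = 0.
Proof. by move=> t2; rewrite /cut /upper upper0// expr0n mul0r. Qed.

Lemma dcut_eq0 t : `|t| <= 1 \/ 2 <= `|t| -> dcut t = 0.
Proof.
move=> [h|h]; rewrite /dcut.
  by rewrite /lower /dlower lower0// expr0n /= !(mulr0, mul0r) subrr mul0r.
by rewrite /upper /dupper upper0// expr0n /= !(mulr0, mul0r) subrr mul0r.
Qed.

Lemma dcut_bounded : exists2 L, 0 < L & forall t, `|dcut t| <= L.
Proof.
have [|L L0 hL] := @compact_cont_bounded R R `[- (2 : R), 2]%classic dcut (@segment_compact R (- 2) 2).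
  by move=> t _; exact: cont_at_dcut.
exists L => // t; have [h|h] := leP `|t| 2; last by rewrite dcut_eq0 ?normr0 ?(ltW L0)//; right; exact: ltW.
by apply: hL; rewrite /= in_itv/= -ler_norml.
Qed.

Lemma sum_disjoint_sq (I : eqType) (r : seq I) (a : I -> R) : uniq r ->
  (forall i j, i != j -> a i * a j = 0) ->
  (\sum_(i <- r) a i) ^+ 2 = \sum_(i <- r) a i ^+ 2.
Proof.
move=> ur h; rewrite expr2 big_distrl/=; apply: eq_big_seq => i ir.
rewrite big_distrr/= (bigD1_seq i)//= big1 ?addr0 ?expr2// => j ji.
by rewrite h// eq_sym.
Qed.

Lemma Rintegral_cont_sum (M : R) (I : Type) (r : seq I) (f : I -> R * R -> R) :
  (forall i, continuous (f i)) ->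
  \int[mu]_(z in box M) (\sum_(i <- r) f i z) = \sum_(i <- r) \int[mu]_(z in box M) f i z.
Proof.
move=> cf; have mb : measurable (box M : set R2) by exact: measurable_box.
elim: r => [|i r ih].
  under eq_Rintegral do rewrite big_nil.
  by rewrite big_nil Rintegral_cst// mul0r.
under eq_Rintegral do rewrite big_cons.
rewrite big_cons -ih RintegralD//.
  exact: (cont_locint (cf i)).2.
have cs : continuous (fun z => \sum_(i <- r) f i z) by move=> z; apply: cont_at_sum => j; exact: cf.
exact: (cont_locint cs).2.
Qed.

Lemma harmonic_sum_unbounded (n : nat) (A : R) : exists2 m, (n <= m)%N &
  A <= \sum_(n <= j < m) (harmonic j : R).
Proof.
have nd : nondecreasing_seq (series (@harmonic R)).
  by apply: nondecreasing_series => k _ _; exact: harmonic_ge0.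
have [m _ hm] : exists2 m, (n <= m)%N & A + \sum_(0 <= j < n) (harmonic j : R) <= series (@harmonic R) m.
  have /cvgryPge := nondecreasing_dvgn_lt nd (@dvg_harmonic R).
  move=> /(_ (A + \sum_(0 <= j < n) (harmonic j : R))) [N _ hN].
  exists (maxn n N); first exact: leq_maxl.
  by apply: hN; exact: leq_maxr.
exists (maxn n m); first exact: leq_maxl.
have := le_trans hm (nd _ _ (leq_maxr n m)).
have e : \sum_(0 <= j < maxn n m) (harmonic j : R) =
    \sum_(0 <= j < n) harmonic j + \sum_(n <= j < maxn n m) harmonic j.
  by rewrite -big_cat_nat// leq_maxl.
rewrite /series /= e; lra.
Qed.

End cutoff.

Lemma cont_atW (R : realType) (T : topologicalType) (f : T -> R) :
  (forall x, cont_at f x) -> continuous f.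
Proof. by []. Qed.

Section log_cutoff.
Variable R : realType.
Local Notation R2 := (measurableTypeR R * measurableTypeR R)%type.
Local Notation mu := (@plane R).
Implicit Types (x z : R * R).
Local Notation rad j := (2 ^+ j.+1 : R).

(** At scale [j] the area is [16 * rad j ^ 2], the squared gradient at most [L^2 / rad j ^ 2], the
    density at most [C * (j + 1)] and the squared weight [1 / ((j + 1)^2 S^2)]. The scale cancels
    and [16 C L^2 / S^2] times [1 / (j + 1)] remains, whose sum brings back one factor [S]. *)
Lemma dyadic_sum_bound (C L M S : R) (n0 n m : nat) (s : R * R -> R) (t : nat -> R * R -> R) :
  (n0 <= n)%N -> 0 < S -> S = \sum_(n <= j < m) (harmonic j : R) ->
  continuous s -> (forall x, 0 <= s x) ->
  (forall j x, (n0 <= j)%N -> box (2 * rad j) x -> s x <= C * j.+1%:R) ->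
  (forall j, continuous (t j)) -> (forall j x, `|t j x| <= L / rad j) ->
  (forall j x, ~ box (2 * rad j) x -> t j x = 0) ->
  (forall i j x, i != j -> t i x * t j x = 0) ->
  (forall j, (j < m)%N -> 2 * rad j <= M) ->
  \int[mu]_(x in box M) (s x * (\sum_(n <= j < m) (harmonic j / S * t j x)) ^+ 2) <= 16 * C * L ^+ 2 / S.
Proof.
move=> n0n S0 SE cs s0 sC ct tL tbox tdis rM.
pose g j x := s x * (harmonic j / S * t j x) ^+ 2.
have cg j : continuous (g j).
  apply: cont_atW => x; apply: cont_atM; first exact: cs.
  by apply: cont_atX; apply: cont_atM; [exact: cont_at_cst|exact: ct].
have -> : \int[mu]_(x in box M) (s x * (\sum_(n <= j < m) (harmonic j / S * t j x)) ^+ 2) =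
    \sum_(n <= j < m) \int[mu]_(x in box M) g j x.
  rewrite -Rintegral_cont_sum//; apply: eq_Rintegral => x _.
  rewrite sum_disjoint_sq ?iota_uniq ?big_distrr// => i j ij.
  have -> : harmonic i / S * t i x * (harmonic j / S * t j x) =
    harmonic i / S * (harmonic j / S) * (t i x * t j x) by ring.
  by rewrite tdis// mulr0.
have term j : (n <= j < m)%N -> \int[mu]_(x in box M) g j x <= harmonic j * (16 * C * L ^+ 2 / S ^+ 2).
  move=> /andP[nj jm].
  have gbox z : ~ box (2 * rad j) z -> g j z = 0.
    by move=> nz; rewrite /g tbox// mulr0 expr0n mulr0.
  have -> : \int[mu]_(x in box M) g j x = \int[mu]_(x in box (2 * rad j)) g j x.
    rewrite -(integral_box_supp gbox) -(@integral_box_supp _ (g j) M)// => z nz.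
    by apply: gbox => bz; apply: nz; apply: box_sub bz; exact: rM.
  pose r := rad j; have r0 : 0 < r by rewrite exprn_gt0.
  pose K := C * j.+1%:R * ((harmonic j / S) ^+ 2 * (L ^+ 2 / r ^+ 2)).
  have mb : measurable (box (2 * r) : set R2) by exact: measurable_box.
  have cK : continuous (fun _ : R * R => K) by move=> z; exact: cvg_cst.
  apply: (@le_trans _ _ (\int[mu]_(x in box (2 * r)) K)).
    apply: le_Rintegral => //; [exact: (cont_locint (cg j)).2|exact: (cont_locint cK).2|].
    move=> x bx; rewrite /g /K exprMn.
    have hs : s x <= C * j.+1%:R by apply: sC => //; exact: leq_trans n0n nj.
    apply: ler_pM; [exact: s0|by rewrite mulr_ge0// sqr_ge0|exact: hs|].
    rewrite ler_wpM2l ?sqr_ge0//.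
    have := tL j x; have -> : L ^+ 2 / r ^+ 2 = (L / r) ^+ 2 by rewrite expr_div_n.
    move=> h; rewrite -[t j x ^+ 2]ger0_norm ?sqr_ge0// normrX.
    by rewrite ler_sqr ?nnegrE//; exact: le_trans h.
  rewrite Rintegral_cst// /box /plane.
  have r20 : - (2 * r) <= 2 * r by lra.
  rewrite lebesgue2_rect//=.
  have j0 : (j.+1%:R : R) != 0 by rewrite pnatr_eq0.
  have hj : harmonic j = (j.+1%:R)^-1 :> R by [].
  rewrite le_eqVlt; apply/orP; left; apply/eqP.
  have alg (a w : R) : a != 0 -> w != 0 ->
      C * w * ((w^-1 / S) ^+ 2 * (L ^+ 2 / a ^+ 2)) * ((2 * a - - (2 * a)) * (2 * a - - (2 * a))) =
      w^-1 * (16 * C * L ^+ 2 / S ^+ 2).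
    by move=> a0 w0; field; rewrite a0 w0 lt0r_neq0.
  by rewrite /K hj; apply: alg => //; exact: lt0r_neq0.
apply: (@le_trans _ _ (\sum_(n <= j < m) (harmonic j : R) * (16 * C * L ^+ 2 / S ^+ 2))).
  by rewrite big_nat_cond [leRHS]big_nat_cond; apply: ler_sum => j /andP[h _]; exact: term.
rewrite -big_distrl/= -SE le_eqVlt; apply/orP; left; apply/eqP; field.
exact: lt0r_neq0.
Qed.

(* [h] averages dyadic cutoffs at scales [2^j] with weights proportional to [1 / (j + 1)].  Their gradients
   have disjoint supports and each scale contributes [O(weight^2 * (j + 1))], which sums to the inverse of a
   partial sum of the harmonic series. *)
Lemma log_cutoff (C : R) (n0 : nat) (M0 kappa : R) : 0 < C -> 0 < kappa ->
  exists (M : R) (h h1 h2 : R * R -> R),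
  [/\ 0 < M /\ M0 <= M,
      [/\ continuous h, continuous h1 & continuous h2],
      (forall x, has_der (fun t => h (t, x.2)) x.1 (h1 x)) /\
      (forall x, has_der (fun t => h (x.1, t)) x.2 (h2 x)),
      [/\ forall x, 0 <= h x <= 1, forall x, box M0 x -> h x = 1 &
          forall x, M <= `|x.1| \/ M <= `|x.2| -> h x = 0] &
      forall s : R * R -> R, continuous s -> (forall x, 0 <= s x) ->
        (forall j x, (n0 <= j)%N -> box (2 * rad j) x -> s x <= C * j.+1%:R) ->
        \int[mu]_(x in box M) (s x * (h1 x ^+ 2 + h2 x ^+ 2)) <= kappa].
Proof.
move=> C0 k0; have [L L0 hL] := @dcut_bounded R.
(* Starting at a scale beyond [M0] makes every cutoff in the average equal to 1 on [box M0]. *)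
have [n n0n nM0] : exists2 n, (n0 <= n)%N & M0 <= rad n.
  exists (maxn n0 (Num.truncn `|M0|)); first exact: leq_maxl.
  apply: le_trans (ler_norm _) _; apply: ltW.
  apply: lt_le_trans (truncnS_gt _) _.
  rewrite -natrX ler_nat; apply: leq_trans (ltn_expl _ (ltnSn 1)) _.
  by rewrite leq_pexp2l// leqW// leq_maxr.
have [m nm hm] := @harmonic_sum_unbounded R n (Num.max 1 (32 * C * L ^+ 2 / kappa)).
set S := \sum_(n <= j < m) (harmonic j : R) in hm.
have [S1 S2] : 1 <= S /\ 32 * C * L ^+ 2 / kappa <= S by move: hm; rewrite ge_max => /andP[].
have S0 : 0 < S by exact: lt_le_trans S1.
(* The largest scale used is [m - 1], whose cutoff vanishes beyond [2 * rad (m - 1) = rad m]. *)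
pose M := rad m.
have rad0 j : 0 < rad j by rewrite exprn_gt0.
have radM j : (j < m)%N -> 2 * rad j <= M.
  by move=> jm; rewrite -exprS; apply: ler_weXn2l => //; rewrite ler1n.
pose c j : R := harmonic j / S.
have c0 j : 0 <= c j by rewrite divr_ge0 ?(ltW S0)// ltW// harmonic_gt0.
pose b j x := cut (x.1 / rad j) * cut (x.2 / rad j).
pose t1 j x := dcut (x.1 / rad j) / rad j * cut (x.2 / rad j).
pose t2 j x := cut (x.1 / rad j) * (dcut (x.2 / rad j) / rad j).
have hc j u : has_der (fun u => cut (u / rad j)) u (dcut (u / rad j) / rad j).
  have hd : has_der (fun u => u / rad j) u (rad j)^-1.
    by apply: has_der_eq (has_derM (has_der_id u) (has_der_cst (rad j)^-1 u)) _; rewrite mul1r mulr0 addr0.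
  exact: (@has_der_comp _ (@cut R) _ _ _ _ (has_der_cut _) hd).
have cc1 (F : R -> R) j x : (forall u, cont_at F u) -> cont_at (fun x : R * R => F (x.1 / rad j)) x.
  move=> cF; apply: (@cont_at_comp1 _ _ (fun x : R * R => x.1 / rad j) F); last exact: cF.
  by apply: cont_atM; [exact: cont_at_fst|exact: cont_at_cst].
have cc2 (F : R -> R) j x : (forall u, cont_at F u) -> cont_at (fun x : R * R => F (x.2 / rad j)) x.
  move=> cF; apply: (@cont_at_comp1 _ _ (fun x : R * R => x.2 / rad j) F); last exact: cF.
  by apply: cont_atM; [exact: cont_at_snd|exact: cont_at_cst].
have ccut u : cont_at (@cut R) u by exact: has_der_cont (has_der_cut u).
have cdcut u : cont_at (@dcut R) u by exact: cont_at_dcut.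
have cb j : continuous (b j) by apply: cont_atW => x; apply: cont_atM; [exact: cc1|exact: cc2].
have ct1 j : continuous (t1 j).
  by apply: cont_atW => x; apply: cont_atM; [apply: cont_atM; [exact: cc1|exact: cont_at_cst]|exact: cc2].
have ct2 j : continuous (t2 j).
  by apply: cont_atW => x; apply: cont_atM; [exact: cc1|apply: cont_atM; [exact: cc2|exact: cont_at_cst]].
have nrm u j : `|u / rad j| = `|u| / rad j by rewrite normrM normfV (ger0_norm (ltW (rad0 j))).
have cut0 u j : 2 * rad j <= `|u| -> cut (u / rad j) = 0.
  by move=> hu; apply: cut_eq0; rewrite nrm ler_pdivlMr.
have dcut0 u j : `|u| <= rad j \/ 2 * rad j <= `|u| -> dcut (u / rad j) = 0.
  move=> [hu|hu]; apply: dcut_eq0; rewrite nrm; [left|right].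
    by rewrite ler_pdivrMr// mul1r.
  by rewrite ler_pdivlMr.
(* The derivative in one coordinate lives where that coordinate lies strictly between [rad j] and
   [2 * rad j]; these ranges are disjoint for distinct [j], so mixed products vanish. *)
have supp1 j x : t1 j x != 0 -> rad j < `|x.1| < 2 * rad j /\ `|x.2| < 2 * rad j.
  move=> nz; split; last first.
    by rewrite ltNge; apply: contra nz => hx; rewrite /t1 (cut0 _ _ hx) mulr0.
  by rewrite !ltNge; apply/andP; split; apply: contra nz => hx; rewrite /t1 dcut0 ?mul0r//; [left|right].
have supp2 j x : t2 j x != 0 -> rad j < `|x.2| < 2 * rad j /\ `|x.1| < 2 * rad j.
  move=> nz; split; last first.
    by rewrite ltNge; apply: contra nz => hx; rewrite /t2 (cut0 _ _ hx) mul0r.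
  by rewrite !ltNge; apply/andP; split; apply: contra nz => hx; rewrite /t2 dcut0 ?mul0r ?mulr0//; [left|right].
have radlt i j : (i < j)%N -> 2 * rad i <= rad j.
  by move=> ij; rewrite -exprS; apply: ler_weXn2l => //; rewrite ler1n.
have dis1 i j x : i != j -> t1 i x * t1 j x = 0.
  move=> ij; apply/eqP; rewrite mulf_eq0; apply/negP => /negP; rewrite negb_or => /andP[/supp1 [/andP[a1 a2] _] /supp1 [/andP[b1 b2] _]].
  by move: ij a1 a2 b1 b2; rewrite neq_ltn => /orP[/radlt|/radlt]; clear; lra.
have dis2 i j x : i != j -> t2 i x * t2 j x = 0.
  move=> ij; apply/eqP; rewrite mulf_eq0; apply/negP => /negP; rewrite negb_or => /andP[/supp2 [/andP[a1 a2] _] /supp2 [/andP[b1 b2] _]].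
  by move: ij a1 a2 b1 b2; rewrite neq_ltn => /orP[/radlt|/radlt]; clear; lra.
have box1 j x : ~ box (2 * rad j) x -> t1 j x = 0.
  move=> nb; apply/eqP/negP => /negP /supp1 [/andP[_ a2] a3]; apply: nb.
  by split; rewrite -ler_norml ltW.
have box2 j x : ~ box (2 * rad j) x -> t2 j x = 0.
  move=> nb; apply/eqP/negP => /negP /supp2 [/andP[_ a2] a3]; apply: nb.
  by split; rewrite -ler_norml ltW.
have cutle u : `|cut u| <= 1 :> R by rewrite ger0_norm ?cut_ge0 ?cut_le1.
have L1 j x : `|t1 j x| <= L / rad j.
  rewrite /t1 normrM normrM normfV (ger0_norm (ltW (rad0 j))) -[leRHS]mulr1.
  have dL (u : R) : `|dcut u| / rad j <= L / rad j by rewrite ler_pM2r ?invr_gt0.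
  have d0 (u : R) : 0 <= `|dcut u| / rad j by rewrite divr_ge0// ltW.
  by apply: ler_pM.
have L2 j x : `|t2 j x| <= L / rad j.
  rewrite /t2 normrM [X in _ * X]normrM normfV (ger0_norm (ltW (rad0 j))) -[leRHS]mul1r.
  have dL (u : R) : `|dcut u| / rad j <= L / rad j by rewrite ler_pM2r ?invr_gt0.
  have d0 (u : R) : 0 <= `|dcut u| / rad j by rewrite divr_ge0// ltW.
  by apply: ler_pM.
pose h x := \sum_(n <= j < m) (c j * b j x).
pose h1 x := \sum_(n <= j < m) (c j * t1 j x).
pose h2 x := \sum_(n <= j < m) (c j * t2 j x).
have csum (F : nat -> R * R -> R) : (forall j, continuous (F j)) -> continuous (fun x => \sum_(n <= j < m) (c j * F j x)).
  move=> cF; apply: cont_atW => x; apply: cont_at_sum => j; apply: cont_atM; first exact: cont_at_cst.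
  exact: cF.
have sumc : \sum_(n <= j < m) c j = 1.
  by rewrite /c -big_distrl/= divff// lt0r_neq0.
have nM : rad n <= M by apply: ler_weXn2l => //; rewrite ler1n.
exists M, h, h1, h2; split.
- by split; [exact: rad0|exact: le_trans nM].
- by split; exact: csum.
- split => x; apply: has_der_sum => j; apply: has_derZ; rewrite /b /=.
    by apply: has_der_eq (has_derM (hc j x.1) (has_der_cst (cut (x.2 / rad j)) x.1)) _; rewrite mulr0 addr0.
  by apply: has_der_eq (has_derM (has_der_cst (cut (x.1 / rad j)) x.2) (hc j x.2)) _; rewrite mul0r add0r.
- split => x.
  + apply/andP; split; first by apply: sumr_ge0 => j _; rewrite mulr_ge0// mulr_ge0// cut_ge0.
    rewrite -sumc; apply: ler_sum => j _; rewrite ler_piMr//.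
    by rewrite mulr_ile1 ?cut_ge0 ?cut_le1.
  + move=> bx; rewrite /h -sumc; apply: eq_big_nat => j /andP[nj _].
    have nj' : rad n <= rad j by apply: ler_weXn2l => //; rewrite ler1n.
    have /box_normP[y1 y2] := box_sub (le_trans nM0 nj') bx.
    by rewrite /b !cut_eq1 ?mulr1// nrm ler_pdivrMr ?mul1r.
  + move=> hx; rewrite /h big_nat_cond big1// => j; rewrite andbT => /andP[_ /radM jm].
    by case: hx => hx; rewrite /b; [rewrite (cut0 x.1)|rewrite (cut0 x.2)]; rewrite ?mul0r ?mulr0//;
      exact: le_trans hx.
- move=> s cs s0 sC.
  have b1 := @dyadic_sum_bound C L M S n0 n m s t1 n0n S0 erefl cs s0 sC ct1 L1 box1 dis1 radM.
  have b2 := @dyadic_sum_bound C L M S n0 n m s t2 n0n S0 erefl cs s0 sC ct2 L2 box2 dis2 radM.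
  have c1 : continuous (fun x => s x * h1 x ^+ 2).
    by apply: cont_atW => x; apply: cont_atM; [exact: cs|apply: cont_atX; exact: (csum t1 ct1)].
  have c2 : continuous (fun x => s x * h2 x ^+ 2).
    by apply: cont_atW => x; apply: cont_atM; [exact: cs|apply: cont_atX; exact: (csum t2 ct2)].
  under eq_Rintegral do rewrite mulrDr.
  rewrite RintegralD; [|exact: measurable_box|exact: (cont_locint c1).2|exact: (cont_locint c2).2].
  apply: le_trans (lerD b1 b2) _.
  have -> : 16 * C * L ^+ 2 / S + 16 * C * L ^+ 2 / S = 32 * C * L ^+ 2 / S.
    by field; exact: lt0r_neq0.
  by rewrite ler_pdivrMr// [kappa * S]mulrC -ler_pdivrMr.
Qed.

End log_cutoff.

(** * Integrability and the truncation error *)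

Section energy_tools.
Variable R : realType.
Local Notation R2 := (measurableTypeR R * measurableTypeR R)%type.
Local Notation mu := (@plane R).
Implicit Types (x z : R * R) (f g : R * R -> R).

Lemma locint_le f g : measurable_fun setT (f : R2 -> R) -> locint g -> (forall z, `|f z| <= g z) -> locint f.
Proof.
move=> mf [mg ig] fg; split => // M; apply: le_integrable (ig M).
- exact: measurable_box.
- by apply/measurable_EFinP; exact: measurable_funTS.
- by move=> z _; rewrite lee_fin (le_trans (fg z))// ler_norm.
Qed.

Lemma locint_sqM f g : measurable_fun setT (f : R2 -> R) -> measurable_fun setT (g : R2 -> R) ->
  locint (fun z => f z ^+ 2) -> locint (fun z => g z ^+ 2) -> locint (fun z => f z * g z).
Proof.
move=> mf mg f2 g2; apply: (@locint_le _ (fun z => f z ^+ 2 + g z ^+ 2)).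
- exact: measurable_funM.
- exact: locintD.
- move=> z; rewrite ler_norml; apply/andP; split.
    by have := sqr_ge0 (f z + g z); have := sqr_ge0 (f z); have := sqr_ge0 (g z); rewrite sqrrD; lra.
  by have := sqr_ge0 (f z - g z); have := sqr_ge0 (f z); have := sqr_ge0 (g z); rewrite sqrrB; lra.
Qed.

Lemma locint_cst (c : R) : locint (fun _ : R * R => c).
Proof. by apply: cont_locint; apply: cont_atW => x; exact: cont_at_cst. Qed.

Lemma locint_sq f : measurable_fun setT (f : R2 -> R) -> locint (fun z => f z ^+ 2) -> locint f.
Proof.
move=> mf f2; apply: (@locint_le _ (fun z => 1 + f z ^+ 2)) => //.
  by apply: locintD => //; exact: locint_cst.
move=> z; rewrite ler_norml; apply/andP; split.
  by have := sqr_ge0 (f z + 1); rewrite sqrrD expr1n mulr1; have := sqr_ge0 (f z); lra.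
by have := sqr_ge0 (f z - 1); rewrite sqrrB expr1n mulr1; have := sqr_ge0 (f z); lra.
Qed.

Lemma locintZ (c : R) f : locint f -> locint (fun z => c * f z).
Proof.
move=> lf; have := locintM_cont lf (g := fun=> c); rewrite (_ : (fun z => f z * c) = (fun z => c * f z)).
  by apply; apply: cont_atW => x; exact: cont_at_cst.
by apply/funext => z; rewrite mulrC.
Qed.

Lemma Rintegral_rect_subset (a b c d a' b' c' d' : R) (f : R * R -> R) :
  rect a' b' c' d' `<=` rect a b c d ->
  (forall z, rect a b c d z -> cont_at f z) -> (forall z, rect a b c d z -> 0 <= f z) ->
  \int[mu]_(z in rect a' b' c' d') f z <= \int[mu]_(z in rect a b c d) f z.
Proof.
move=> sub cf f0.
have i1 : mu.-integrable (rect a b c d) (EFin \o f) by exact: cont_integrable.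
have i0 : mu.-integrable (rect a' b' c' d') (EFin \o f).
  by apply: cont_integrable => z /sub; exact: cf.
apply: fine_le.
- by apply: integrable_fin_num => //; exact: measurable_rect.
- by apply: integrable_fin_num => //; exact: measurable_rect.
apply: ge0_subset_integral => //.
- exact: measurable_rect.
- exact: measurable_rect.
- exact: (measurable_int _ i1).
Qed.

(** The zeros of [s] do no harm: near them [s <= E], where [chi] is identically 0. *)
Lemma cont_at_chi_div (T : topologicalType) (E : R) (s : T -> R) (a : T) : 0 < E -> cont_at s a ->
  cont_at (fun y => chi E (s y) / s y) a.
Proof.
move=> E0 cs; have [Es|sE] := leP E (s a).
  apply: cont_atM; first by apply: (@cont_at_comp1 _ _ s (chi E)) => //; exact: cont_at_chi.
  by apply: cont_atV => //; rewrite lt0r_neq0//; exact: lt_le_trans Es.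
apply: (@cont_at_near _ _ (fun=> 0)); last exact: cont_at_cst.
have /cvgr_lt := cs => /(_ _ sE).
by apply: filterS => y /ltW h; rewrite chi_eq0// mul0r.
Qed.

Lemma cont_at_sdchi (T : topologicalType) (E : R) (s : T -> R) (a : T) : 0 < E -> cont_at s a ->
  cont_at (fun y => s y * dchi E (s y)) a.
Proof.
move=> E0 cs; apply: cont_atM => //; apply: (@cont_at_comp1 _ _ s (dchi E)) => //.
exact: cont_at_dchi.
Qed.

(** Once [E <= s / 2], [sdchi_le] gives the bound [12 E^2 / s^2]; [harmonic n] serves as a positive
    sequence of levels tending to 0. *)
Lemma sdchi_cvg0 (s : R) : 0 <= s -> s * dchi (harmonic n) s @[n --> \oo] --> (0 : R).
Proof.
rewrite le_eqVlt => /predU1P[<-|s0].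
  by under eq_fun do rewrite mul0r; exact: cvg_cst.
pose K := 12 / s ^+ 2.
have hK : (fun n => K * (@harmonic R n * @harmonic R n)) n @[n --> \oo] --> (K * (0 * 0) : R).
  exact: (cvgM (cvg_cst _) (cvgM (@cvg_harmonic R) (@cvg_harmonic R))).
rewrite !mulr0 in hK.
apply: (@squeeze_cvgr _ _ _ _ (fun=> 0) (fun n => K * (@harmonic R n * @harmonic R n))) => //; last exact: cvg_cst.
near=> n.
have h0 : 0 < harmonic n :> R by exact: harmonic_gt0.
have hs : harmonic n <= s / 2 :> R.
  by near: n; move/cvgr_le : (@cvg_harmonic R) => /(_ (s / 2)); apply; rewrite divr_gt0.
rewrite sdchi_ge0 ?(ltW s0)//=.
apply: le_trans (sdchi_le h0 s) _.
set E := harmonic n in h0 hs *.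
have p1 : s / 2 <= pospart (s - E) by rewrite /pospart le_max; apply/orP; right; lra.
have p2 : s ^+ 2 / 4 <= pospart (s - E) ^+ 2.
  have -> : s ^+ 2 / 4 = (s / 2) ^+ 2 by field.
  by rewrite ler_sqr ?nnegrE ?pospart_ge0// divr_ge0// ltW.
rewrite ler_pdivrMr; last by rewrite ltr_pwDl ?exprn_gt0// sqr_ge0.
have -> : 3 * E ^+ 2 = K * (E * E) * (s ^+ 2 / 4) by rewrite /K; field; exact: lt0r_neq0.
apply: ler_wpM2l.
  have K0 : 0 <= K by rewrite divr_ge0 ?sqr_ge0.
  by apply: mulr_ge0 => //; apply: mulr_ge0; exact: ltW.
by apply: le_trans p2 _; rewrite lerDr sqr_ge0.
Unshelve. all: by end_near. Qed.

(** Dominated convergence with majorant [3 * L]: the weight of the truncation error tends to 0 at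
    each point, though not uniformly where [s] is comparable to [E]. *)
Lemma integral_sdchi_small (s L : R * R -> R) (M e c : R) : continuous s -> (forall z, 0 <= s z) ->
  locint L -> (forall z, 0 <= L z) -> 0 < e -> 0 < c ->
  exists E, [/\ 0 < E, E <= c & \int[mu]_(z in box M) (s z * dchi E (s z) * L z) <= e].
Proof.
move=> cs s0 lL L0 e0 c0.
have h0 n : 0 < harmonic n :> R by exact: harmonic_gt0.
pose W n z := s z * dchi (harmonic n) (s z).
have cW n : continuous (W n) by apply: cont_atW => z; exact: (cont_at_sdchi (h0 n) (cs z)).
have lWL n : locint (fun z => W n z * L z).
  have := locintM_cont lL (cW n); congr locint; by apply/funext => z; rewrite mulrC.
have lim : (\int[mu]_(z in box M) (W n z * L z)%:E)%E @[n --> \oo] --> (\int[mu]_(z in box M) (0 : R)%:E)%E.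
  apply: (@dominated_cvg _ _ _ mu _ (measurable_box M) _ _ (fun z => (3 * L z)%:E)).
  - by move=> n; exact: (measurable_int _ ((lWL n).2 M)).
  - move=> z _; apply/cvg_EFin; first exact: nearW.
    have : (fun n => W n z * L z) n @[n --> \oo] --> (0 * L z : R).
      exact: (cvgM (sdchi_cvg0 (s0 z)) (cvg_cst _)).
    by rewrite mul0r.
  - by [].
  - exact: (locintZ 3 lL).2.
  - move=> n z _; rewrite lee_fin normrM !ger0_norm//.
      by rewrite ler_wpM2r// sdchi_le3.
    by rewrite sdchi_ge0.
rewrite integral0 in lim.
have /fine_cvgP[_ lim'] := lim.
have near_e := cvgr_le _ lim' _ e0.
have near_c := cvgr_le _ (@cvg_harmonic R) _ c0.
have [n [hn1 hn2]] : exists n, harmonic n <= c /\ \int[mu]_(z in box M) (W n z * L z) <= e.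
  near \oo => n; exists n; split; near: n; [exact: near_c|exact: near_e].
by exists (harmonic n); split.
Unshelve. all: by end_near. Qed.

End energy_tools.

(** * The energy estimate *)

Section flow.
Variable R : realType.
Local Notation R2 := (measurableTypeR R * measurableTypeR R)%type.
Local Notation mu := (@plane R).
Implicit Types (x z : R * R) (f g : R * R -> R) (d E : R).

(* The weak derivatives of [f] are [f1] and [f2], tested against product kernels only. *)
Definition mweak (f f1 f2 : R * R -> R) : Prop := forall D p q, csmooth D p -> csmooth D q ->
  forall x, conv f (derive1 p) q x = conv f1 p q x /\ conv f p (derive1 q) x = conv f2 p q x.

Variables (v1 v2 A1 A2 B1 B2 : R * R -> R).
Hypotheses (cv1 : continuous v1) (cv2 : continuous v2).
Hypotheses (mA1 : measurable_fun setT (A1 : R2 -> R)) (mA2 : measurable_fun setT (A2 : R2 -> R)).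
Hypotheses (mB1 : measurable_fun setT (B1 : R2 -> R)) (mB2 : measurable_fun setT (B2 : R2 -> R)).
Hypotheses (lA1 : locint (fun z => A1 z ^+ 2)) (lA2 : locint (fun z => A2 z ^+ 2)).
Hypotheses (lB1 : locint (fun z => B1 z ^+ 2)) (lB2 : locint (fun z => B2 z ^+ 2)).
Hypotheses (wv1 : mweak v1 A1 A2) (wv2 : mweak v2 B1 B2).

(** [g1] and [g2] are the components of the field [v1 grad v2 - v2 grad v1], which [divg] states to
    be divergence free. *)
Let g1 z := v1 z * B1 z - v2 z * A1 z.
Let g2 z := v1 z * B2 z - v2 z * A2 z.
Hypothesis divg : forall D p q, csmooth D p -> csmooth D q ->
  forall x, conv g1 (derive1 p) q x + conv g2 p (derive1 q) x = 0.

Let L z := A1 z ^+ 2 + A2 z ^+ 2 + B1 z ^+ 2 + B2 z ^+ 2.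
Let lL : locint L.
Proof. by do 3 (apply: locintD => //). Qed.
Let L0 z : 0 <= L z.
Proof. by rewrite !addr_ge0 ?sqr_ge0. Qed.

Let locv1 f : locint f -> locint (fun z => v1 z * f z).
Proof. by move=> lf; have := locintM_cont lf cv1; congr locint; apply/funext => z; rewrite mulrC. Qed.
Let locv2 f : locint f -> locint (fun z => v2 z * f z).
Proof. by move=> lf; have := locintM_cont lf cv2; congr locint; apply/funext => z; rewrite mulrC. Qed.

Let lg1 : locint g1.
Proof. by apply: locintB; [apply: locv1|apply: locv2]; exact: locint_sq. Qed.
Let lg2 : locint g2.
Proof. by apply: locintB; [apply: locv1|apply: locv2]; exact: locint_sq. Qed.

Let J (u w : R) (du dw : R) := u * dw - w * du.

Section radius.
Variable d : R.
Hypothesis d0 : 0 < d.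
Let hm := csmooth_moll d0.

(** [conv_dir] puts the derivative on the kernel, and the weak derivative moves it onto [f]. The
    base point lies on an axis, so that the line parameter is the coordinate itself. *)
Lemma mollify_section1 f f1 f2 x : continuous f -> mweak f f1 f2 ->
  has_der (fun t => mollify d f (t, x.2)) x.1 (mollify d f1 x).
Proof.
move=> cf wf.
have h := @conv_dir R d f (moll d) (moll d) (0, x.2) (1, 0) x.1 (cont_locint cf) hm hm.
have [e1 _] := wf _ _ _ hm hm x.
have X : (0 + x.1 * 1, x.2 + x.1 * 0) = x by rewrite add0r mulr1 mulr0 addr0 -surjective_pairing.
rewrite /= X mul1r mul0r addr0 e1 in h.
have E t : (0 + t * 1, x.2 + t * 0) = (t, x.2) by rewrite add0r mulr1 mulr0 addr0.
by apply: has_der_ext h => t; rewrite E.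
Qed.

Lemma mollify_section2 f f1 f2 x : continuous f -> mweak f f1 f2 ->
  has_der (fun t => mollify d f (x.1, t)) x.2 (mollify d f2 x).
Proof.
move=> cf wf.
have h := @conv_dir R d f (moll d) (moll d) (x.1, 0) (0, 1) x.2 (cont_locint cf) hm hm.
have [_ e2] := wf _ _ _ hm hm x.
have X : (x.1 + x.2 * 0, 0 + x.2 * 1) = x by rewrite add0r mulr1 mulr0 addr0 -surjective_pairing.
rewrite /= X mul1r mul0r add0r e2 in h.
have E t : (x.1 + t * 0, 0 + t * 1) = (x.1, t) by rewrite add0r mulr1 mulr0 addr0.
by apply: has_der_ext h => t; rewrite E.
Qed.

Let u := mollify d v1.
Let w := mollify d v2.
Let u1 := mollify d A1.
Let u2 := mollify d A2.
Let w1 := mollify d B1.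
Let w2 := mollify d B2.

Lemma mollify_grad_le x : u1 x ^+ 2 + u2 x ^+ 2 + w1 x ^+ 2 + w2 x ^+ 2 <= mollify d L x.
Proof.
rewrite /L mollifyD// ?mollifyD// ?mollifyD//; last 2 first.
- by apply: locintD.
- by apply: locintD => //; apply: locintD.
by rewrite !lerD// mollify_jensen//; exact: locint_sq.
Qed.

(** With [x] frozen the difference is the mollification of [k], in which [A] and [B] are multiplied
    by oscillations of [v] over distance [d]. Jensen then bounds its square by [om^2] times the
    mollified gradient energy. *)
Let comm_sq (A B : R * R -> R) x (om : R) :
  measurable_fun setT (A : R2 -> R) -> measurable_fun setT (B : R2 -> R) ->
  locint (fun z => A z ^+ 2) -> locint (fun z => B z ^+ 2) ->
  (forall z, `|x.1 - z.1| <= d -> `|x.2 - z.2| <= d -> `|u x - v1 z| <= om /\ `|w x - v2 z| <= om) ->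
  (J (u x) (w x) (mollify d A x) (mollify d B x) - mollify d (fun z => v1 z * B z - v2 z * A z) x) ^+ 2
    <= 2 * om ^+ 2 * mollify d (fun z => A z ^+ 2 + B z ^+ 2) x.
Proof.
move=> mA mB lA lB hom.
have iA : locint A by exact: locint_sq.
have iB : locint B by exact: locint_sq.
pose k z := (u x - v1 z) * B z - (w x - v2 z) * A z.
have c1 : continuous (fun z => u x - v1 z).
  by apply: cont_atW => z; apply: cont_atB; [exact: cont_at_cst|exact: cv1].
have c2 : continuous (fun z => w x - v2 z).
  by apply: cont_atW => z; apply: cont_atB; [exact: cont_at_cst|exact: cv2].
have lk : locint k.
  apply: locintB.
    by have := locintM_cont iB c1; congr locint; apply/funext => z; rewrite mulrC.
  by have := locintM_cont iA c2; congr locint; apply/funext => z; rewrite mulrC.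
have csq f : continuous f -> continuous (fun z => f z * f z).
  by move=> cf; apply: cont_atW => z; apply: cont_atM; exact: cf.
have csq2 : continuous (fun z => (u x - v1 z) * (w x - v2 z)).
  by apply: cont_atW => z; apply: cont_atM; [exact: c1|exact: c2].
have lk2 : locint (fun z => k z ^+ 2).
  have e : (fun z => k z ^+ 2) = (fun z => (B z ^+ 2 * ((u x - v1 z) * (u x - v1 z)) +
     A z ^+ 2 * ((w x - v2 z) * (w x - v2 z))) + (- 2) * (A z * B z * ((u x - v1 z) * (w x - v2 z)))).
    by apply/funext => z; rewrite /k; ring.
  rewrite e; apply: locintD.
    by apply: locintD; [exact: (locintM_cont lB (csq _ c1))|exact: (locintM_cont lA (csq _ c2))].
  by apply: locintZ; apply: (locintM_cont _ csq2); exact: locint_sqM.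
have -> : J (u x) (w x) (mollify d A x) (mollify d B x) - mollify d (fun z => v1 z * B z - v2 z * A z) x =
    mollify d k x.
  have e : k = (fun z => (u x * B z + (- w x) * A z) + (-1) * (v1 z * B z - v2 z * A z)).
    by apply/funext => z; rewrite /k; ring.
  have l1 : locint (fun z => u x * B z) by exact: locintZ.
  have l2 : locint (fun z => - w x * A z) by exact: locintZ.
  have l3 : locint (fun z => v1 z * B z - v2 z * A z).
    by apply: locintB; [exact: locv1|exact: locv2].
  have l12 := locintD l1 l2; have l4 := locintZ (-1) l3.
  rewrite e (mollifyD d0 x l12 l4) (mollifyD d0 x l1 l2) (mollifyZ d0 _ x iB) (mollifyZ d0 _ x iA) (mollifyZ d0 _ x l3).
  rewrite /J; ring.
apply: le_trans (mollify_jensen d0 x lk lk2) _.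
have lAB : locint (fun z => A z ^+ 2 + B z ^+ 2) by exact: locintD.
rewrite -mollifyZ//; apply: le_mollify => //; first exact: locintZ.
move=> z z1 z2; have [h1 h2] := hom z z1 z2.
have s1 : (u x - v1 z) ^+ 2 <= om ^+ 2.
  rewrite -[leLHS]ger0_norm ?sqr_ge0// normrX ler_sqr ?nnegrE//.
  exact: le_trans h1.
have s2 : (w x - v2 z) ^+ 2 <= om ^+ 2.
  rewrite -[leLHS]ger0_norm ?sqr_ge0// normrX ler_sqr ?nnegrE//.
  exact: le_trans h2.
have := sqr_ge0 ((u x - v1 z) * B z + (w x - v2 z) * A z).
have := ler_wpM2r (sqr_ge0 (B z)) s1; have := ler_wpM2r (sqr_ge0 (A z)) s2.
have -> : k z ^+ 2 = 2 * ((u x - v1 z) ^+ 2 * B z ^+ 2) + 2 * ((w x - v2 z) ^+ 2 * A z ^+ 2) -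
    ((u x - v1 z) * B z + (w x - v2 z) * A z) ^+ 2 by rewrite /k; ring.
lra.
Qed.

Lemma commutator_le x (om : R) :
  (forall z, `|x.1 - z.1| <= d -> `|x.2 - z.2| <= d -> `|u x - v1 z| <= om /\ `|w x - v2 z| <= om) ->
  (u x * w1 x - w x * u1 x - mollify d g1 x) ^+ 2 + (u x * w2 x - w x * u2 x - mollify d g2 x) ^+ 2
    <= 2 * om ^+ 2 * mollify d L x.
Proof.
move=> hom.
have c1 := comm_sq mA1 mB1 lA1 lB1 hom; have c2 := comm_sq mA2 mB2 lA2 lB2 hom.
have l1 : locint (fun z => A1 z ^+ 2 + B1 z ^+ 2) by exact: locintD.
have l2 : locint (fun z => A2 z ^+ 2 + B2 z ^+ 2) by exact: locintD.
apply: le_trans (lerD c1 c2) _; rewrite -mulrDr -(mollifyD d0 x l1 l2).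
rewrite le_eqVlt; apply/orP; left; apply/eqP; congr (_ * _); congr (mollify d _ x).
by apply/funext => z; rewrite /L; ring.
Qed.

Variables (E e1 e2 M : R) (h h1 h2 : R * R -> R).
Hypotheses (E0 : 0 < E) (he : e1 ^+ 2 + e2 ^+ 2 = 1) (M0 : 0 < M).
Hypothesis os : forall x, box M x -> off_slit E e1 e2 (u x) (w x).
Hypotheses (ch : continuous h) (ch1 : continuous h1) (ch2 : continuous h2).
Hypothesis dh1 : forall x, has_der (fun t => h (t, x.2)) x.1 (h1 x).
Hypothesis dh2 : forall x, has_der (fun t => h (x.1, t)) x.2 (h2 x).
Hypothesis h01 : forall x, 0 <= h x <= 1.
Hypothesis h_supp : forall x, M <= `|x.1| \/ M <= `|x.2| -> h x = 0.

(** The mollified field inherits the vanishing divergence, unlike the field built from the mollified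
    velocity. *)
Let K1 := mollify d g1.
Let K2 := mollify d g2.
Let F x := cang E e1 e2 (u x) (w x).
Let F1 x := dcang E e1 e2 (u x) (w x) (u1 x) (w1 x).
Let F2 x := dcang E e1 e2 (u x) (w x) (u2 x) (w2 x).
Let Phi1 x := F1 x * h x ^+ 2 + 2 * F x * h x * h1 x.
Let Phi2 x := F2 x * h x ^+ 2 + 2 * F x * h x * h2 x.

Let cm f : locint f -> forall x, cont_at (mollify d f) x.
Proof. by move=> lf x; exact: (mollify_continuous d0 lf). Qed.
Let cu : forall x, cont_at u x. Proof. exact: (cm (cont_locint cv1)). Qed.
Let cw : forall x, cont_at w x. Proof. exact: (cm (cont_locint cv2)). Qed.
Let cu1 : forall x, cont_at u1 x. Proof. by apply: cm; exact: locint_sq. Qed.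
Let cu2 : forall x, cont_at u2 x. Proof. by apply: cm; exact: locint_sq. Qed.
Let cw1 : forall x, cont_at w1 x. Proof. by apply: cm; exact: locint_sq. Qed.
Let cw2 : forall x, cont_at w2 x. Proof. by apply: cm; exact: locint_sq. Qed.
Let cK1 : forall x, cont_at K1 x. Proof. exact: cm. Qed.
Let cK2 : forall x, cont_at K2 x. Proof. exact: cm. Qed.
Let cF x : box M x -> cont_at F x.
Proof. by move=> bx; apply: cont_at_cang => //; exact: os. Qed.
Let cF1 x : box M x -> cont_at F1 x.
Proof. by move=> bx; apply: cont_at_dcang => //; exact: os. Qed.
Let cF2 x : box M x -> cont_at F2 x.
Proof. by move=> bx; apply: cont_at_dcang => //; exact: os. Qed.
Let cPhi1 x : box M x -> cont_at Phi1 x.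
Proof.
move=> bx; apply: cont_atD.
  by apply: cont_atM; [exact: cF1|apply: cont_atX; exact: ch].
apply: cont_atM; last exact: ch1.
apply: cont_atM; last exact: ch.
by apply: cont_atM; [exact: cont_at_cst|exact: cF].
Qed.
Let cPhi2 x : box M x -> cont_at Phi2 x.
Proof.
move=> bx; apply: cont_atD.
  by apply: cont_atM; [exact: cF2|apply: cont_atX; exact: ch].
apply: cont_atM; last exact: ch2.
apply: cont_atM; last exact: ch.
by apply: cont_atM; [exact: cont_at_cst|exact: cF].
Qed.

Let pair_eta x : (x.1, x.2) = x. Proof. by case: x. Qed.

(** [(Phi1, Phi2)] is the gradient of [F * h^2]. Integrating the divergence of [(K1, K2)] times this
    function over the box leaves no boundary term, since [h] vanishes on the boundary, and no term
    with the divergence of [K]. *)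
Let weak_energy0 : \int[mu]_(x in box M) (K1 x * Phi1 x + K2 x * Phi2 x) = 0.
Proof.
pose D1 := conv g1 (derive1 (moll d)) (moll d).
pose D2 := conv g2 (moll d) (derive1 (moll d)).
have hm' := csmooth_derive1 hm.
have cD1 x : cont_at D1 x by exact: (conv_continuous lg1 hm' hm).
have cD2 x : cont_at D2 x by exact: (conv_continuous lg2 hm hm').
have dK1 x : has_der (fun t => K1 (t, x.2)) x.1 (D1 x).
  have H := @conv_dir R d g1 (moll d) (moll d) (0, x.2) (1, 0) x.1 lg1 hm hm.
  have X : (0 + x.1 * 1, x.2 + x.1 * 0) = x by rewrite add0r mulr1 mulr0 addr0 -surjective_pairing.
  rewrite /= X mul1r mul0r addr0 in H.
  by apply: has_der_ext H => t; rewrite /K1 /mollify add0r mulr1 mulr0 addr0.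
have dK2 x : has_der (fun t => K2 (x.1, t)) x.2 (D2 x).
  have H := @conv_dir R d g2 (moll d) (moll d) (x.1, 0) (0, 1) x.2 lg2 hm hm.
  have X : (x.1 + x.2 * 0, 0 + x.2 * 1) = x by rewrite add0r mulr1 mulr0 addr0 -surjective_pairing.
  rewrite /= X mul1r mul0r add0r in H.
  by apply: has_der_ext H => t; rewrite /K2 /mollify add0r mulr1 mulr0 addr0.
have dF1 x : box M x -> has_der (fun t => F (t, x.2)) x.1 (F1 x).
  move=> bx; rewrite /F /F1.
  have p1 := mollify_section1 x cv1 wv1; have p2 := mollify_section1 x cv2 wv2.
  have := @has_der_cang R E e1 e2 E0 he (fun t => u (t, x.2)) (fun t => w (t, x.2)) x.1 (u1 x) (w1 x) p1 p2.
  by rewrite pair_eta => /(_ (os bx)).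
have dF2 x : box M x -> has_der (fun t => F (x.1, t)) x.2 (F2 x).
  move=> bx; rewrite /F /F2.
  have p1 := mollify_section2 x cv1 wv1; have p2 := mollify_section2 x cv2 wv2.
  have := @has_der_cang R E e1 e2 E0 he (fun t => u (x.1, t)) (fun t => w (x.1, t)) x.2 (u2 x) (w2 x) p1 p2.
  by rewrite pair_eta => /(_ (os bx)).
have MM : `|M| = M by rewrite gtr0_norm.
have hM s : h (M, s) = 0 by apply: h_supp; left; rewrite /= MM.
have hNM s : h (- M, s) = 0 by apply: h_supp; left; rewrite /= normrN MM.
have hM' s : h (s, M) = 0 by apply: h_supp; right; rewrite /= MM.
have hNM' s : h (s, - M) = 0 by apply: h_supp; right; rewrite /= normrN MM.
pose G1 x := K1 x * (F x * h x ^+ 2).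
pose G2 x := K2 x * (F x * h x ^+ 2).
pose f1 x := D1 x * (F x * h x ^+ 2) + K1 x * Phi1 x.
pose f2 x := D2 x * (F x * h x ^+ 2) + K2 x * Phi2 x.
have cFh x : box M x -> cont_at (fun x => F x * h x ^+ 2) x.
  by move=> bx; apply: cont_atM; [exact: cF|apply: cont_atX; exact: ch].
have key : \int[mu]_(x in box M) (f1 x + f2 x) = 0.
  apply: (@rect_ibp R G1 G2 f1 f2 M M0).
  - move=> x bx; apply: cont_atD; apply: cont_atM => //; [exact: cFh|exact: cPhi1].
  - move=> x bx; apply: cont_atD; apply: cont_atM => //; [exact: cFh|exact: cPhi2].
  - move=> x bx.
    have H := has_derM (dK1 x) (has_derM (dF1 x bx) (has_derX 2 (dh1 x))).
    apply: has_der_eq H _; rewrite /= !pair_eta /f1 /Phi1 expr1; ring.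
  - move=> x bx.
    have H := has_derM (dK2 x) (has_derM (dF2 x bx) (has_derX 2 (dh2 x))).
    apply: has_der_eq H _; rewrite /= !pair_eta /f2 /Phi2 expr1; ring.
  - by move=> s; rewrite /G1 hM expr0n !mulr0.
  - by move=> s; rewrite /G1 hNM expr0n !mulr0.
  - by move=> s; rewrite /G2 hM' expr0n !mulr0.
  - by move=> s; rewrite /G2 hNM' expr0n !mulr0.
rewrite -[RHS]key; apply: eq_Rintegral => x _.
have := divg hm hm x; rewrite -/(D1 x) -/(D2 x) => dg.
rewrite /f1 /f2 addrACA -mulrDl dg mul0r add0r//.
Qed.

(** The integral of [energy_pointwise]: the pairing with [K] disappears by [weak_energy0], and
    mollified quantities on the right are traded for unmollified ones on a box enlarged by [d]. The
    number [tau] is the price of comparing the truncation weight at [x] and at nearby [z]. *)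
Lemma mollified_energy (om tau H Hs : R) :
  0 < om -> 0 <= tau ->
  (forall x z, box M x -> `|x.1 - z.1| <= d -> `|x.2 - z.2| <= d ->
    [/\ `|u x - v1 z| <= om, `|w x - v2 z| <= om &
     (u x ^+ 2 + w x ^+ 2) * dchi E (u x ^+ 2 + w x ^+ 2) <=
     (v1 z ^+ 2 + v2 z ^+ 2) * dchi E (v1 z ^+ 2 + v2 z ^+ 2) + tau]) ->
  \int[mu]_(x in box M) (h1 x ^+ 2 + h2 x ^+ 2) <= H ->
  \int[mu]_(x in box M) ((u x ^+ 2 + w x ^+ 2) * (h1 x ^+ 2 + h2 x ^+ 2)) <= Hs ->
  2^-1 * \int[mu]_(x in box M) (chi E (u x ^+ 2 + w x ^+ 2) *
     ((u x * w1 x - w x * u1 x) ^+ 2 + (u x * w2 x - w x * u2 x) ^+ 2) / (u x ^+ 2 + w x ^+ 2) * h x ^+ 2) <=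
  om * (1 + (72 * pi ^+ 2 + 2) / E) * \int[mu]_(z in box (M + d)) L z + 4 * pi ^+ 2 * om * H +
  pi * \int[mu]_(z in box (M + d))
     (((v1 z ^+ 2 + v2 z ^+ 2) * dchi E (v1 z ^+ 2 + v2 z ^+ 2) + tau) * L z) + 2 * pi ^+ 2 * Hs.
Proof.
move=> om0 tau0 hyp hH hHs.
pose s x := u x ^+ 2 + w x ^+ 2.
pose sv z := v1 z ^+ 2 + v2 z ^+ 2.
pose W z := sv z * dchi E (sv z) + tau.
pose J1 x := u x * w1 x - w x * u1 x.
pose J2 x := u x * w2 x - w x * u2 x.
pose Lam := mollify d L.
pose CE := 1 + (72 * pi ^+ 2 + 2) / E : R.
pose gr x := h1 x ^+ 2 + h2 x ^+ 2.
have cs x : cont_at s x by apply: cont_atD; exact: cont_atX.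
have csv z : cont_at sv z.
  by apply: cont_atD; apply: cont_atX; [exact: cv1|exact: cv2].
have cJ1 x : cont_at J1 x by apply: cont_atB; exact: cont_atM.
have cJ2 x : cont_at J2 x by apply: cont_atB; exact: cont_atM.
have cLam x : cont_at Lam x by exact: cm.
have cgr x : cont_at gr x by apply: cont_atD; apply: cont_atX; [exact: ch1|exact: ch2].
have cW z : cont_at W z by apply: cont_atD; [exact: cont_at_sdchi|exact: cont_at_cst].
have lWL : locint (fun z => W z * L z).
  have := locintM_cont lL (cont_atW cW); congr locint; by apply/funext => z; rewrite mulrC.
have sv0 z : 0 <= sv z by rewrite addr_ge0 ?sqr_ge0.
have W0 z : 0 <= W z by rewrite addr_ge0// sdchi_ge0.
have cWL x : cont_at (mollify d (fun z => W z * L z)) x by exact: cm.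
pose lhs x := chi E (s x) * (J1 x ^+ 2 + J2 x ^+ 2) / s x * h x ^+ 2.
have clhs x : cont_at lhs x.
  apply: (@cont_at_ext _ _ (fun x => (chi E (s x) / s x) * ((J1 x ^+ 2 + J2 x ^+ 2) * h x ^+ 2))).
    by move=> y; rewrite /lhs; ring.
  apply: cont_atM; first exact: cont_at_chi_div.
  by apply: cont_atM; [apply: cont_atD; exact: cont_atX|apply: cont_atX; exact: ch].
pose q0 x := K1 x * Phi1 x + K2 x * Phi2 x.
have cq0 x : box M x -> cont_at q0 x.
  by move=> bx; apply: cont_atD; apply: cont_atM => //; [exact: cPhi1|exact: cPhi2].
pose a1 : R := om * CE.
pose a2 : R := 4 * pi ^+ 2 * om.
pose a3 : R := 2 * pi ^+ 2.
pose rhs x := q0 x + (a1 * Lam x + (a2 * gr x + (pi * mollify d (fun z => W z * L z) x + a3 * (s x * gr x)))).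
have point x : box M x -> 2^-1 * lhs x <= rhs x.
  move=> bx.
  have om_le z : `|x.1 - z.1| <= d -> `|x.2 - z.2| <= d -> `|u x - v1 z| <= om /\ `|w x - v2 z| <= om.
    by move=> z1 z2; have [] := hyp x z bx z1 z2.
  have hle : `|h x| <= 1 by have /andP[h0 h1'] := h01 x; rewrite ger0_norm.
  have JK := commutator_le om_le.
  have base := @energy_pointwise R E e1 e2 E0 (u x) (w x) (u1 x) (u2 x) (w1 x) (w2 x)
     (h x) (h1 x) (h2 x) (K1 x) (K2 x) om (Lam x) (os bx) om0 hle (mollify_grad_le x) JK.
  apply: le_trans base _; rewrite /rhs /q0 /Phi1 /Phi2 /F1 /F2 /F -/(s x) -/(gr x).
  (* The weight at [x] is moved inside the average, where it may be replaced by the weight at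
     [z]. *)
  have WL : s x * dchi E (s x) * Lam x <= mollify d (fun z => W z * L z) x.
    rewrite /Lam -mollifyZ//; apply: le_mollify => //; first exact: locintZ.
    by move=> z z1 z2; apply: ler_wpM2r => //; have [] := hyp x z bx z1 z2.
  have := ler_wpM2l (pi_ge0 R) WL; rewrite /a1 /a2 /a3 /CE; lra.
have mb : measurable (box M : set R2) by exact: measurable_box.
have il : mu.-integrable (box M) (EFin \o (fun x => 2^-1 * lhs x)).
  by apply: cont_integrable => x _; apply: cont_atM; [exact: cont_at_cst|exact: clhs].
have cz (a : R) (f : R * R -> R) x : cont_at f x -> cont_at (fun x => a * f x) x.
  by move=> cf; apply: cont_atM => //; exact: cont_at_cst.
have csg x : cont_at (fun x => s x * gr x) x by exact: cont_atM.
have i0 : mu.-integrable (box M) (EFin \o q0) by exact: cont_integrable.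
have i5 : mu.-integrable (box M) (EFin \o (fun x => a3 * (s x * gr x))) by apply: cont_integrable => x _; exact: cz.
have i4 : mu.-integrable (box M) (EFin \o (fun x => pi * mollify d (fun z => W z * L z) x)).
  by apply: cont_integrable => x _; exact: cz.
have i45 : mu.-integrable (box M) (EFin \o (fun x => pi * mollify d (fun z => W z * L z) x + a3 * (s x * gr x))).
  by apply: cont_integrable => x _; apply: cont_atD; exact: cz.
have i3 : mu.-integrable (box M) (EFin \o (fun x => a2 * gr x)) by apply: cont_integrable => x _; exact: cz.
have i345 : mu.-integrable (box M) (EFin \o (fun x => a2 * gr x + (pi * mollify d (fun z => W z * L z) x + a3 * (s x * gr x)))).
  by apply: cont_integrable => x _; apply: cont_atD; [exact: cz|apply: cont_atD; exact: cz].
have i2 : mu.-integrable (box M) (EFin \o (fun x => a1 * Lam x)) by apply: cont_integrable => x _; exact: cz.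
have i2345 : mu.-integrable (box M) (EFin \o (fun x => a1 * Lam x + (a2 * gr x + (pi * mollify d (fun z => W z * L z) x + a3 * (s x * gr x))))).
  by apply: cont_integrable => x _; apply: cont_atD; [exact: cz|apply: cont_atD; [exact: cz|apply: cont_atD; exact: cz]].
have ir : mu.-integrable (box M) (EFin \o rhs).
  by apply: cont_integrable => x bx; apply: cont_atD; [exact: cq0|apply: cont_atD; [exact: cz|apply: cont_atD; [exact: cz|apply: cont_atD; exact: cz]]].
have ci (f : R * R -> R) : (forall x, cont_at f x) -> mu.-integrable (box M) (EFin \o f).
  by move=> cf; apply: cont_integrable => x _; exact: cf.
have main := le_Rintegral mb il ir point.
rewrite (RintegralZl _ mb (ci _ clhs)) in main.
apply: le_trans main _.
rewrite (RintegralD mb i0 i2345) (RintegralD mb i2 i345) (RintegralD mb i3 i45) (RintegralD mb i4 i5).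
rewrite weak_energy0 add0r.
rewrite (RintegralZl _ mb (ci _ cLam)) (RintegralZl _ mb (ci _ cgr)) (RintegralZl _ mb (ci _ cWL)) (RintegralZl _ mb (ci _ csg)).
have t1 : a1 * \int[mu]_(x in box M) Lam x <= a1 * \int[mu]_(z in box (M + d)) L z.
  apply: ler_wpM2l; last exact: (integral_mollify_le d0 M lL L0).
  rewrite /a1 /CE; apply: mulr_ge0; first exact: ltW.
  by rewrite addr_ge0// divr_ge0 ?(ltW E0)// addr_ge0// mulr_ge0// sqr_ge0.
have t2 : a2 * \int[mu]_(x in box M) gr x <= a2 * H.
  apply: ler_wpM2l => //; rewrite /a2; apply: mulr_ge0; last exact: ltW.
  by rewrite mulr_ge0// sqr_ge0.
have t3 : pi * \int[mu]_(x in box M) mollify d (fun z => W z * L z) x <=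
    pi * \int[mu]_(z in box (M + d)) (W z * L z).
  apply: ler_wpM2l; first exact: pi_ge0.
  by apply: (integral_mollify_le d0 M lWL) => z; exact: mulr_ge0.
have t4 : a3 * \int[mu]_(x in box M) (s x * gr x) <= a3 * Hs.
  by apply: ler_wpM2l => //; rewrite /a3 mulr_ge0// sqr_ge0.
apply: le_trans (lerD t1 (lerD t2 (lerD t3 t4))) _.
by rewrite le_eqVlt; apply/orP; left; apply/eqP; rewrite /a1 /a2 /a3 /CE /W; ring.
Qed.

End radius.

End flow.

Section energy.
Variable R : realType.
Local Notation R2 := (measurableTypeR R * measurableTypeR R)%type.
Local Notation mu := (@plane R).
Implicit Types (x z : R * R) (f g : R * R -> R) (d E : R).

(* What the argument uses of a solution, with [Ai], [Bi] the weak derivatives of [v1], [v2]; the field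
   [flow_vort] is the vorticity equation in the form [div (v1 grad v2 - v2 grad v1) = 0]. *)
Record flow_data (v1 v2 A1 A2 B1 B2 : R * R -> R) : Prop := FlowData {
  flow_cont1 : continuous v1;
  flow_cont2 : continuous v2;
  flow_mA1 : measurable_fun setT (A1 : R2 -> R);
  flow_mA2 : measurable_fun setT (A2 : R2 -> R);
  flow_mB1 : measurable_fun setT (B1 : R2 -> R);
  flow_mB2 : measurable_fun setT (B2 : R2 -> R);
  flow_lA1 : locint (fun z => A1 z ^+ 2);
  flow_lA2 : locint (fun z => A2 z ^+ 2);
  flow_lB1 : locint (fun z => B1 z ^+ 2);
  flow_lB2 : locint (fun z => B2 z ^+ 2);
  flow_grad1 : mweak v1 A1 A2;
  flow_grad2 : mweak v2 B1 B2;
  flow_div : forall D p q, csmooth D p -> csmooth D q -> forall x,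
    conv v1 (derive1 p) q x + conv v2 p (derive1 q) x = 0;
  flow_vort : forall D p q, csmooth D p -> csmooth D q -> forall x,
    conv (fun z => v1 z * B1 z - v2 z * A1 z) (derive1 p) q x +
    conv (fun z => v1 z * B2 z - v2 z * A2 z) p (derive1 q) x = 0 }.

Lemma Rintegral_box_le f (M M' : R) : M <= M' -> locint f -> (forall z, 0 <= f z) ->
  \int[mu]_(z in box M) f z <= \int[mu]_(z in box M') f z.
Proof.
move=> MM [mf lf] f0; apply: fine_le.
- by apply: integrable_fin_num => //; exact: measurable_box.
- by apply: integrable_fin_num => //; exact: measurable_box.
apply: ge0_subset_integral.
- exact: measurable_box.
- exact: measurable_box.
- exact: (measurable_int _ (lf M')).
- by move=> z _; rewrite lee_fin; exact: f0.
- exact: box_sub.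
Qed.

Variables (v1 v2 A1 A2 B1 B2 : R * R -> R).
Hypothesis fd : flow_data v1 v2 A1 A2 B1 B2.

(** [Psi] is the larger of the distance-like slit quantity and [E / 2 - s]. It is positive along [v]
    everywhere, hence bounded below on the box, hence still positive along a fine mollification;
    from level [E] on its second entry is negative, so the first must be positive. *)
Lemma flow_off_slit (e1 e2 E M : R) : 0 < E ->
  (forall x, 0 < v1 x ^+ 2 + v2 x ^+ 2 ->
     0 < Num.sqrt (v1 x ^+ 2 + v2 x ^+ 2) + (v1 x * e1 + v2 x * e2)) ->
  exists2 d0, 0 < d0 & forall d x, 0 < d -> d <= d0 -> box M x ->
    off_slit E e1 e2 (mollify d v1 x) (mollify d v2 x).
Proof.
move=> E0 slit.
pose Psi (y : R * R) := Num.max (Num.sqrt (y.1 ^+ 2 + y.2 ^+ 2) + (y.1 * e1 + y.2 * e2)) (E / 2 - (y.1 ^+ 2 + y.2 ^+ 2)).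
have cPsi y : cont_at Psi y.
  have c1 := @cont_at_fst R y; have c2 := @cont_at_snd R y.
  have cs : cont_at (fun y : R * R => y.1 ^+ 2 + y.2 ^+ 2) y by apply: cont_atD; exact: cont_atX.
  apply: cont_at_max; last by apply: cont_atB => //; exact: cont_at_cst.
  apply: cont_atD.
    by apply: (@cont_at_comp1 _ _ (fun y : R * R => y.1 ^+ 2 + y.2 ^+ 2) Num.sqrt) => //; exact: sqrt_continuous.
  by apply: cont_atD; apply: cont_atM => //; exact: cont_at_cst.
have Psi0 x : 0 < Psi (v1 x, v2 x).
  rewrite /Psi /= lt_max; have [h|h] := ltP 0 (E / 2 - (v1 x ^+ 2 + v2 x ^+ 2)); first by rewrite orbT.
  rewrite slit//; have : 0 < E / 2 by rewrite divr_gt0.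
  by lra.
have cv : forall x, cont_at (fun x => Psi (v1 x, v2 x)) x.
  by move=> x; apply: cont_at_comp2; [exact: (flow_cont1 fd)|exact: (flow_cont2 fd)|exact: cPsi].
(* A positive lower bound for a positive continuous function on a compact set, obtained as an upper
   bound for its inverse. *)
have [B B0 hB] : exists2 B, 0 < B & forall x, box M x -> `|(Psi (v1 x, v2 x))^-1| <= B.
  apply: (@compact_cont_bounded R _ (box M) (fun x => (Psi (v1 x, v2 x))^-1)); first exact: compact_rect.
  by move=> x _; apply: cont_atV; [exact: lt0r_neq0|exact: cv].
have iB : 0 < B^-1 by rewrite invr_gt0.
have [d0 d00 hd] := mollify_unif M (flow_cont1 fd) (flow_cont2 fd) (cont_atW cPsi) iB.
exists d0 => // d x dp dd bx.
have n0 (a : R) : `|a - a| <= d by rewrite subrr normr0 ltW.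
have := hd d x x dp dd bx (n0 _) (n0 _).
have Bx : B^-1 <= Psi (v1 x, v2 x).
  have := hB x bx; rewrite ger0_norm ?invr_ge0 ?(ltW (Psi0 x))// => h.
  by rewrite -[leRHS]invrK lef_pV2 ?posrE ?invr_gt0.
rewrite ltr_norml => /andP[h _].
have : 0 < Psi (mollify d v1 x, mollify d v2 x) by lra.
rewrite /Psi /= lt_max => /orP[h1 _|h2 Es]; first exact: h1.
by exfalso; move: Es h2 E0; lra.
Qed.

(** The right side of [mollified_energy] is split into four errors of at most [tau / 16] each:
    cutoff, truncation, and two from mollification. The factor [1/2] on the left then leaves
    [tau / 2]. The extra 1 in the growth hypothesis is the room taken by mollification. *)
Theorem energy_small (e1 e2 C : R) (n0 : nat) (M0 c tau : R) : e1 ^+ 2 + e2 ^+ 2 = 1 ->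
  (forall x, 0 < v1 x ^+ 2 + v2 x ^+ 2 ->
     0 < Num.sqrt (v1 x ^+ 2 + v2 x ^+ 2) + (v1 x * e1 + v2 x * e2)) ->
  0 < C ->
  (forall j x, (n0 <= j)%N -> box (2 * 2 ^+ j.+1 + 1) x -> v1 x ^+ 2 + v2 x ^+ 2 <= C * j.+1%:R) ->
  0 < c -> 0 < tau ->
  exists E d0, [/\ 0 < E, E <= c, 0 < d0 & forall d, 0 < d -> d <= d0 ->
    \int[mu]_(x in box M0) (chi E (mollify d v1 x ^+ 2 + mollify d v2 x ^+ 2) *
      ((mollify d v1 x * mollify d B1 x - mollify d v2 x * mollify d A1 x) ^+ 2 +
       (mollify d v1 x * mollify d B2 x - mollify d v2 x * mollify d A2 x) ^+ 2) /
      (mollify d v1 x ^+ 2 + mollify d v2 x ^+ 2)) <= tau].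
Proof.
move=> he slit C0 growth c0 tau0.
have [cv1 cv2] := (flow_cont1 fd, flow_cont2 fd).
have pi0 : 0 < pi :> R by exact: pi_gt0.
have pi2 : 0 < pi ^+ 2 :> R by rewrite exprn_gt0.
(* Chosen so that the cutoff error [2 * pi^2 * kappa] is [tau / 16]. *)
pose kappa := tau / (32 * pi ^+ 2).
have kappa0 : 0 < kappa by rewrite divr_gt0// mulr_gt0.
have [M [h [h1 [h2 [[Mp M0M] [ch ch1 ch2] [dh1 dh2] [h01 h1box hsupp] hs]]]]] := log_cutoff n0 M0 C0 kappa0.
pose s z := v1 z ^+ 2 + v2 z ^+ 2.
have cs z : cont_at s z by apply: cont_atD; apply: cont_atX; [exact: cv1|exact: cv2].
have s0 z : 0 <= s z by rewrite addr_ge0 ?sqr_ge0.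
pose L z := A1 z ^+ 2 + A2 z ^+ 2 + B1 z ^+ 2 + B2 z ^+ 2.
have lL : locint L.
  apply: locintD (flow_lB2 fd); apply: locintD (flow_lB1 fd).
  exact: locintD (flow_lA1 fd) (flow_lA2 fd).
have L0 z : 0 <= L z by rewrite !addr_ge0 ?sqr_ge0.
pose IL := \int[mu]_(z in box (M + 1)) L z.
have IL0 : 0 <= IL by apply: Rintegral_ge0 => z _; exact: L0.
have e10 : 0 < tau / (16 * pi) by rewrite divr_gt0// mulr_gt0.
(* The box is enlarged by 1 because the final integrals extend over [box (M + d)] with [d <= 1]. *)
have [E [E0 Ec hE]] := integral_sdchi_small (M + 1) (cont_atW cs) s0 lL L0 e10 c0.
pose H := \int[mu]_(x in box M) (h1 x ^+ 2 + h2 x ^+ 2).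
have H0 : 0 <= H by apply: Rintegral_ge0 => x _; rewrite addr_ge0 ?sqr_ge0.
pose CE := 1 + (72 * pi ^+ 2 + 2) / E : R.
have CE0 : 0 <= CE by rewrite addr_ge0// divr_ge0 ?(ltW E0)// addr_ge0// mulr_ge0// ltW.
pose X := CE * IL + 4 * pi ^+ 2 * H.
have X0 : 0 <= X by rewrite addr_ge0// mulr_ge0// mulr_ge0// ltW.
(* [X] collects everything multiplied by the oscillation bound; adding 1 keeps the quotient
   meaningful when [X] is 0. *)
pose om := tau / (16 * (X + 1)).
have X1 : 0 < X + 1 by rewrite ltr_wpDl.
have om0 : 0 < om by rewrite divr_gt0// mulr_gt0.
have omX : om * X <= tau / 16.
  have -> : om * X = (tau / 16) * (X / (X + 1)) by rewrite /om; field; exact: lt0r_neq0.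
  rewrite ler_piMr ?divr_ge0 ?(ltW tau0)// ler_pdivrMr// mul1r lerDl//.
have IL1 : 0 < IL + 1 by rewrite ltr_wpDl.
(* The admissible change of the truncation weight under mollification, scaled by its total cost
   [pi * IL]. *)
pose t' := tau / (16 * pi * (IL + 1)).
have t'0 : 0 < t' by rewrite divr_gt0// mulr_gt0// mulr_gt0.
have t'IL : pi * (t' * IL) <= tau / 16.
  have alg (a b t k : R) : a != 0 -> b != 0 -> a * (t / (16 * a * b) * k) = t / 16 * (k / b).
    by move=> a0 b0; field; rewrite a0 b0.
  rewrite (alg pi (IL + 1) tau IL) ?lt0r_neq0//.
  rewrite ler_piMr ?divr_ge0 ?(ltW tau0)// ler_pdivrMr// mul1r lerDl//.
pose Pw (y : R * R) := (y.1 ^+ 2 + y.2 ^+ 2) * dchi E (y.1 ^+ 2 + y.2 ^+ 2).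
have cPw y : cont_at Pw y.
  apply: (@cont_at_sdchi R _ E (fun y : R * R => y.1 ^+ 2 + y.2 ^+ 2)) => //.
  by apply: cont_atD; apply: cont_atX; [exact: cont_at_fst|exact: cont_at_snd].
have [da da0 hda] := mollify_unif M cv1 cv2 (cont_atW (@cont_at_fst R)) om0.
have [db db0 hdb] := mollify_unif M cv1 cv2 (cont_atW (@cont_at_snd R)) om0.
have [dc dc0 hdc] := mollify_unif M cv1 cv2 (cont_atW cPw) t'0.
have [dd dd0 hdd] := flow_off_slit M E0 slit.
exists E, (Num.min 1 (Num.min da (Num.min db (Num.min dc dd)))); split => //.
  by rewrite !lt_min ltr01 da0 db0 dc0.
move=> d d0; rewrite !le_min => /andP[d1 /andP[dda /andP[ddb /andP[ddc ddd]]]].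
have os x : box M x -> off_slit E e1 e2 (mollify d v1 x) (mollify d v2 x) by exact: hdd.
have cu x : cont_at (mollify d v1) x by exact: (mollify_continuous d0 (cont_locint cv1)).
have cw x : cont_at (mollify d v2) x by exact: (mollify_continuous d0 (cont_locint cv2)).
pose su x := mollify d v1 x ^+ 2 + mollify d v2 x ^+ 2.
have csu x : cont_at su x by apply: cont_atD; exact: cont_atX.
have hyp x z : box M x -> `|x.1 - z.1| <= d -> `|x.2 - z.2| <= d ->
    [/\ `|mollify d v1 x - v1 z| <= om, `|mollify d v2 x - v2 z| <= om &
     su x * dchi E (su x) <= s z * dchi E (s z) + t'].
  move=> bx z1 z2; split.
  - exact: ltW (hda d x z d0 dda bx z1 z2).
  - exact: ltW (hdb d x z d0 ddb bx z1 z2).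
  - have := hdc d x z d0 ddc bx z1 z2; rewrite ltr_distl => /andP[_ /ltW].
    by rewrite /Pw /=.
have lv1 : locint (fun z => v1 z ^+ 2).
  by apply: cont_locint; apply: cont_atW => z; apply: cont_atX; exact: cv1.
have lv2 : locint (fun z => v2 z ^+ 2).
  by apply: cont_locint; apply: cont_atW => z; apply: cont_atX; exact: cv2.
(* The cutoff estimate is applied to the mollified speed, which inherits the growth bound by
   Jensen. *)
have hHs : \int[mu]_(x in box M) (su x * (h1 x ^+ 2 + h2 x ^+ 2)) <= kappa.
  apply: hs; [exact: cont_atW csu|by move=> x; rewrite addr_ge0 ?sqr_ge0|].
  move=> j x nj bx; apply: le_trans (lerD (mollify_jensen d0 x (cont_locint cv1) lv1)
    (mollify_jensen d0 x (cont_locint cv2) lv2)) _.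
  rewrite -(mollifyD d0 x lv1 lv2) -[leRHS](mollify_cst d0 _ x).
  apply: le_mollify => //; [exact: cont_locint (cont_atW cs)|exact: locint_cst|].
  move=> z z1 z2; apply: growth => //.
  apply: box_sub (box_near bx z1 z2); exact: lerD.
have main := @mollified_energy R v1 v2 A1 A2 B1 B2 cv1 cv2 (flow_mA1 fd) (flow_mA2 fd) (flow_mB1 fd) (flow_mB2 fd)
  (flow_lA1 fd) (flow_lA2 fd) (flow_lB1 fd) (flow_lB2 fd) (flow_grad1 fd) (flow_grad2 fd) (flow_vort fd)
  d d0 E e1 e2 M h h1 h2 E0 he Mp os ch ch1 ch2 dh1 dh2 h01 hsupp om t' H kappa om0 (ltW t'0) hyp (lexx H) hHs.
have lW : locint (fun z => s z * dchi E (s z) * L z).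
  have cW : continuous (fun z => s z * dchi E (s z)) by apply: cont_atW => z; exact: cont_at_sdchi.
  by have := locintM_cont lL cW; congr locint; apply/funext => z; rewrite mulrC.
have W0 z : 0 <= s z * dchi E (s z) * L z by rewrite mulr_ge0// sdchi_ge0.
have Md : M + d <= M + 1 by rewrite lerD2l.
have b1 : \int[mu]_(z in box (M + d)) L z <= IL by exact: Rintegral_box_le.
have b2 : \int[mu]_(z in box (M + d)) ((s z * dchi E (s z) + t') * L z) <= tau / (16 * pi) + t' * IL.
  under eq_Rintegral do rewrite mulrDl.
  rewrite (RintegralD (measurable_box _) (lW.2 _) ((locintZ t' lL).2 _)) (RintegralZl _ (measurable_box _) (lL.2 _)).
  apply: lerD; first by apply: le_trans (Rintegral_box_le Md lW W0) hE.
  by apply: ler_wpM2l => //; exact: ltW.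
pose G x := chi E (su x) *
     ((mollify d v1 x * mollify d B1 x - mollify d v2 x * mollify d A1 x) ^+ 2 +
      (mollify d v1 x * mollify d B2 x - mollify d v2 x * mollify d A2 x) ^+ 2) / su x.
have cm f : locint f -> forall x, cont_at (mollify d f) x.
  by move=> lf x; exact: (mollify_continuous d0 lf).
have cB1 := cm _ (locint_sq (flow_mB1 fd) (flow_lB1 fd)).
have cB2 := cm _ (locint_sq (flow_mB2 fd) (flow_lB2 fd)).
have cA1 := cm _ (locint_sq (flow_mA1 fd) (flow_lA1 fd)).
have cA2 := cm _ (locint_sq (flow_mA2 fd) (flow_lA2 fd)).
have cG x : cont_at (fun x => G x * h x ^+ 2) x.
  apply: (@cont_at_ext _ _ (fun x => (chi E (su x) / su x) *
     (((mollify d v1 x * mollify d B1 x - mollify d v2 x * mollify d A1 x) ^+ 2 +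
      (mollify d v1 x * mollify d B2 x - mollify d v2 x * mollify d A2 x) ^+ 2) * h x ^+ 2))).
    by move=> y; rewrite /G; ring.
  apply: cont_atM; first exact: cont_at_chi_div.
  apply: cont_atM; last by apply: cont_atX; exact: ch.
  by apply: cont_atD; apply: cont_atX; apply: cont_atB; exact: cont_atM.
have su0 x : 0 <= su x by rewrite addr_ge0 ?sqr_ge0.
have FE : \int[mu]_(x in box M0) G x <= \int[mu]_(x in box M) (G x * h x ^+ 2).
  have -> : \int[mu]_(x in box M0) G x = \int[mu]_(x in box M0) (G x * h x ^+ 2).
    by apply: eq_Rintegral => x; rewrite inE => bx; rewrite h1box// expr1n mulr1.
  apply: (Rintegral_rect_subset (box_sub M0M)) => // z _.
  apply: mulr_ge0; last exact: sqr_ge0.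
  rewrite /G; apply: divr_ge0 => //; apply: mulr_ge0; first exact: chi_ge0.
  by rewrite addr_ge0 ?sqr_ge0.
apply: (le_trans FE).
move: main; rewrite -[X in 2^-1 * X]/(\int[mu]_(x in box M) (G x * h x ^+ 2)) -/CE -/(L _).
have p1 : om * CE * \int[mu]_(z in box (M + d)) L z <= om * (CE * IL).
  by rewrite -mulrA; apply: ler_wpM2l; [exact: ltW|exact: ler_wpM2l].
have p2 := ler_wpM2l (pi_ge0 R) b2.
have p3 : pi * (tau / (16 * pi) + t' * IL) = tau / 16 + pi * (t' * IL).
  have alg (a t k : R) : a != 0 -> a * (t / (16 * a) + k) = t / 16 + a * k by move=> a0; field.
  by rewrite (alg pi) ?lt0r_neq0.
have p4 : 2 * pi ^+ 2 * kappa = tau / 16.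
  have alg (a t : R) : a != 0 -> 2 * a ^+ 2 * (t / (32 * a ^+ 2)) = t / 16 by move=> a0; field.
  by rewrite /kappa (alg pi) ?lt0r_neq0.
have p5 : om * X = om * (CE * IL) + 4 * pi ^+ 2 * om * H by rewrite /X; ring.
rewrite p4; rewrite p3 in p2; rewrite p5 in omX.
set Y := \int[mu]_(x in box M) _ => main.
have {}main : 2^-1 * Y <= om * (CE * IL) + 4 * pi ^+ 2 * om * H + (tau / 16 + pi * (t' * IL)) + tau / 16.
  apply: le_trans main _; apply: lerD => //; apply: lerD; last exact: p2.
  by apply: lerD.
by move: main omX t'IL tau0; clear; lra.
Qed.

End energy.

(** * Local structure of the flow *)

Section small_gradients.
Variable R : realType.
Local Notation R2 := (measurableTypeR R * measurableTypeR R)%type.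
Local Notation mu := (@plane R).
Local Notation leb := (@lebesgue_measure R).

Lemma pick_interval (g : R -> R) (c d y0 k : R) : c < d -> c <= y0 <= d -> 0 < k ->
  cont_at g y0 -> exists c' d', [/\ c <= c', d' <= d, c' < d' &
    forall y, c' <= y <= d' -> `|g y - g y0| <= k].
Proof.
move=> cd /andP[cy yd] k0 cg.
have /cvgrPdist_le := cg => /(_ _ k0) /nbhs_ballP [rho /= rho0 hrho].
exists (Num.max c (y0 - rho / 2)), (Num.min d (y0 + rho / 2)).
have r2 : 0 < rho / 2 by rewrite divr_gt0.
split.
- by rewrite le_max lexx.
- by rewrite ge_min lexx.
- rewrite lt_min !gt_max cd /=; apply/and3P; split; move: cy yd r2 cd; lra.
- move=> y; rewrite ge_max le_min => /andP[/andP[_ h1] /andP[_ h2]].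
  by rewrite distrC; apply: hrho; rewrite /ball/= ltr_distl; apply/andP; split; move: h1 h2 rho0; lra.
Qed.

Lemma rect_gap1 (Phi f : R * R -> R) (a b c d k : R) : a < b -> c < d ->
  (forall z, rect a b c d z -> cont_at Phi z) ->
  (forall z, rect a b c d z -> cont_at f z) ->
  (forall z, rect a b c d z -> has_der (fun t => Phi (t, z.2)) z.1 (f z)) ->
  (forall y, c <= y <= d -> k <= Phi (b, y) - Phi (a, y)) ->
  k * (d - c) <= \int[mu]_(z in rect a b c d) f z.
Proof.
move=> ab cd cP cf hf hk; rewrite (rect_ftc1 ab cf hf).
have mcd : measurable (`[c, d]%classic : set (measurableTypeR R)) by exact: measurable_itv.
have cg y : c <= y <= d -> cont_at (fun y => Phi (b, y) - Phi (a, y)) y.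
  have aa : a <= a <= b by rewrite lexx ltW.
  have bb : a <= b <= b by rewrite lexx ltW.
  move=> cyd; apply: cont_atB; apply: (@cont_at_comp2 _ _ _ (fun y => y));
    [exact: cont_at_cst|exact: cvg_id|by apply: cP|exact: cont_at_cst|exact: cvg_id|by apply: cP].
have ig : leb.-integrable `[c, d] (EFin \o (fun y => Phi (b, y) - Phi (a, y))).
  apply: continuous_compact_integrable; first exact: segment_compact.
  by apply: continuous_in_subspaceT => y; rewrite inE/= in_itv/=; exact: cg.
have ic : leb.-integrable `[c, d] (EFin \o (fun _ : R => k)).
  apply: continuous_compact_integrable; first exact: segment_compact.
  by apply: continuous_in_subspaceT => y _; exact: cont_at_cst.
have := le_Rintegral mcd ic ig; rewrite Rintegral_cst//= lebesgue_measure_itv/= lte_fin cd -EFinB /=.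
by apply=> y; rewrite /= in_itv/=; exact: hk.
Qed.

(** If the values at the two ends differed for one [y0], they would differ by a definite amount for
    all [y] in a small interval. Each approximant would then have an average slope there,
    contradicting arbitrarily small energy. *)
Lemma small_gradient_eq1 (T : R * R -> R) (a b c d : R) : a < b -> c < d -> continuous T ->
  (forall e, 0 < e -> exists Phi f : R * R -> R,
    [/\ forall z, rect a b c d z -> `|Phi z - T z| <= e,
        forall z, rect a b c d z -> cont_at Phi z,
        forall z, rect a b c d z -> cont_at f z,
        forall z, rect a b c d z -> has_der (fun t => Phi (t, z.2)) z.1 (f z) &
        \int[mu]_(z in rect a b c d) (f z ^+ 2) <= e]) ->
  forall y, c <= y <= d -> T (b, y) = T (a, y).
Proof.
move=> ab cd cT hT y0 y0cd; apply/eqP/negPn/negP => neq.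
pose g y := T (b, y) - T (a, y).
have cg y : cont_at g y.
  by apply: cont_atB; apply: (@cont_at_comp2 _ _ _ (fun y => y)); [exact: cont_at_cst|exact: cvg_id|exact: cT|exact: cont_at_cst|exact: cvg_id|exact: cT].
have [sg [sg2 sgg]] : exists sg : R, sg ^+ 2 = 1 /\ 0 < sg * g y0.
  have [g0|g0|g0] := ltgtP (g y0) 0.
  - by exists (-1); split; [rewrite sqrrN expr1n|rewrite mulN1r oppr_gt0].
  - by exists 1; split; [rewrite expr1n|rewrite mul1r].
  - by move: neq; rewrite -subr_eq0 -/(g y0) g0 eqxx.
have nsg : `|sg| = 1.
  by apply/eqP; rewrite -(@eqrXn2 _ 2)// -normrX sg2 normr1 expr1n.
(* One third of the gap is lost to the variation of [g] in [y], one third to the two approximation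
   errors of at most [k / 2], and one third survives. *)
pose k := sg * g y0 / 3.
have k0 : 0 < k by rewrite divr_gt0.
have [c' [d' [cc' dd' c'd' hg]]] := pick_interval cd y0cd k0 (cg y0).
have ba : 0 < b - a by rewrite subr_gt0.
have dc' : 0 < d' - c' by rewrite subr_gt0.
(* The weight in Young's inequality for which the constant term, integrated over the rectangle, is
   half of the forced slope integral [k * (d' - c')]. *)
pose lam := (b - a) / (2 * k).
have lam0 : 0 < lam by rewrite divr_gt0// mulr_gt0.
(* The second entry makes the energy term at most a quarter of the slope integral, so that a half
   and a quarter cannot add up to the whole. *)
pose e := Num.min (k / 2) (k * (d' - c') / (4 * lam)).
have e0 : 0 < e by rewrite lt_min !divr_gt0// mulr_gt0.
have ek : e <= k / 2 by rewrite /e ge_min lexx.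
have el : e <= k * (d' - c') / (4 * lam) by rewrite /e ge_min lexx orbT.
have [Phi [f [PT cP cf hf If]]] := hT e e0.
have sub : rect a b c' d' `<=` rect a b c d.
  exact: rect_sub.
have aa : a <= a <= b by rewrite lexx ltW.
have bb : a <= b <= b by rewrite lexx ltW.
have gap : k * (d' - c') <= \int[mu]_(z in rect a b c' d') (sg * f z).
  apply: (@rect_gap1 (fun z => sg * Phi z)) => //.
  - by move=> z /sub zr; apply: cont_atM; [exact: cont_at_cst|exact: cP].
  - by move=> z /sub zr; apply: cont_atM; [exact: cont_at_cst|exact: cf].
  - by move=> z /sub zr; apply: has_derZ; exact: hf.
  move=> y /andP[cy yd].
  have ycd : c <= y <= d by rewrite (le_trans cc')//= (le_trans yd).
  have h1 : `|Phi (b, y) - T (b, y)| <= e by apply: PT; split.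
  have h2 : `|Phi (a, y) - T (a, y)| <= e by apply: PT; split.
  have h3 : `|g y - g y0| <= k by apply: hg; rewrite cy yd.
  have s1 : `|sg * (Phi (b, y) - T (b, y))| <= e by rewrite normrM nsg mul1r.
  have s2 : `|sg * (Phi (a, y) - T (a, y))| <= e by rewrite normrM nsg mul1r.
  have s3 : `|sg * (g y - g y0)| <= k by rewrite normrM nsg mul1r.
  move: s1 s2 s3 ek; rewrite !ler_norml => /andP[l1 r1] /andP[l2 r2] /andP[l3 r3] ek.
  have e3 : sg * g y0 = 3 * k by rewrite /k; field.
  by rewrite /g !mulrBr in l1 r1 l2 r2 l3 r3 e3 *; move: l1 r1 l2 r2 l3 r3 e3 ek; clear; lra.
have csq z : rect a b c' d' z -> cont_at (fun z => lam * f z ^+ 2) z.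
  by move=> /sub zr; apply: cont_atM; [exact: cont_at_cst|apply: cont_atX; exact: cf].
have csq' z : rect a b c' d' z -> cont_at (fun z => f z ^+ 2) z.
  by move=> /sub zr; apply: cont_atX; exact: cf.
have mr : measurable (rect a b c' d' : set R2) by exact: measurable_rect.
have i1 : mu.-integrable (rect a b c' d') (EFin \o (fun z => sg * f z)).
  by apply: cont_integrable => z /sub zr; apply: cont_atM; [exact: cont_at_cst|exact: cf].
have i2 : mu.-integrable (rect a b c' d') (EFin \o (fun z => lam * f z ^+ 2)) by exact: cont_integrable.
have i2' : mu.-integrable (rect a b c' d') (EFin \o (fun z => f z ^+ 2)) by exact: cont_integrable.
have i3 : mu.-integrable (rect a b c' d') (EFin \o (fun _ : R * R => (4 * lam)^-1)).
  by apply: cont_integrable => z _; exact: cont_at_cst.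
have i23 : mu.-integrable (rect a b c' d') (EFin \o (fun z => lam * f z ^+ 2 + (4 * lam)^-1)).
  by apply: cont_integrable => z zr; apply: cont_atD; [exact: csq|exact: cont_at_cst].
have young z : sg * f z <= lam * f z ^+ 2 + (4 * lam)^-1.
  have -> : lam * f z ^+ 2 + (4 * lam)^-1 = lam * (f z - sg / (2 * lam)) ^+ 2 + sg * f z.
    have -> : lam * (f z - sg / (2 * lam)) ^+ 2 = lam * f z ^+ 2 - sg * f z + sg ^+ 2 / (4 * lam).
      by field; exact: lt0r_neq0.
    by rewrite sg2 mul1r; ring.
  by rewrite lerDr mulr_ge0 ?sqr_ge0// ltW.
have up := le_Rintegral mr i1 i23 (fun z _ => young z).
rewrite (RintegralD mr i2 i3) (RintegralZl _ mr i2') Rintegral_cst// /plane (lebesgue2_rect (ltW ab) (ltW c'd')) /= in up.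
have Isub : \int[mu]_(z in rect a b c' d') (f z ^+ 2) <= e.
  apply: le_trans If; apply: Rintegral_rect_subset => //.
    by move=> z zr; apply: cont_atX; exact: cf.
  by move=> z _; exact: sqr_ge0.
have {}Isub := ler_wpM2l (ltW lam0) Isub.
have el' := ler_wpM2l (ltW lam0) el.
have e4 : lam * (k * (d' - c') / (4 * lam)) = k * (d' - c') / 4 by field; exact: lt0r_neq0.
have e5 : (4 * lam)^-1 * ((b - a) * (d' - c')) = k * (d' - c') / 2.
  have alg (x y w : R) : x != 0 -> y != 0 -> (4 * (x / (2 * y)))^-1 * (x * w) = y * w / 2.
    by move=> x0 y0'; field; rewrite x0 y0'.
  by rewrite /lam alg ?lt0r_neq0.
rewrite e5 in up; rewrite e4 in el'.
have kd : 0 < k * (d' - c') by rewrite mulr_gt0.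
by have := le_trans gap up; move: Isub el' kd; rewrite /plane; clear; lra.
Qed.

Lemma rect_gap2 (Phi f : R * R -> R) (a b c d k : R) : a < b -> c < d ->
  (forall z, rect c d a b z -> cont_at Phi z) ->
  (forall z, rect c d a b z -> cont_at f z) ->
  (forall z, rect c d a b z -> has_der (fun t => Phi (z.1, t)) z.2 (f z)) ->
  (forall y, c <= y <= d -> k <= Phi (y, b) - Phi (y, a)) ->
  k * (d - c) <= \int[mu]_(z in rect c d a b) f z.
Proof.
move=> ab cd cP cf hf hk; rewrite (rect_ftc2 ab cf hf).
have mcd : measurable (`[c, d]%classic : set (measurableTypeR R)) by exact: measurable_itv.
have cg y : c <= y <= d -> cont_at (fun y => Phi (y, b) - Phi (y, a)) y.
  have aa : a <= a <= b by rewrite lexx ltW.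
  have bb : a <= b <= b by rewrite lexx ltW.
  move=> cyd; apply: cont_atB; apply: (@cont_at_comp2 _ _ (fun y => y));
    [exact: cvg_id|exact: cont_at_cst|by apply: cP|exact: cvg_id|exact: cont_at_cst|by apply: cP].
have ig : leb.-integrable `[c, d] (EFin \o (fun y => Phi (y, b) - Phi (y, a))).
  apply: continuous_compact_integrable; first exact: segment_compact.
  by apply: continuous_in_subspaceT => y; rewrite inE/= in_itv/=; exact: cg.
have ic : leb.-integrable `[c, d] (EFin \o (fun _ : R => k)).
  apply: continuous_compact_integrable; first exact: segment_compact.
  by apply: continuous_in_subspaceT => y _; exact: cont_at_cst.
have := le_Rintegral mcd ic ig; rewrite Rintegral_cst//= lebesgue_measure_itv/= lte_fin cd -EFinB /=.
by apply=> y; rewrite /= in_itv/=; exact: hk.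
Qed.

(** The argument of [small_gradient_eq1] with the two coordinates exchanged. *)
Lemma small_gradient_eq2 (T : R * R -> R) (a b c d : R) : a < b -> c < d -> continuous T ->
  (forall e, 0 < e -> exists Phi f : R * R -> R,
    [/\ forall z, rect c d a b z -> `|Phi z - T z| <= e,
        forall z, rect c d a b z -> cont_at Phi z,
        forall z, rect c d a b z -> cont_at f z,
        forall z, rect c d a b z -> has_der (fun t => Phi (z.1, t)) z.2 (f z) &
        \int[mu]_(z in rect c d a b) (f z ^+ 2) <= e]) ->
  forall y, c <= y <= d -> T (y, b) = T (y, a).
Proof.
move=> ab cd cT hT y0 y0cd; apply/eqP/negPn/negP => neq.
pose g y := T (y, b) - T (y, a).
have cg y : cont_at g y.
  by apply: cont_atB; apply: (@cont_at_comp2 _ _ (fun y => y)); [exact: cvg_id|exact: cont_at_cst|exact: cT|exact: cvg_id|exact: cont_at_cst|exact: cT].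
have [sg [sg2 sgg]] : exists sg : R, sg ^+ 2 = 1 /\ 0 < sg * g y0.
  have [g0|g0|g0] := ltgtP (g y0) 0.
  - by exists (-1); split; [rewrite sqrrN expr1n|rewrite mulN1r oppr_gt0].
  - by exists 1; split; [rewrite expr1n|rewrite mul1r].
  - by move: neq; rewrite -subr_eq0 -/(g y0) g0 eqxx.
have nsg : `|sg| = 1.
  by apply/eqP; rewrite -(@eqrXn2 _ 2)// -normrX sg2 normr1 expr1n.
pose k := sg * g y0 / 3.
have k0 : 0 < k by rewrite divr_gt0.
have [c' [d' [cc' dd' c'd' hg]]] := pick_interval cd y0cd k0 (cg y0).
have ba : 0 < b - a by rewrite subr_gt0.
have dc' : 0 < d' - c' by rewrite subr_gt0.
pose lam := (b - a) / (2 * k).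
have lam0 : 0 < lam by rewrite divr_gt0// mulr_gt0.
pose e := Num.min (k / 2) (k * (d' - c') / (4 * lam)).
have e0 : 0 < e by rewrite lt_min !divr_gt0// mulr_gt0.
have ek : e <= k / 2 by rewrite /e ge_min lexx.
have el : e <= k * (d' - c') / (4 * lam) by rewrite /e ge_min lexx orbT.
have [Phi [f [PT cP cf hf If]]] := hT e e0.
have sub : rect c' d' a b `<=` rect c d a b.
  exact: rect_sub.
have aa : a <= a <= b by rewrite lexx ltW.
have bb : a <= b <= b by rewrite lexx ltW.
have gap : k * (d' - c') <= \int[mu]_(z in rect c' d' a b) (sg * f z).
  apply: (@rect_gap2 (fun z => sg * Phi z)) => //.
  - by move=> z /sub zr; apply: cont_atM; [exact: cont_at_cst|exact: cP].
  - by move=> z /sub zr; apply: cont_atM; [exact: cont_at_cst|exact: cf].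
  - by move=> z /sub zr; apply: has_derZ; exact: hf.
  move=> y /andP[cy yd].
  have ycd : c <= y <= d by rewrite (le_trans cc')//= (le_trans yd).
  have h1 : `|Phi (y, b) - T (y, b)| <= e by apply: PT; split.
  have h2 : `|Phi (y, a) - T (y, a)| <= e by apply: PT; split.
  have h3 : `|g y - g y0| <= k by apply: hg; rewrite cy yd.
  have s1 : `|sg * (Phi (y, b) - T (y, b))| <= e by rewrite normrM nsg mul1r.
  have s2 : `|sg * (Phi (y, a) - T (y, a))| <= e by rewrite normrM nsg mul1r.
  have s3 : `|sg * (g y - g y0)| <= k by rewrite normrM nsg mul1r.
  move: s1 s2 s3 ek; rewrite !ler_norml => /andP[l1 r1] /andP[l2 r2] /andP[l3 r3] ek.
  have e3 : sg * g y0 = 3 * k by rewrite /k; field.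
  by rewrite /g !mulrBr in l1 r1 l2 r2 l3 r3 e3 *; move: l1 r1 l2 r2 l3 r3 e3 ek; clear; lra.
have csq z : rect c' d' a b z -> cont_at (fun z => lam * f z ^+ 2) z.
  by move=> /sub zr; apply: cont_atM; [exact: cont_at_cst|apply: cont_atX; exact: cf].
have csq' z : rect c' d' a b z -> cont_at (fun z => f z ^+ 2) z.
  by move=> /sub zr; apply: cont_atX; exact: cf.
have mr : measurable (rect c' d' a b : set R2) by exact: measurable_rect.
have i1 : mu.-integrable (rect c' d' a b) (EFin \o (fun z => sg * f z)).
  by apply: cont_integrable => z /sub zr; apply: cont_atM; [exact: cont_at_cst|exact: cf].
have i2 : mu.-integrable (rect c' d' a b) (EFin \o (fun z => lam * f z ^+ 2)) by exact: cont_integrable.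
have i2' : mu.-integrable (rect c' d' a b) (EFin \o (fun z => f z ^+ 2)) by exact: cont_integrable.
have i3 : mu.-integrable (rect c' d' a b) (EFin \o (fun _ : R * R => (4 * lam)^-1)).
  by apply: cont_integrable => z _; exact: cont_at_cst.
have i23 : mu.-integrable (rect c' d' a b) (EFin \o (fun z => lam * f z ^+ 2 + (4 * lam)^-1)).
  by apply: cont_integrable => z zr; apply: cont_atD; [exact: csq|exact: cont_at_cst].
have young z : sg * f z <= lam * f z ^+ 2 + (4 * lam)^-1.
  have -> : lam * f z ^+ 2 + (4 * lam)^-1 = lam * (f z - sg / (2 * lam)) ^+ 2 + sg * f z.
    have -> : lam * (f z - sg / (2 * lam)) ^+ 2 = lam * f z ^+ 2 - sg * f z + sg ^+ 2 / (4 * lam).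
      by field; exact: lt0r_neq0.
    by rewrite sg2 mul1r; ring.
  by rewrite lerDr mulr_ge0 ?sqr_ge0// ltW.
have up := le_Rintegral mr i1 i23 (fun z _ => young z).
rewrite (RintegralD mr i2 i3) (RintegralZl _ mr i2') Rintegral_cst// /plane (lebesgue2_rect (ltW c'd') (ltW ab)) /= in up.
have Isub : \int[mu]_(z in rect c' d' a b) (f z ^+ 2) <= e.
  apply: le_trans If; apply: Rintegral_rect_subset => //.
    by move=> z zr; apply: cont_atX; exact: cf.
  by move=> z _; exact: sqr_ge0.
have {}Isub := ler_wpM2l (ltW lam0) Isub.
have el' := ler_wpM2l (ltW lam0) el.
have e4 : lam * (k * (d' - c') / (4 * lam)) = k * (d' - c') / 4 by field; exact: lt0r_neq0.
have e5 : (4 * lam)^-1 * ((b - a) * (d' - c')) = k * (d' - c') / 2.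
  have alg (x y w : R) : x != 0 -> y != 0 -> (4 * (x / (2 * y)))^-1 * (x * w) = y * w / 2.
    by move=> x0 y0'; field; rewrite x0 y0'.
  by rewrite /lam alg ?lt0r_neq0.
rewrite [(d' - c') * (b - a)]mulrC e5 in up; rewrite e4 in el'.
have kd : 0 < k * (d' - c') by rewrite mulr_gt0.
by have := le_trans gap up; move: Isub el' kd; rewrite /plane; clear; lra.
Qed.

(* [T] needs no derivative: if it were not constant, the approximants [Phi] would have to bridge a fixed gap
   on a set of segments of positive measure, at a fixed cost in Dirichlet energy. *)
Lemma const_of_small_gradients (T : R * R -> R) (a b c d : R) : a < b -> c < d -> continuous T ->
  (forall e, 0 < e -> exists Phi f1 f2 : R * R -> R,
    [/\ forall z, rect a b c d z -> `|Phi z - T z| <= e,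
        forall z, rect a b c d z -> [/\ cont_at Phi z, cont_at f1 z & cont_at f2 z],
        forall z, rect a b c d z -> has_der (fun t => Phi (t, z.2)) z.1 (f1 z),
        forall z, rect a b c d z -> has_der (fun t => Phi (z.1, t)) z.2 (f2 z) &
        \int[mu]_(z in rect a b c d) (f1 z ^+ 2 + f2 z ^+ 2) <= e]) ->
  forall z w, rect a b c d z -> rect a b c d w -> T z = T w.
Proof.
move=> ab cd cT hT.
have step1 s1 s2 y : a <= s1 -> s1 < s2 -> s2 <= b -> c <= y <= d -> T (s2, y) = T (s1, y).
  move=> as1 s12 s2b; apply: small_gradient_eq1 => // e e0.
  have [Phi [f1 [f2 [h1 h2 h3 h4 h5]]]] := hT e e0.
  have sub : rect s1 s2 c d `<=` rect a b c d.
    exact: rect_sub.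
  exists Phi, f1; split.
  - by move=> z /sub; exact: h1.
  - by move=> z /sub /h2[].
  - by move=> z /sub /h2[].
  - by move=> z /sub; exact: h3.
  apply: le_trans h5; apply: (@le_trans _ _ (\int[mu]_(z in rect a b c d) (f1 z ^+ 2))).
    apply: Rintegral_rect_subset => // z; last by move=> _; exact: sqr_ge0.
    by move=> /h2[_ ? _]; exact: cont_atX.
  apply: le_Rintegral.
  - exact: measurable_rect.
  - by apply: cont_integrable => z /h2[_ ? _]; exact: cont_atX.
  - by apply: cont_integrable => z /h2[_ ? ?]; apply: cont_atD; exact: cont_atX.
  - by move=> z _; rewrite lerDl sqr_ge0.
have step2 s1 s2 x : c <= s1 -> s1 < s2 -> s2 <= d -> a <= x <= b -> T (x, s2) = T (x, s1).
  move=> cs1 s12 s2d; apply: small_gradient_eq2 => // e e0.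
  have [Phi [f1 [f2 [h1 h2 h3 h4 h5]]]] := hT e e0.
  have sub : rect a b s1 s2 `<=` rect a b c d.
    exact: rect_sub.
  exists Phi, f2; split.
  - by move=> z /sub; exact: h1.
  - by move=> z /sub /h2[].
  - by move=> z /sub /h2[].
  - by move=> z /sub; exact: h4.
  apply: le_trans h5; apply: (@le_trans _ _ (\int[mu]_(z in rect a b c d) (f2 z ^+ 2))).
    apply: Rintegral_rect_subset => // z; last by move=> _; exact: sqr_ge0.
    by move=> /h2[_ _ ?]; exact: cont_atX.
  apply: le_Rintegral.
  - exact: measurable_rect.
  - by apply: cont_integrable => z /h2[_ _ ?]; exact: cont_atX.
  - by apply: cont_integrable => z /h2[_ ? ?]; apply: cont_atD; exact: cont_atX.
  - by move=> z _; rewrite lerDr sqr_ge0.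
move=> [z1 z2] [w1 w2] [/= zab zcd] [/= wab wcd].
transitivity (T (w1, z2)).
  move: zab wab => /andP[? ?] /andP[? ?].
  have [h|h|->//] := ltgtP z1 w1; [apply/esym|]; exact: step1.
move: zcd wcd => /andP[? ?] /andP[? ?].
have [h|h|->//] := ltgtP z2 w2; [apply/esym|]; exact: step2.
Qed.

End small_gradients.

Section local_structure.
Variable R : realType.
Local Notation R2 := (measurableTypeR R * measurableTypeR R)%type.
Local Notation mu := (@plane R).
Implicit Types (x z : R * R) (d E : R).

Variables (v1 v2 A1 A2 B1 B2 : R * R -> R).
Hypothesis fd : flow_data v1 v2 A1 A2 B1 B2.

Let cv1 x : cont_at v1 x. Proof. exact: (flow_cont1 fd). Qed.
Let cv2 x : cont_at v2 x. Proof. exact: (flow_cont2 fd). Qed.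

(** Near [x0] the function [be / al] is the tangent of the angle between [v] and [v x0]. Its
    analogue for the mollified velocity has gradient [n * J / ad^2], so [energy_small] makes its
    Dirichlet energy arbitrarily small; hence it is constant, with the value 0 taken at [x0]. *)
Lemma locally_parallel (e1 e2 C : R) (n0 : nat) x0 : e1 ^+ 2 + e2 ^+ 2 = 1 ->
  (forall x, 0 < v1 x ^+ 2 + v2 x ^+ 2 ->
     0 < Num.sqrt (v1 x ^+ 2 + v2 x ^+ 2) + (v1 x * e1 + v2 x * e2)) ->
  0 < C ->
  (forall j x, (n0 <= j)%N -> box (2 * 2 ^+ j.+1 + 1) x -> v1 x ^+ 2 + v2 x ^+ 2 <= C * j.+1%:R) ->
  0 < v1 x0 ^+ 2 + v2 x0 ^+ 2 ->
  exists2 r, 0 < r & forall x, `|x.1 - x0.1| <= r -> `|x.2 - x0.2| <= r ->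
    v2 x * v1 x0 - v1 x * v2 x0 = 0.
Proof.
move=> he slit C0 growth; set P := v1 x0; set Q := v2 x0; set n := P ^+ 2 + Q ^+ 2 => n_gt0.
have nn0 : n != 0 by exact: lt0r_neq0.
pose al (y : R * R) := y.1 * P + y.2 * Q.
pose be (y : R * R) := y.2 * P - y.1 * Q.
(* Truncating the denominator from below makes the tangent continuous on the whole plane without
   changing it where [al >= n / 2]. *)
pose Psi y := be y / Num.max (al y) (n / 2).
pose sq (y : R * R) := y.1 ^+ 2 + y.2 ^+ 2.
have den0 y : 0 < Num.max (al y) (n / 2) by rewrite lt_max divr_gt0 ?orbT.
have c1 y := @cont_at_fst R y; have c2 y := @cont_at_snd R y.
have clin (c : R) y : cont_at (fun y : R * R => y.1 * c) y by apply: cont_atM; [exact: c1|exact: cont_at_cst].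
have clin' (c : R) y : cont_at (fun y : R * R => y.2 * c) y by apply: cont_atM; [exact: c2|exact: cont_at_cst].
have cal y : cont_at al y by apply: cont_atD; [exact: clin|exact: clin'].
have cbe y : cont_at be y by apply: cont_atB; [exact: clin'|exact: clin].
have csq y : cont_at sq y by apply: cont_atD; apply: cont_atX; [exact: c1|exact: c2].
have cPsi y : cont_at Psi y.
  apply: cont_atM; first exact: cbe.
  by apply: cont_atV; [exact: lt0r_neq0|apply: cont_at_max; [exact: cal|exact: cont_at_cst]].
pose T x := Psi (v1 x, v2 x).
have cT x : cont_at T x by apply: cont_at_comp2; [exact: cv1|exact: cv2|exact: cPsi].
pose a x := al (v1 x, v2 x).
have ca x : cont_at a x by apply: cont_at_comp2; [exact: cv1|exact: cv2|exact: cal].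
have a0 : a x0 = n by rewrite /a /al /n !expr2.
have n4 : 0 < n / 4 by rewrite divr_gt0.
have [r2 r20 hr2] := (cont_at2P a x0).1 (ca x0) _ n4.
pose r := r2 / 2; have r0 : 0 < r by rewrite divr_gt0.
have rr2 : r < r2 by rewrite /r ltr_pdivrMr// ltr_pMr// ltr1n.
exists r => //.
pose sqr := rect (x0.1 - r) (x0.1 + r) (x0.2 - r) (x0.2 + r).
have in_sq x : `|x.1 - x0.1| <= r -> `|x.2 - x0.2| <= r -> sqr x.
  by rewrite !ler_distl => h1 h2.
have sq_in x : sqr x -> `|x.1 - x0.1| <= r /\ `|x.2 - x0.2| <= r.
  by move=> [h1 h2]; rewrite !ler_distl.
have ax x : sqr x -> 3 * n / 4 <= a x.
  move=> /sq_in[h1 h2]; have := hr2 x (le_lt_trans h1 rr2) (le_lt_trans h2 rr2).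
  by rewrite a0 ltr_distl => /andP[h3 _]; move: h3; clear; lra.
pose M0 := `|x0.1| + `|x0.2| + r.
have sub : sqr `<=` box M0.
  have xM : box (`|x0.1| + `|x0.2|) x0 by exact: in_box.
  by move=> x /sq_in[h1 h2]; apply: (box_near xM); rewrite distrC.
have [S0 S00 hS] : exists2 S, 0 < S & forall x, box M0 x -> `|sq (v1 x, v2 x)| <= S.
  apply: (@compact_cont_bounded R _ (box M0) (fun x => sq (v1 x, v2 x))); first exact: compact_rect.
  by move=> x _; apply: cont_at_comp2; [exact: cv1|exact: cv2|exact: csq].
pose S := S0 + 1; have Sp : 0 < S by rewrite addr_gt0.
(* From [J1^2 + J2^2 <= 2 * S * G] and [(n / ad^2)^2 <= (4 / n)^2]. *)
pose K := 32 * S / n ^+ 2; have K0 : 0 < K by rewrite divr_gt0 ?exprn_gt0// mulr_gt0.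
(* On the square the mollified squared speed is at least [n / 4]; a truncation level of at most
   [n / 8] therefore gives [chi >= 1/2] there. *)
have n8 : 0 < n / 8 by rewrite divr_gt0.
suff Tc y1 y2 : sqr y1 -> sqr y2 -> T y1 = T y2.
  move=> x h1 h2; have sx := in_sq x h1 h2.
  have s0 : sqr x0 by apply: in_sq; rewrite subrr normr0 ltW.
  have := Tc _ _ sx s0; rewrite /T /Psi /be /= -/P -/Q [Q * P]mulrC subrr mul0r => /eqP.
  by rewrite mulf_eq0 invr_eq0 (gt_eqF (den0 _)) orbF => /eqP.
have xr1 : x0.1 - r < x0.1 + r by move: r0; lra.
have xr2 : x0.2 - r < x0.2 + r by move: r0; lra.
apply: (@const_of_small_gradients R T _ _ _ _ xr1 xr2 (cont_atW cT)) => e e_gt0.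
have tau0 : 0 < e / K by rewrite divr_gt0.
have [E [d0 [E0 En d00 hE]]] := @energy_small R v1 v2 A1 A2 B1 B2 fd e1 e2 C n0 M0 (n / 8) (e / K) he slit C0 growth n8 tau0.
have [d1 d10 hd1] := mollify_unif M0 (flow_cont1 fd) (flow_cont2 fd) (cont_atW cPsi) e_gt0.
have [d2 d20 hd2] := mollify_unif M0 (flow_cont1 fd) (flow_cont2 fd) (cont_atW cal) n4.
have [d3 d30 hd3] := mollify_unif M0 (flow_cont1 fd) (flow_cont2 fd) (cont_atW csq) (@ltr01 R).
pose d := Num.min d0 (Num.min d1 (Num.min d2 d3)).
have d_gt0 : 0 < d by rewrite !lt_min d00 d10 d20.
have [dd0 [dd1 [dd2 dd3]]] : d <= d0 /\ d <= d1 /\ d <= d2 /\ d <= d3.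
  have : d <= d by []; rewrite {2}/d !le_min => /andP[? /andP[? /andP[? ?]]].
  by [].
have zd (t : R) : `|t - t| <= d by rewrite subrr normr0 ltW.
pose u := mollify d v1; pose w := mollify d v2.
pose u1 := mollify d A1; pose u2 := mollify d A2.
pose w1 := mollify d B1; pose w2 := mollify d B2.
pose ad x := al (u x, w x); pose bd x := be (u x, w x).
pose s x := u x ^+ 2 + w x ^+ 2.
pose J1 x := u x * w1 x - w x * u1 x; pose J2 x := u x * w2 x - w x * u2 x.
have cm f : locint f -> forall x, cont_at (mollify d f) x.
  by move=> lf x; exact: (mollify_continuous d_gt0 lf).
have cu := cm _ (cont_locint (flow_cont1 fd)).
have cw := cm _ (cont_locint (flow_cont2 fd)).
have cw1 := cm _ (locint_sq (flow_mB1 fd) (flow_lB1 fd)).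
have cw2 := cm _ (locint_sq (flow_mB2 fd) (flow_lB2 fd)).
have cu1 := cm _ (locint_sq (flow_mA1 fd) (flow_lA1 fd)).
have cu2 := cm _ (locint_sq (flow_mA2 fd) (flow_lA2 fd)).
have cJ1 x : cont_at J1 x by apply: cont_atB; apply: cont_atM; [exact: cu|exact: cw1|exact: cw|exact: cu1].
have cJ2 x : cont_at J2 x by apply: cont_atB; apply: cont_atM; [exact: cu|exact: cw2|exact: cw|exact: cu2].
have cad x : cont_at ad x by apply: cont_at_comp2; [exact: cu|exact: cw|exact: cal].
have cbd x : cont_at bd x by apply: cont_at_comp2; [exact: cu|exact: cw|exact: cbe].
have cs x : cont_at s x by apply: cont_atD; apply: cont_atX; [exact: cu|exact: cw].
have adx x : sqr x -> n / 2 <= ad x.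
  move=> sx; have h1 := ax x sx.
  have := hd2 d x x d_gt0 dd2 (sub x sx) (zd _) (zd _).
  by rewrite -/(a x) -/(ad x) ltr_distl => /andP[h3 _]; move: h1 h3; clear; lra.
have n2 : 0 < n / 2 by rewrite divr_gt0.
have ad0 x : sqr x -> ad x != 0.
  by move=> sx; apply: lt0r_neq0; exact: lt_le_trans n2 (adx x sx).
exists (fun x => bd x / ad x), (fun x => n * J1 x / ad x ^+ 2), (fun x => n * J2 x / ad x ^+ 2).
have cf (J : R * R -> R) x : (forall x, cont_at J x) -> sqr x -> cont_at (fun x => n * J x / ad x ^+ 2) x.
  move=> cJ sx; apply: cont_atM; first by apply: cont_atM; [exact: cont_at_cst|exact: cJ].
  by apply: cont_atV; [rewrite expf_neq0// ad0|apply: cont_atX; exact: cad].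
have pair_eta x : (x.1, x.2) = x by case: x.
(* The quotient rule, where the numerator collapses because the determinant of the linear map
   [(al, be)] is [n]. *)
have quot (p q : R -> R) (t dp dq : R) : has_der p t dp -> has_der q t dq ->
    al (p t, q t) != 0 -> has_der (fun t => be (p t, q t) / al (p t, q t)) t
     (n * (p t * dq - q t * dp) / al (p t, q t) ^+ 2).
  move=> hp hq al0.
  have hb := has_derB (has_derM hq (has_der_cst P t)) (has_derM hp (has_der_cst Q t)).
  have ha := has_derD (has_derM hp (has_der_cst P t)) (has_derM hq (has_der_cst Q t)).
  apply: (@has_der_eq _ (fun t => be (p t, q t) / al (p t, q t)) _ _ _
    (has_derM hb (@has_derV _ (fun t => al (p t, q t)) _ _ al0 ha))).
  rewrite !mulr0 !addr0 /=.
  move: al0; rewrite /al /n /=; move: (p t) (q t) => pt qt al0; field.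
  exact: al0.
split.
- move=> x sx; have := hd1 d x x d_gt0 dd1 (sub x sx) (zd _) (zd _).
  move=> /ltW; rewrite -/(T x) /Psi -/u -/w -/(ad x) -/(bd x) max_l//; exact: adx.
- move=> x sx; split; [|exact: cf|exact: cf].
  by apply: cont_atM; [exact: cbd|apply: cont_atV; [exact: ad0|exact: cad]].
- move=> x sx.
  have p1 := mollify_section1 d_gt0 x (flow_cont1 fd) (flow_grad1 fd).
  have p2 := mollify_section1 d_gt0 x (flow_cont2 fd) (flow_grad2 fd).
  have := quot (fun t => u (t, x.2)) (fun t => w (t, x.2)) x.1 (u1 x) (w1 x) p1 p2.
  by rewrite pair_eta => /(_ (ad0 x sx)).
- move=> x sx.
  have p1 := mollify_section2 d_gt0 x (flow_cont1 fd) (flow_grad1 fd).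
  have p2 := mollify_section2 d_gt0 x (flow_cont2 fd) (flow_grad2 fd).
  have := quot (fun t => u (x.1, t)) (fun t => w (x.1, t)) x.2 (u2 x) (w2 x) p1 p2.
  by rewrite pair_eta => /(_ (ad0 x sx)).
pose G x := chi E (s x) * (J1 x ^+ 2 + J2 x ^+ 2) / s x.
have s_ge0 x : 0 <= s x by rewrite addr_ge0 ?sqr_ge0.
have G0 x : 0 <= G x.
  by rewrite /G divr_ge0//; apply: mulr_ge0; [exact: chi_ge0|rewrite addr_ge0 ?sqr_ge0].
have cG x : cont_at G x.
  apply: (@cont_at_ext _ _ (fun x => (chi E (s x) / s x) * (J1 x ^+ 2 + J2 x ^+ 2))).
    by move=> y; rewrite /G mulrAC.
  by apply: cont_atM; [exact: cont_at_chi_div|apply: cont_atD; apply: cont_atX; [exact: cJ1|exact: cJ2]].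
have point x : sqr x -> (n * J1 x / ad x ^+ 2) ^+ 2 + (n * J2 x / ad x ^+ 2) ^+ 2 <= K * G x.
  move=> sx; have adn := adx x sx.
  have JJ0 : 0 <= J1 x ^+ 2 + J2 x ^+ 2 by rewrite addr_ge0 ?sqr_ge0.
  have ad2 : n ^+ 2 / 4 <= ad x ^+ 2.
    have -> : n ^+ 2 / 4 = (n / 2) ^+ 2 by field.
    by rewrite ler_sqr ?nnegrE// ltW// (lt_le_trans n2).
  have adle : ad x ^+ 2 <= n * s x.
    have -> : n * s x = ad x ^+ 2 + bd x ^+ 2 by rewrite /n /s /ad /bd /al /be /=; ring.
    by rewrite lerDl sqr_ge0.
  have sn : n / 4 <= s x.
    rewrite -(ler_pM2l n_gt0); apply: le_trans adle; move: ad2.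
    by have -> : n * (n / 4) = n ^+ 2 / 4 by field.
  have s0 : 0 < s x by apply: lt_le_trans sn; rewrite divr_gt0.
  have chih : 2^-1 <= chi E (s x) by apply: chi_half => //; move: En sn; clear; lra.
  have sS : s x <= S.
    have h1 := hS x (sub x sx).
    have := hd3 d x x d_gt0 dd3 (sub x sx) (zd _) (zd _); rewrite ltr_distl => /andP[_ h2].
    have h3 := ler_norm (sq (v1 x, v2 x)).
    by move: h1 h2 h3; rewrite /S -[sq (mollify d v1 x, mollify d v2 x)]/(s x); clear; lra.
  have JG : J1 x ^+ 2 + J2 x ^+ 2 <= 2 * S * G x.
    have e2' : G x * s x = chi E (s x) * (J1 x ^+ 2 + J2 x ^+ 2) by rewrite /G divfK// lt0r_neq0.
    have h1 : 2^-1 * (J1 x ^+ 2 + J2 x ^+ 2) <= G x * s x by rewrite e2' ler_wpM2r.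
    have h2 : G x * s x <= G x * S by rewrite ler_wpM2l.
    by move: h1 h2; clear; lra.
  have -> : (n * J1 x / ad x ^+ 2) ^+ 2 + (n * J2 x / ad x ^+ 2) ^+ 2 =
      (J1 x ^+ 2 + J2 x ^+ 2) * (n / ad x ^+ 2) ^+ 2 by ring.
  have h4 : (n / ad x ^+ 2) ^+ 2 <= (4 / n) ^+ 2.
    rewrite ler_sqr ?nnegrE; last by rewrite divr_ge0// ltW.
      rewrite ler_pdivrMr; last by rewrite exprn_gt0// (lt_le_trans n2).
      by rewrite mulrAC ler_pdivlMr//; move: ad2; rewrite expr2; clear; lra.
    by rewrite divr_ge0 ?sqr_ge0// ltW.
  apply: le_trans (ler_pM JJ0 (sqr_ge0 _) JG h4) _.
  rewrite le_eqVlt; apply/orP; left; apply/eqP; rewrite /K; field; exact: nn0.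
have mr : measurable (sqr : set R2) by exact: measurable_rect.
apply: (@le_trans _ _ (\int[mu]_(z in sqr) (K * G z))).
  apply: le_Rintegral => //.
  - by apply: cont_integrable => x sx; apply: cont_atD; apply: cont_atX; exact: cf.
  - by apply: cont_integrable => x sx; apply: cont_atM; [exact: cont_at_cst|exact: cG].
rewrite RintegralZl//; last by apply: cont_integrable => x _; exact: cG.
apply: (@le_trans _ _ (K * (e / K))); last by rewrite mulrC divfK// lt0r_neq0.
rewrite ler_pM2l//; apply: le_trans (hE d d_gt0 dd0).
by apply: (@Rintegral_rect_subset _ (- M0) M0 (- M0) M0) => // z _.
Qed.

End local_structure.

Section constancy.
Variable R : realType.
Local Notation R2 := (measurableTypeR R * measurableTypeR R)%type.
Local Notation mu := (@plane R).
Implicit Types (x z : R * R) (d : R).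

Lemma has_der0_eq (g : R -> R) : (forall t, 0 <= t <= 1 -> has_der g t 0) -> g 1 = g 0.
Proof.
move=> h.
have c0 : {within `[0, 1]%classic, continuous g}.
  by apply: continuous_in_subspaceT => t; rewrite inE/= in_itv/= => /h /has_der_cont.
have [c _ hc] := @MVT _ g (fun=> 0) 0 1 ltr01 (fun t ht => h t (subset_itv_oo_cc ht)) c0.
by apply/eqP; rewrite -subr_eq0 hc mul0r.
Qed.

(** Mollifications of a continuous function converge to it at each point as the radius tends to
    0. *)
Lemma mollify_inj (f : R * R -> R) x z d0 : continuous f -> 0 < d0 ->
  (forall d, 0 < d -> d <= d0 -> mollify d f x = mollify d f z) -> f x = f z.
Proof.
move=> cf d00 h; apply/eqP; rewrite -subr_eq0 -normr_le0; apply/ler_addgt0Pr => e e0; rewrite add0r.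
pose M := `|x.1| + `|x.2| + (`|z.1| + `|z.2|).
have cfst : continuous (fst : R * R -> R) by apply: cont_atW => y; exact: cont_at_fst.
have e2 : 0 < e / 2 by rewrite divr_gt0.
have [d1 d10 hd] := mollify_unif M cf cf cfst e2.
pose d := Num.min d0 d1.
have d_gt0 : 0 < d by rewrite lt_min d00 d10.
have n0 (a : R) : `|a - a| <= d by rewrite subrr normr0 ltW.
have dd1 : d <= d1 by rewrite ge_min lexx orbT.
have bx : box M x by apply: box_sub (in_box x); rewrite lerDl addr_ge0.
have bz : box M z by apply: box_sub (in_box z); rewrite lerDr addr_ge0.
have hx := hd d x x d_gt0 dd1 bx (n0 _) (n0 _).
have hz := hd d z z d_gt0 dd1 bz (n0 _) (n0 _).
rewrite /= (h d d_gt0) ?ge_min ?lexx// in hx; move: hx hz; rewrite /= !ltr_norml ler_norml.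
by move=> /andP[? ?] /andP[? ?]; apply/andP; split; lra.
Qed.

Variables (v1 v2 A1 A2 B1 B2 : R * R -> R).
Hypothesis fd : flow_data v1 v2 A1 A2 B1 B2.

(** Where [v] is parallel to [(P, Q)], [v2 * P = v1 * Q], so the derivative of [v1] along [(P, Q)]
    is [P] times the divergence, and that of [v2] is [Q] times it. The computation is carried out on
    mollifications. *)
Lemma locally_constant_along (P Q r : R) x0 : 0 < r ->
  (forall x, `|x.1 - x0.1| <= r -> `|x.2 - x0.2| <= r -> v2 x * P - v1 x * Q = 0) ->
  exists2 t0, 0 < t0 & forall t, `|t| <= t0 ->
    v1 (x0.1 + t * P, x0.2 + t * Q) = v1 x0 /\ v2 (x0.1 + t * P, x0.2 + t * Q) = v2 x0.
Proof.
move=> r0 hpar.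
have PQ0 : 0 < 2 * (`|P| + `|Q| + 1) by rewrite mulr_gt0// ltr_wpDl// addr_ge0.
(* Half of [r] is left for moving along the line, the other half for the mollification radius. *)
exists (r / (2 * (`|P| + `|Q| + 1))); first by rewrite divr_gt0.
move=> t; rewrite ler_pdivlMr// => ht.
have r2 : 0 < r / 2 by rewrite divr_gt0.
have l1 := cont_locint (flow_cont1 fd); have l2 := cont_locint (flow_cont2 fd).
have tP : `|t * P| <= r / 2.
  rewrite normrM; have := mulr_ge0 (normr_ge0 t) (normr_ge0 Q); have := normr_ge0 t; move: ht; nra.
have tQ : `|t * Q| <= r / 2.
  rewrite normrM; have := mulr_ge0 (normr_ge0 t) (normr_ge0 P); have := normr_ge0 t; move: ht; nra.
pose e := (t * P, t * Q).
have close d s p q : d <= r / 2 -> 0 <= s <= 1 -> csmooth d p -> csmooth d q ->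
    conv v2 p q (x0.1 + s * e.1, x0.2 + s * e.2) * P = conv v1 p q (x0.1 + s * e.1, x0.2 + s * e.2) * Q.
  move=> dr /andP[s0 s1] hp hq; set x := (_, _).
  have sx (a : R) : `|a| <= r / 2 -> `|s * a| <= r / 2.
    by move=> ha; rewrite normrM ger0_norm// -[leRHS]mul1r ler_pM.
  have zero : conv (fun z => P * v2 z + - Q * v1 z) p q x = 0.
    rewrite /conv /Rintegral integral0_eq// => z _; congr EFin.
    have [h1|h1] := leP `|x.1 - z.1| d; last by rewrite /kern hp.2// mul0r mulr0.
    have [h2|h2] := leP `|x.2 - z.2| d; last by rewrite /kern hq.2// !mulr0.
    have -> : P * v2 z + - Q * v1 z = 0.
      rewrite -(hpar z); first by ring.
        have := sx _ tP; move: h1 dr; rewrite /x /= !ler_norml => /andP[? ?] ? /andP[? ?].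
        by apply/andP; split; lra.
      have := sx _ tQ; move: h2 dr; rewrite /x /= !ler_norml => /andP[? ?] ? /andP[? ?].
      by apply/andP; split; lra.
    by rewrite mul0r.
  have m2 : locint (fun z => P * v2 z).
    by apply: cont_locint; apply: cont_atW => z; apply: cont_atM; [exact: cont_at_cst|exact: (flow_cont2 fd)].
  have m1 : locint (fun z => - Q * v1 z).
    by apply: cont_locint; apply: cont_atW => z; apply: cont_atM; [exact: cont_at_cst|exact: (flow_cont1 fd)].
  rewrite (convD hp hq x m2 m1) (convZ hp hq P x l2) (convZ hp hq (- Q) x l1) in zero.
  by move: zero; set a := conv _ _ _ _; set b := conv _ _ _ _; lra.
have e01 : (x0.1 + t * P, x0.2 + t * Q) = (x0.1 + 1 * e.1, x0.2 + 1 * e.2) by rewrite !mul1r.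
have e00 : x0 = (x0.1 + 0 * e.1, x0.2 + 0 * e.2) by rewrite !mul0r !addr0; case: (x0).
have main d : 0 < d -> d <= r / 2 ->
    mollify d v1 (x0.1 + 1 * e.1, x0.2 + 1 * e.2) = mollify d v1 (x0.1 + 0 * e.1, x0.2 + 0 * e.2) /\
    mollify d v2 (x0.1 + 1 * e.1, x0.2 + 1 * e.2) = mollify d v2 (x0.1 + 0 * e.1, x0.2 + 0 * e.2).
  move=> d0 dr; have hm := csmooth_moll d0; have hm' := csmooth_derive1 hm.
  split.
    apply: (@has_der0_eq (fun s => mollify d v1 (x0.1 + s * e.1, x0.2 + s * e.2))) => s s01.
    apply: has_der_eq (conv_dir x0 e s l1 hm hm) _.
    have k1 := close d s _ _ dr s01 hm' hm; have k2 := close d s _ _ dr s01 hm hm'.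
    have dv := flow_div fd hm hm (x0.1 + s * e.1, x0.2 + s * e.2).
    move: k1 k2 dv; rewrite /e /=; set u1 := conv v1 _ _ _; set u2 := conv v1 _ _ _.
    set w1 := conv v2 _ _ _; set w2 := conv v2 _ _ _ => k1 k2 dv.
    have -> : t * P * u1 + t * Q * u2 = t * (P * u1 + u2 * Q) by ring.
    by rewrite -k2 [w2 * P]mulrC -mulrDr dv !mulr0.
  apply: (@has_der0_eq (fun s => mollify d v2 (x0.1 + s * e.1, x0.2 + s * e.2))) => s s01.
  apply: has_der_eq (conv_dir x0 e s l2 hm hm) _.
  have k1 := close d s _ _ dr s01 hm' hm; have k2 := close d s _ _ dr s01 hm hm'.
  have dv := flow_div fd hm hm (x0.1 + s * e.1, x0.2 + s * e.2).
  move: k1 k2 dv; rewrite /e /=; set u1 := conv v1 _ _ _; set u2 := conv v1 _ _ _.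
  set w1 := conv v2 _ _ _; set w2 := conv v2 _ _ _ => k1 k2 dv.
  have -> : t * P * w1 + t * Q * w2 = t * (w1 * P + Q * w2) by ring.
  by rewrite k1 [u1 * Q]mulrC -mulrDr dv !mulr0.
have q1 := mollify_inj (flow_cont1 fd) r2 (fun d hp hr => (main d hp hr).1).
have q2 := mollify_inj (flow_cont2 fd) r2 (fun d hp hr => (main d hp hr).2).
by rewrite -e00 -e01 in q1 q2.
Qed.
End constancy.

(** * Global structure of the flow *)

Section shear.
Variable R : realType.
Variables v1 v2 : R * R -> R.
Hypotheses (cv1 : continuous v1) (cv2 : continuous v2).
Hypothesis local : forall x, 0 < v1 x ^+ 2 + v2 x ^+ 2 -> exists2 t0 : R, 0 < t0 &
  forall t : R, `|t| <= t0 -> v1 (x.1 + t * v1 x, x.2 + t * v2 x) = v1 x /\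
                          v2 (x.1 + t * v1 x, x.2 + t * v2 x) = v2 x.

(** The parameters at which [v] equals [v x] form a closed set by continuity and an open set by
    [local], since the velocity there is again [v x]. The set contains 0 and the line is
    connected. *)
Lemma constant_along_flow x (t : R) : 0 < v1 x ^+ 2 + v2 x ^+ 2 ->
  v1 (x.1 + t * v1 x, x.2 + t * v2 x) = v1 x /\ v2 (x.1 + t * v1 x, x.2 + t * v2 x) = v2 x.
Proof.
move=> x0; pose y (s : R) := (x.1 + s * v1 x, x.2 + s * v2 x).
have cl (a b : R) (s : R) : cont_at (fun s : R => a + s * b) s.
  by apply: cont_atD; [exact: cont_at_cst|apply: cont_atM; [exact: cvg_id|exact: cont_at_cst]].
have c1 : continuous (fun s => v1 (y s)).
  by apply: cont_atW => s; apply: (@cont_at_comp2 _ _ (fun s : R => x.1 + s * v1 x) (fun s : R => x.2 + s * v2 x) v1); [exact: cl|exact: cl|exact: cv1].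
have c2 : continuous (fun s => v2 (y s)).
  by apply: cont_atW => s; apply: (@cont_at_comp2 _ _ (fun s : R => x.1 + s * v1 x) (fun s : R => x.2 + s * v2 x) v2); [exact: cl|exact: cl|exact: cv2].
pose S := [set s : R | v1 (y s) = v1 x /\ v2 (y s) = v2 x].
have oS : open S.
  rewrite openE => s [h1 h2]; have := @local (y s); rewrite h1 h2 => /(_ x0)[t0 t00 ht].
  apply/nbhs_ballP; exists t0 => //= s'; rewrite /ball /= => hs.
  have := ht (s' - s); rewrite distrC => /(_ (ltW hs)).
  rewrite /S /= /y /=.
  have -> : x.1 + s * v1 x + (s' - s) * v1 x = x.1 + s' * v1 x by ring.
  by have -> : x.2 + s * v2 x + (s' - s) * v2 x = x.2 + s' * v2 x by ring.
have cS : closed S.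
  have -> : S = (fun s => v1 (y s)) @^-1` [set z | z = v1 x] `&` (fun s => v2 (y s)) @^-1` [set z | z = v2 x] by [].
  by apply: closedI; apply: preimage_closed; [move=> s _; exact: c1|exact: closed_eq|move=> s _; exact: c2|exact: closed_eq].
have cR : connected [set: R] by apply/connected_intervalP => ? ? *.
suff: S = setT by move=> ST; have : S t by rewrite ST.
apply: cR.
- by exists 0; rewrite /S /= /y !mul0r !addr0; case: (x).
- by exists S => //; rewrite setTI.
- by exists S => //; rewrite setTI.
Qed.

(** Two lines with independent directions meet, and at the intersection [v] would equal both [v x]
    and [v z], which would then coincide. *)
Lemma parallel_to_nonzero x z : 0 < v1 x ^+ 2 + v2 x ^+ 2 -> v2 z * v1 x - v1 z * v2 x = 0.
Proof.
move=> x0; have [/eqP|z0] := eqVneq (v1 z ^+ 2 + v2 z ^+ 2) 0.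
  by rewrite paddr_eq0 ?sqr_ge0// !sqrf_eq0 => /andP[/eqP-> /eqP->]; rewrite !mul0r subrr.
have {}z0 : 0 < v1 z ^+ 2 + v2 z ^+ 2 by rewrite lt_def z0 addr_ge0 ?sqr_ge0.
apply/eqP/negPn/negP => det0; move/eqP: (det0) => detE; apply: detE.
set P := v1 x in x0 det0 *; set Q := v2 x in x0 det0 *; set a := v1 z in z0 det0 *; set b := v2 z in z0 det0 *.
(* Cramer's rule for the parameters of the intersection point on the two lines. *)
pose D := b * P - a * Q.
pose t := (b * (z.1 - x.1) - a * (z.2 - x.2)) / D.
pose s := (Q * (z.1 - x.1) - P * (z.2 - x.2)) / D.
have [h1 h2] := constant_along_flow t x0.
have [k1 k2] := constant_along_flow s z0.
have alg1 (X Y p q c d : R) : d * p - c * q != 0 ->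
  (d * X - c * Y) / (d * p - c * q) * p = X + (q * X - p * Y) / (d * p - c * q) * c by move=> ?; field.
have alg2 (X Y p q c d : R) : d * p - c * q != 0 ->
  (d * X - c * Y) / (d * p - c * q) * q = Y + (q * X - p * Y) / (d * p - c * q) * d by move=> ?; field.
have E : (x.1 + t * P, x.2 + t * Q) = (z.1 + s * a, z.2 + s * b).
  congr pair; rewrite /t /s.
    by rewrite (alg1 (z.1 - x.1) (z.2 - x.2) P Q a b det0); ring.
  by rewrite (alg2 (z.1 - x.1) (z.2 - x.2) P Q a b det0); ring.
have ea : a = P by move: h1; rewrite -/P -/Q E => <-; rewrite -[LHS]k1.
have eb : b = Q by move: h2; rewrite -/P -/Q E => <-; rewrite -[LHS]k2.
by rewrite ea eb mulrC subrr.
Qed.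

(** If [v] is nonzero at [z], then [v x] is a multiple of [v z] and the line of [z] is followed. If
    it is zero at [z], either the translate also has zero velocity, or the nonzero case applied
    backwards from the translate gives equality. *)
Lemma constant_along_direction x z (t : R) : 0 < v1 x ^+ 2 + v2 x ^+ 2 ->
  v1 (z.1 + t * v1 x, z.2 + t * v2 x) = v1 z /\ v2 (z.1 + t * v1 x, z.2 + t * v2 x) = v2 z.
Proof.
move=> x0.
have nz y s : 0 < v1 y ^+ 2 + v2 y ^+ 2 ->
    v1 (y.1 + s * v1 x, y.2 + s * v2 x) = v1 y /\ v2 (y.1 + s * v1 x, y.2 + s * v2 x) = v2 y.
  move=> y0; have det := parallel_to_nonzero y x0.
  set P := v1 x in x0 det *; set Q := v2 x in x0 det *.
  pose N := v1 y ^+ 2 + v2 y ^+ 2; pose c := (P * v1 y + Q * v2 y) / N.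
  have N0 : N != 0 by exact: lt0r_neq0.
  have [eP eQ] : P = c * v1 y /\ Q = c * v2 y.
    split; apply: (mulIf N0); rewrite /c mulrAC divfK// /N.
      by apply/eqP; rewrite -subr_eq0; apply/eqP; transitivity (v2 y * (v2 y * P - v1 y * Q)); [ring|rewrite det mulr0].
    by apply/eqP; rewrite -subr_eq0; apply/eqP; transitivity (- v1 y * (v2 y * P - v1 y * Q)); [ring|rewrite det mulr0].
  by rewrite eP eQ !mulrA; exact: constant_along_flow.
have [z0|z0] := ltP 0 (v1 z ^+ 2 + v2 z ^+ 2); first exact: nz.
pose y := (z.1 + t * v1 x, z.2 + t * v2 x).
have back : (y.1 + (- t) * v1 x, y.2 + (- t) * v2 x) = z by rewrite /y /= !mulNr !addrK; case: (z).
have [y0|y0] := ltP 0 (v1 y ^+ 2 + v2 y ^+ 2).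
  by have [] := nz y (- t) y0; rewrite back => -> ->.
have zz w : v1 w ^+ 2 + v2 w ^+ 2 <= 0 -> v1 w = 0 /\ v2 w = 0.
  move=> h; have : v1 w ^+ 2 + v2 w ^+ 2 == 0 by rewrite eq_le h addr_ge0 ?sqr_ge0.
  by rewrite paddr_eq0 ?sqr_ge0// !sqrf_eq0 => /andP[/eqP-> /eqP->].
by have [-> ->] := zz _ y0; have [-> ->] := zz _ z0.
Qed.

Lemma shear_of_local : shear_flow (fun x => (v1 x, v2 x)).
Proof.
have [[x x0]|none] := pselect (exists x, 0 < v1 x ^+ 2 + v2 x ^+ 2); last first.
  (* When [v] vanishes identically any direction will do. *)
  exists (1, 0); first by rewrite /unit_circle /= /enorm /= expr1n expr0n addr0 sqrtr1.
  exists (fun=> 0) => x; rewrite !mul0r.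
  have : v1 x ^+ 2 + v2 x ^+ 2 == 0.
    rewrite eq_le addr_ge0 ?sqr_ge0// andbT leNgt; apply/negP => h; apply: none; by exists x.
  by rewrite paddr_eq0 ?sqr_ge0// !sqrf_eq0 => /andP[/eqP-> /eqP->].
pose P := v1 x; pose Q := v2 x; pose m := Num.sqrt (P ^+ 2 + Q ^+ 2).
have m0 : 0 < m by rewrite sqrtr_gt0.
have mE : m ^+ 2 = P ^+ 2 + Q ^+ 2 by rewrite sqr_sqrtr// ltW.
have mn0 : m != 0 by exact: lt0r_neq0.
have unit1 : (P / m) ^+ 2 + (Q / m) ^+ 2 = 1.
  by rewrite !exprMn -mulrDl -mE exprVn mulfV// expf_neq0.
exists (P / m, Q / m); first by rewrite /unit_circle /= /enorm /= unit1 sqrtr1.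
set e1 := P / m in unit1 *; set e2 := Q / m in unit1 *.
(* The profile is the component of [v] along [e] at the point [s * perp e], which represents the
   line at signed distance [s] from the origin. *)
exists (fun s => v1 (- s * e2, s * e1) * e1 + v2 (- s * e2, s * e1) * e2) => z.
set s := dot z (perp (e1, e2)).
have sE : s = z.2 * e1 - z.1 * e2 by rewrite /s /dot /perp /=; ring.
(* The time needed to move from [z] with velocity [v x], of length [m], to the orthogonal projection
   of [z] on the line spanned by [perp e]. *)
pose t := - (z.1 * e1 + z.2 * e2) / m.
have zE : (z.1 + t * v1 x, z.2 + t * v2 x) = (- s * e2, s * e1).
  have tP : t * v1 x = - (z.1 * e1 + z.2 * e2) * e1 by rewrite /t /e1 -/P; ring.
  have tQ : t * v2 x = - (z.1 * e1 + z.2 * e2) * e2 by rewrite /t /e2 -/Q; ring.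
  rewrite tP tQ sE; congr pair.
    rewrite -[z.1 in LHS]mulr1 -{1}unit1; ring.
  rewrite -[z.2 in LHS]mulr1 -{1}unit1; ring.
have [h1 h2] := constant_along_direction z t x0.
rewrite -zE h1 h2.
have det : v2 z * e1 - v1 z * e2 = 0.
  by rewrite /e1 /e2 !mulrA -mulrBl (parallel_to_nonzero z x0) mul0r.
congr pair => /=.
  by apply/eqP; rewrite -subr_eq0 -[v1 z in X in X - _]mulr1 -{1}unit1; apply/eqP; transitivity (- e2 * (v2 z * e1 - v1 z * e2)); [ring|rewrite det mulr0].
by apply/eqP; rewrite -subr_eq0 -[v2 z in X in X - _]mulr1 -{1}unit1; apply/eqP; transitivity (e1 * (v2 z * e1 - v1 z * e2)); [ring|rewrite det mulr0].
Qed.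
End shear.

(** * Weak formulations and mollified equations *)

Section distributions.
Variable R : realType.
Local Notation R2 := (measurableTypeR R * measurableTypeR R)%type.
Local Notation mu := (@plane R).
Implicit Types (x z : R * R) (f g : R * R -> R) (D : R) (p q : R -> R).

Lemma Lloc_restrict_Lfun (r : \bar R) f (M : R) : Lloc r f -> (f \_ (box M) : R2 -> R) \in Lfun mu r.
Proof.
move=> [mf hf]; rewrite inE; apply/andP; split; rewrite inE /=.
  apply/(measurable_restrictT _ (measurable_box M)).
  exact: measurable_funS mf.
by have := hf _ (@compact_rect R (- M) M (- M) M); rewrite /finite_norm unlock.
Qed.

Lemma Lloc1_locint f : Lloc 1%E f -> locint f.
Proof.
move=> lf; split; first exact: lf.1.
move=> M; have /Lfun1_integrable h := Lloc_restrict_Lfun M lf.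
apply/(integrable_mkcond _ (measurable_box M)).
by rewrite restrict_EFin.
Qed.

Lemma Lloc2_locint f : Lloc 2%:E f -> locint (fun z => f z ^+ 2).
Proof.
move=> lf; split; first by apply: measurable_funX; exact: lf.1.
move=> M; have /Lfun2_integrable_sqr h := Lloc_restrict_Lfun M lf.
apply/(integrable_mkcond _ (measurable_box M)).
rewrite restrict_EFin; congr (integrable _ _ _): h; apply/funext => z /=; congr EFin.
by rewrite !patchE; case: ifP => // _; rewrite expr0n.
Qed.

Lemma smooth_reflect (c : R) p : smooth p -> smooth (fun s => p (c - s)).
Proof.
move=> sp; have -> : (fun s => p (c - s)) = (fun s => p (-1 * s + c)) by apply/funext => s; rewrite mulN1r addrC.
by move=> k; exact: smooth_upto_affine (sp k).
Qed.

Lemma derive1_reflect (c : R) p : smooth p ->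
  derive1 (fun s => p (c - s)) = (fun s => - derive1 p (c - s)).
Proof.
move=> sp; apply: derive1_has_der => s.
have := @has_der_comp_affine _ p (-1) c s (derive1 p (c - s)).
rewrite mulN1r [- s + c]addrC => /(_ (smooth_has_der _ sp)); rewrite mulN1r.
by apply: has_der_ext => t; rewrite mulN1r addrC.
Qed.

Lemma kern_tensor p q x : kern p q x = tensor (fun s => p (x.1 - s)) (fun s => q (x.2 - s)).
Proof. by []. Qed.

Lemma test_kern D p q x : csmooth D p -> csmooth D q -> test_function (kern p q x).
Proof.
move=> [sp p0] [sq q0]; rewrite kern_tensor.
have far (a b s : R) : D + `|a| + b < `|s| -> 0 <= b -> D < `|a - s|.
  by move=> h b0; have := lerB_dist s a; rewrite distrC; lra.
apply: (@test_tensor _ _ _ (D + `|x.1| + `|x.2|)).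
- exact: smooth_reflect.
- exact: smooth_reflect.
- by move=> s hs; apply: p0; exact: far hs _.
- by move=> s; rewrite addrAC => hs; apply: q0; exact: far hs _.
Qed.

Lemma pder_kern1 p q x : smooth p -> smooth q ->
  pder (axis1 R) (kern p q x) = (fun z => - kern (derive1 p) q x z).
Proof.
move=> sp sq; rewrite kern_tensor pder_tensor1; [|exact: smooth_reflect..].
by rewrite derive1_reflect//; apply/funext => z; rewrite /tensor mulNr.
Qed.

Lemma pder_kern2 p q x : smooth p -> smooth q ->
  pder (axis2 R) (kern p q x) = (fun z => - kern p (derive1 q) x z).
Proof.
move=> sp sq; rewrite kern_tensor pder_tensor2; [|exact: smooth_reflect..].
by rewrite derive1_reflect//; apply/funext => z; rewrite /tensor mulrN.
Qed.

Lemma distr_of_opp f (h : R * R -> R) : mu.-integrable setT (EFin \o (fun z => f z * h z)) ->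
  distr_of f (fun z => - h z) = - \int[mu]_z (f z * h z).
Proof.
move=> ih; rewrite -mulN1r -RintegralZl//.
by apply: eq_Rintegral => z _; rewrite mulN1r mulrN.
Qed.

(** Two signs cancel: the one in the distributional derivative and the one from differentiating
    [p (x.1 - z.1)] in [z] instead of [x]. *)
Lemma distr_der_kern1 D f p q x : locint f -> csmooth D p -> csmooth D q ->
  distr_der (axis1 R) (distr_of f) (kern p q x) = conv f (derive1 p) q x.
Proof.
move=> lf hp hq; rewrite /distr_der pder_kern1; [|exact: hp.1|exact: hq.1].
by rewrite distr_of_opp ?opprK//; exact: (conv_integrable (csmooth_derive1 hp) hq).
Qed.

Lemma distr_der_kern2 D f p q x : locint f -> csmooth D p -> csmooth D q ->
  distr_der (axis2 R) (distr_of f) (kern p q x) = conv f p (derive1 q) x.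
Proof.
move=> lf hp hq; rewrite /distr_der pder_kern2; [|exact: hp.1|exact: hq.1].
by rewrite distr_of_opp ?opprK//; exact: (conv_integrable hp (csmooth_derive1 hq)).
Qed.

Lemma mweak_weak_der f g1 g2 : weak_der (axis1 R) f g1 -> weak_der (axis2 R) f g2 -> mweak f g1 g2.
Proof.
move=> [lf _ h1] [_ _ h2] D p q hp hq x; have {}lf := Lloc1_locint lf.
have tk := test_kern x hp hq.
by rewrite -(distr_der_kern1 x lf hp hq) h1// -(distr_der_kern2 x lf hp hq) h2.
Qed.

Lemma test_function_supp phi : test_function phi -> exists M, forall z, ~ box M z -> phi z = 0.
Proof.
move=> [_ /compact_bounded [M0 [_ hM]]]; exists (M0 + 1) => z nz; apply/eqP/negPn/negP => zn0; apply: nz.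
have sz : supp phi z by apply: subset_closure.
have M01 : M0 < M0 + 1 by rewrite ltrDl.
(* The norm on the product is the maximum norm, so a norm bound is a box bound. *)
have : Num.max `|z.1| `|z.2| <= M0 + 1 by exact: (hM _ M01 z sz).
rewrite ge_max !ler_norml => /andP[? ?]; by split.
Qed.

Lemma integrable_test f phi : locint f -> test_function phi ->
  mu.-integrable setT (EFin \o (fun z => f z * phi z)).
Proof.
move=> lf tphi; have [M hM] := test_function_supp tphi.
apply: (@integrable_box_supp _ _ M); first by move=> z /hM ->; rewrite mulr0.
exact: (locintM_cont lf (tphi.1 0)).2.
Qed.

Lemma locally_ae_eq f g M : locint f -> locint g ->
  (forall phi, test_function phi -> distr_of f phi = distr_of g phi) ->
  {ae mu, forall z, box M z -> f z = g z}.
Proof.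
move=> lf lg h.
have : ae_eq mu (box M) (EFin \o (fun z => f z - g z)) (cst 0%E).
  apply: (test_ae_eq0 M (locintB lf lg)) => phi tphi.
  have := h _ tphi; rewrite /distr_of => e.
  transitivity (\int[mu]_z (f z * phi z - g z * phi z)).
    by apply: eq_Rintegral => z _; rewrite mulrBl.
  rewrite RintegralB//; [|exact: integrable_test..].
  by apply/eqP; rewrite subr_eq0; apply/eqP; exact: e.
apply: filterS => z hz bz; have := hz bz => /= -[] /eqP; rewrite subr_eq0 => /eqP; exact.
Qed.

Lemma conv_ae D f g p q x : locint f -> locint g -> csmooth D p -> csmooth D q ->
  (forall M, {ae mu, forall z, box M z -> f z = g z}) -> conv f p q x = conv g p q x.
Proof.
move=> lf lg hp hq fg.
rewrite (conv_boxE hp hq f (in_box x)) (conv_boxE hp hq g (in_box x)); congr fine.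
apply: ae_eq_integral.
- exact: measurable_box.
- exact: (measurable_int _ (conv_integrable_box hp hq _ _ lf)).
- exact: (measurable_int _ (conv_integrable_box hp hq _ _ lg)).
by have := fg (`|x.1| + `|x.2| + D); apply: (@filterS _ _ (ae_filter_ringOfSetsType mu)) => z h bz; rewrite /= h.
Qed.
End distributions.

Section euler.
Variable R : realType.
Local Notation R2 := (measurableTypeR R * measurableTypeR R)%type.
Local Notation mu := (@plane R).
Implicit Types (x z : R * R).

(** The gradients given by [H1loc] and those inside [steady_euler] may be different representatives,
    so they are first identified almost everywhere. Incompressibility, as [A1 = - B2], turns the
    components of [v1 grad v2 - v2 grad v1] into [F2] and [- F1], and its divergence into the curl
    of the Euler system. *)
Lemma flow_data_of_euler (v : R * R -> R * R) : H1loc v -> continuous v -> steady_euler v ->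
  exists A1 A2 B1 B2, flow_data (fun x => (v x).1) (fun x => (v x).2) A1 A2 B1 B2.
Proof.
move=> [[_ [A1 [A2 [wA1 wA2 LA1 LA2]]]] [_ [B1 [B2 [wB1 wB2 LB1 LB2]]]]] cv.
move=> [P [_ [g1 [g2 [[wg11 wg12] [wg21 wg22] eqs]]]]].
set v1 := fun x => (v x).1; set v2 := fun x => (v x).2.
have cv1 : continuous v1 by move=> x; apply: (@continuous_comp _ _ _ v fst); [exact: cv|exact: cont_at_fst].
have cv2 : continuous v2 by move=> x; apply: (@continuous_comp _ _ _ v snd); [exact: cv|exact: cont_at_snd].
have lv1 := cont_locint cv1; have lv2 := cont_locint cv2.
have [_ /Lloc1_locint lA1 eA1] := wA1; have [_ /Lloc1_locint lA2 eA2] := wA2.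
have [_ /Lloc1_locint lB1 eB1] := wB1; have [_ /Lloc1_locint lB2 eB2] := wB2.
have [_ /Lloc1_locint lg11 eg11] := wg11; have [_ /Lloc1_locint lg12 eg12] := wg12.
have [_ /Lloc1_locint lg21 eg21] := wg21; have [_ /Lloc1_locint lg22 eg22] := wg22.
have ae11 M : {ae mu, forall z, box M z -> (g1 z).1 = A1 z}.
  by apply: (locally_ae_eq M lg11 lA1) => phi t; rewrite -eg11// -eA1.
have ae12 M : {ae mu, forall z, box M z -> (g1 z).2 = A2 z}.
  by apply: (locally_ae_eq M lg12 lA2) => phi t; rewrite -eg12// -eA2.
have ae21 M : {ae mu, forall z, box M z -> (g2 z).1 = B1 z}.
  by apply: (locally_ae_eq M lg21 lB1) => phi t; rewrite -eg21// -eB1.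
have ae22 M : {ae mu, forall z, box M z -> (g2 z).2 = B2 z}.
  by apply: (locally_ae_eq M lg22 lB2) => phi t; rewrite -eg22// -eB2.
have aediv M : {ae mu, forall z, box M z -> A1 z = - B2 z}.
  apply: (locally_ae_eq M lA1 (locintN lB2)) => phi t.
  have [_ _] := eqs phi t; rewrite eA1// eB2// => h.
  have -> : distr_of (fun z => - B2 z) phi = - distr_of B2 phi.
    rewrite /distr_of -mulN1r -RintegralZl//; last exact: (integrable_test lB2 t).
    by apply: eq_Rintegral => z _; rewrite mulN1r mulNr.
  by apply/eqP; rewrite -addr_eq0; apply/eqP.
have cM1 f : locint f -> locint (fun z => v1 z * f z).
  by move=> lf; have := locintM_cont lf cv1; congr locint; apply/funext => z; rewrite mulrC.
have cM2 f : locint f -> locint (fun z => v2 z * f z).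
  by move=> lf; have := locintM_cont lf cv2; congr locint; apply/funext => z; rewrite mulrC.
pose F1 z := dot (v z) (g1 z); pose F2 z := dot (v z) (g2 z).
have lF1 : locint F1 by apply: locintD; [exact: cM1|exact: cM2].
have lF2 : locint F2 by apply: locintD; [exact: cM1|exact: cM2].
have lG1 : locint (fun z => v1 z * B1 z - v2 z * A1 z) by apply: locintB; [exact: cM1|exact: cM2].
have lG2 : locint (fun z => v1 z * B2 z - v2 z * A2 z) by apply: locintB; [exact: cM1|exact: cM2].
exists A1, A2, B1, B2; split.
- exact: cv1.
- exact: cv2.
- exact: lA1.1.
- exact: lA2.1.
- exact: lB1.1.
- exact: lB2.1.
- exact: Lloc2_locint.
- exact: Lloc2_locint.
- exact: Lloc2_locint.
- exact: Lloc2_locint.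
- exact: mweak_weak_der.
- exact: mweak_weak_der.
- move=> D p q hp hq x.
  have [_ _] := eqs _ (test_kern x hp hq).
  by rewrite (distr_der_kern1 x lv1 hp hq) (distr_der_kern2 x lv2 hp hq).
move=> D p q hp hq x.
have hp' := csmooth_derive1 hp; have hq' := csmooth_derive1 hq.
(* The first equation is tested with a kernel differentiated in the second variable and the second
   with one differentiated in the first: the pressure is then evaluated at the same mixed derivative
   in both and cancels. *)
have [e1 _ _] := eqs _ (test_kern x hp hq').
have [_ e2 _] := eqs _ (test_kern x hp' hq).
have eqF : conv F1 p (derive1 q) x = conv F2 (derive1 p) q x.
  move: e1 e2; rewrite /distr_der pder_kern1 ?pder_kern2; [|exact: hp'.1|exact: hq.1|exact: hp.1|exact: hq'.1].
  rewrite -[distr_of (fun z => dot (v z) (g1 z)) _]/(conv F1 p (derive1 q) x).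
  rewrite -[distr_of (fun z => dot (v z) (g2 z)) _]/(conv F2 (derive1 p) q x).
  by move=> h1 h2; apply: (@addIr _ (- P (fun z => - kern (derive1 p) (derive1 q) x z))); rewrite h1 h2.
have -> : conv (fun z => v1 z * B1 z - v2 z * A1 z) (derive1 p) q x = conv F2 (derive1 p) q x.
  apply: (conv_ae x lG1 lF2 hp' hq) => M.
  have h1 := ae21 M; have h2 := ae22 M; have h3 := aediv M.
  apply: (@filterS3 _ _ (ae_filter_ringOfSetsType mu) _ _ _ _ _ h1 h2 h3) => z k1 k2 k3 bz.
  by rewrite /F2 /dot k1// k2// k3// mulrN opprK.
have -> : conv (fun z => v1 z * B2 z - v2 z * A2 z) p (derive1 q) x = - conv F1 p (derive1 q) x.
  rewrite -mulN1r -(convZ hp hq' (-1) x lF1).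
  apply: (conv_ae x lG2 (locintZ (-1) lF1) hp hq') => M.
  have h1 := ae11 M; have h2 := ae12 M; have h3 := aediv M.
  apply: (@filterS3 _ _ (ae_filter_ringOfSetsType mu) _ _ _ _ _ h1 h2 h3) => z k1 k2 k3 bz.
  by rewrite /F1 /dot k1// k2// k3// mulN1r mulrN opprD opprK.
by rewrite eqF subrr.
Qed.

(** The box lies in the disc of radius [r = 2^(j + 4)], and [ln r <= j + 4 <= 4 * (j + 1)]. The
    condition [3 <= j] gives [r >= 128], so that the growth bound applies. *)
Lemma growth_on_boxes (v : R * R -> R * R) (C : R) : 0 < C ->
  (forall r : R, 100 < r ->
     (ereal_sup [set (enorm (v x))%:E | x in [set x : R * R | (enorm x <= r)%R]]
            <= (C * Num.sqrt (ln r))%:E)%E) ->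
  forall j x, (3 <= j)%N -> box (2 * 2 ^+ j.+1 + 1) x ->
    (v x).1 ^+ 2 + (v x).2 ^+ 2 <= (4 * C ^+ 2) * j.+1%:R.
Proof.
move=> C0 h j x j3 [/andP[x1 x2] /andP[x3 x4]].
have n16 : 16 <= 2 ^+ j.+1 :> R.
  have -> : 16 = 2 ^+ 4 :> R by ring.
  by apply: ler_weXn2l => //; rewrite ler1n.
pose r : R := 8 * 2 ^+ j.+1.
have r100 : 100 < r by rewrite /r; lra.
have ex : enorm x <= r.
  rewrite /enorm -[leRHS]ger0_norm; last by rewrite /r; lra.
  rewrite -sqrtr_sqr ler_sqrt ?sqr_ge0//.
  have sq1 (t : R) : - (2 * 2 ^+ j.+1 + 1) <= t -> t <= 2 * 2 ^+ j.+1 + 1 -> t ^+ 2 <= (3 * 2 ^+ j.+1) ^+ 2.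
    move=> t1 t2; rewrite -real_normK ?num_real// ler_sqr ?nnegrE//.
    by rewrite ler_norml; apply/andP; split; lra.
  have s1 := sq1 _ x1 x2; have s2 := sq1 _ x3 x4.
  have : 0 <= (2 ^+ j.+1 : R) ^+ 2 by exact: sqr_ge0.
  by move: s1 s2; rewrite /r !exprMn; lra.
have : ((enorm (v x))%:E <= (C * Num.sqrt (ln r))%:E)%E.
  by apply: le_trans (h r r100); apply: ereal_sup_ubound; exists x.
rewrite lee_fin => hv.
have lnr0 : 0 <= ln r by apply: ln_ge0; lra.
have ln2 : ln (2 : R) <= 1.
  by have := @le_ln1Dx R 1; rewrite -[1 + 1]/(2 : R); apply; lra.
have lnr : ln r <= 4 * j.+1%:R.
  have -> : r = 2 ^+ (3 + j.+1) by rewrite exprD /r; ring.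
  rewrite lnXn// -[ln 2 *+ _]mulr_natl (natrD _ 3%N j.+1).
  have j0 : 1 <= j.+1%:R :> R by rewrite ler1n.
  have k0 : 0 <= 3 + j.+1%:R :> R by lra.
  have := ler_wpM2l k0 ln2; lra.
have e0 : 0 <= enorm (v x) by exact: sqrtr_ge0.
have : enorm (v x) ^+ 2 <= (C * Num.sqrt (ln r)) ^+ 2.
  by rewrite ler_sqr ?nnegrE// mulr_ge0 ?sqrtr_ge0// ltW.
rewrite exprMn /enorm !sqr_sqrtr ?addr_ge0 ?sqr_ge0// => hle.
apply: le_trans hle _; have -> : 4 * C ^+ 2 * j.+1%:R = C ^+ 2 * (4 * j.+1%:R) by ring.
by apply: ler_wpM2l lnr; exact: sqr_ge0.
Qed.

(** * Missing directions and conclusion *)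

(** Angles are measured from [- e], so that the slit is the half-line of the missing direction [e].
    Failure of the inequality is the equality case of Cauchy-Schwarz and forces [v x] to be a
    positive multiple of [e]. *)
Lemma slit_of_missing_angle (v : R * R -> R * R) (e : R * R) : unit_circle e ->
  ~ flow_angles v setT e -> forall x, 0 < (v x).1 ^+ 2 + (v x).2 ^+ 2 ->
  0 < Num.sqrt ((v x).1 ^+ 2 + (v x).2 ^+ 2) + ((v x).1 * - e.1 + (v x).2 * - e.2).
Proof.
rewrite /unit_circle /= /enorm => ue miss x n0.
have ue2 : e.1 ^+ 2 + e.2 ^+ 2 = 1.
  by rewrite -[LHS]sqr_sqrtr ?addr_ge0 ?sqr_ge0// ue expr1n.
rewrite ltNge; apply/negP => le0; apply: miss; exists x.
  by split => //; rewrite /enorm sqrtr_gt0.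
have m2 : enorm (v x) ^+ 2 = (v x).1 ^+ 2 + (v x).2 ^+ 2 by rewrite /enorm sqr_sqrtr// ltW.
have m0 : 0 < enorm (v x) by rewrite /enorm sqrtr_gt0.
move: le0; rewrite -/(enorm (v x)).
move: (enorm (v x)) m2 m0 => m m2 m0 le0.
have h : ((v x).1 - m * e.1) ^+ 2 + ((v x).2 - m * e.2) ^+ 2 <= 0.
  have -> : ((v x).1 - m * e.1) ^+ 2 + ((v x).2 - m * e.2) ^+ 2 =
     (v x).1 ^+ 2 + (v x).2 ^+ 2 + m ^+ 2 * (e.1 ^+ 2 + e.2 ^+ 2) -
     2 * (m * ((v x).1 * e.1 + (v x).2 * e.2)) by ring.
  rewrite ue2 -m2; have := mulr_ge0_le0 (ltW m0) le0; rewrite mulrDr !mulrN; lra.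
have : ((v x).1 - m * e.1) ^+ 2 + ((v x).2 - m * e.2) ^+ 2 == 0 by rewrite eq_le h addr_ge0 ?sqr_ge0.
rewrite paddr_eq0 ?sqr_ge0// !sqrf_eq0 !subr_eq0 => /andP[/eqP-> /eqP->].
by rewrite ![m * _]mulrC !mulfK ?gt_eqF//; case: (e).
Qed.

(** The arc has centre [theta0] and half-width [pi - beta < pi]. Comparing cosines of the difference
    to the centre avoids tracking multiples of [2 * pi]. *)
Lemma antipode_notin_arc (theta0 beta : R) : 0 < beta -> beta < pi ->
  ~ arc_set theta0 beta (cos (theta0 + pi), sin (theta0 + pi)).
Proof.
move=> b0 bpi [theta /andP[t1 t2] [ec es]].
have : cos (theta - theta0) = - 1.
  have h : cos (theta - (theta0 + pi)) = 1.
    by rewrite cosB ec es -!expr2 cos2Dsin2.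
  have -> : theta - theta0 = (theta - (theta0 + pi)) + pi by ring.
  by rewrite cosDpi h.
have : cos pi < cos `|theta - theta0|.
  have a0 : `|theta - theta0| <= pi - beta by rewrite ler_norml; apply/andP; split; lra.
  by rewrite ltr_cos ?in_itv /= ?normr_ge0 ?pi_ge0 /=; lra.
by rewrite cos_norm cospi => h1 h2; rewrite h2 ltxx in h1.
Qed.

Lemma shear_of_missing_angle (v : R * R -> R * R) (C : R) (e : R * R) : H1loc v -> continuous v ->
  steady_euler v -> 0 < C ->
  (forall r : R, 100 < r ->
     (ereal_sup [set (enorm (v x))%:E | x in [set x : R * R | (enorm x <= r)%R]]
            <= (C * Num.sqrt (ln r))%:E)%E) ->
  unit_circle e -> ~ flow_angles v setT e -> shear_flow v.
Proof.
move=> vH cv euler C0 growth ue miss.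
have [A1 [A2 [B1 [B2 fd]]]] := flow_data_of_euler vH cv euler.
have -> : v = (fun x => ((v x).1, (v x).2)) by apply/funext => x; case: (v x).
apply: shear_of_local; [exact: (flow_cont1 fd)|exact: (flow_cont2 fd)|].
move=> x x0.
have ue2 : (- e.1) ^+ 2 + (- e.2) ^+ 2 = 1.
  by rewrite !sqrrN -[LHS]sqr_sqrtr ?addr_ge0 ?sqr_ge0// [Num.sqrt _]ue expr1n.
have C4 : 0 < 4 * C ^+ 2 by rewrite mulr_gt0// exprn_gt0.
have [r r0 par] := locally_parallel fd ue2 (slit_of_missing_angle ue miss) C4 (growth_on_boxes C0 growth) x0.
exact: (locally_constant_along fd r0 par).
Qed.
End euler.

Theorem theorem1p1 (R : realType) (v : R * R -> R * R)
    (v_H1loc : H1loc v) (v_cont : continuous v)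
    (v_euler : steady_euler v)
    (v_growth : exists2 C : R, 0 < C &
       forall r : R, 100 < r ->
         (ereal_sup [set (enorm (v x))%:E | x in [set x : R * R | (enorm x <= r)%R]]
            <= (C * Num.sqrt (ln r))%:E)%E) :
  ((exists theta0 beta : R,
      [/\ 0 < beta, beta < pi & flow_angles v setT `<=` arc_set theta0 beta]) ->
    shear_flow v) /\
  (Wloc_field 2 1%E v ->
    shear_flow v \/ flow_angles v setT = @unit_circle R).
Proof.
have [C C0 growth] := v_growth.
have miss e : unit_circle e -> ~ flow_angles v setT e -> shear_flow v.
  exact: shear_of_missing_angle v_H1loc v_cont v_euler C0 growth.
split=> [[theta0 [beta [b0 bpi sub]]]|_].
  (* The direction opposite to the centre of the arc is missed, because [beta] is positive. *)
  apply: (miss (cos (theta0 + pi), sin (theta0 + pi))).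
    by rewrite /unit_circle /= /enorm /= cos2Dsin2 sqrtr1.
  by move=> /sub; exact: antipode_notin_arc.
have [all|] := pselect (forall e, unit_circle e -> flow_angles v setT e).
  right; apply/seteqP; split=> [_ [x [_ m0] <-]|//].
  have m2 : (v x).1 ^+ 2 + (v x).2 ^+ 2 = enorm (v x) ^+ 2.
    by rewrite /enorm sqr_sqrtr// addr_ge0 ?sqr_ge0.
  rewrite /unit_circle /= {1}/enorm /= !exprMn -mulrDl m2 -exprMn mulfV ?expr1n ?sqrtr1//.
  exact: lt0r_neq0.
by move=> /existsNP[e /not_implyP[ue ne]]; left; exact: (miss e).
Qed.
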